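(* Let $A$ be the gentle Gorenstein $R$-algebra over $R=k\llbracket c\rrbracket$ associated with a gentle quiver $(Q,I)$ all of whose arrows lie on admissible cycles (see context). Let $Q_1^{dc}$ be the set of all arrows of $Q$ which appear in differential cycles, and for each arrow $\alpha$ let $L_\alpha=A\alpha$. The singularity category $\mathbf{D}_{\mathrm{sg}}(A)$ has the following description. (1) The assignment $\alpha\mapsto L_\alpha$, with $L_\alpha$ viewed as an object of $\mathbf{D}_{\mathrm{sg}}(A)$, is a bijection from $Q_1^{dc}$ to the set of isomorphism classes of indecomposable objects of $\mathbf{D}_{\mathrm{sg}}(A)$. (2) For any $\alpha,\beta\in Q_1^{dc}$ one has $\dim_k\operatorname{Hom}_{\mathbf{D}_{\mathrm{sg}}(A)}(L_\alpha,L_\beta)=\delta_{\alpha\beta}$ (Kronecker delta). (3) For any $\alpha\in Q_1^{dc}$ there are isomorphisms in $\mathbf{D}_{\mathrm{sg}}(A)$ $$\omega_{A/R}\otimes^{\mathrm L}_A L_\alpha\cong L_\alpha\qquad\text{and}\qquad \Sigma^{-1}(L_\alpha)\cong L_{\varrho(\alpha)},$$ where $\varrho(\alpha)$ denotes the unique arrow with $s(\varrho(\alpha))=t(\alpha)$ and $\varrho(\alpha)\alpha\in I$.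
   Context: Let $k$ be a field. Paths are composed from right to left and modules are left modules. Let $Q=(Q_0,Q_1,s,t)$ be a finite quiver and $I$ an ideal of $kQ$ generated by paths of length two such that each vertex is of one of two types (loops count both as starting and as ending): a 2-regular vertex with gentle relations, i.e. exactly two arrows end and exactly two arrows start at $i$, for each arrow $\alpha$ ending at $i$ exactly one of the two arrows $\beta$ starting at $i$ satisfies $\beta\alpha\in I$, and for each arrow $\beta$ starting at $i$ exactly one of the two arrows $\alpha$ ending at $i$ satisfies $\beta\alpha\in I$; or a transition vertex, i.e. exactly one arrow $\alpha$ ends and exactly one arrow $\beta$ starts there, and $\beta\alpha\notin I$. (This expresses that $(Q,I)$ is gentle and every arrow lies on an admissible cycle.) For $\alpha\in Q_1$ let $\sigma(\alpha)$ be the unique arrow with $s(\sigma(\alpha))=t(\alpha)$ and $\sigma(\alpha)\alpha\notin I$; let $\ell_\alpha\ge1$ be minimal with $\sigma^{\ell_\alpha}(\alpha)=\alpha$, and $c_\alpha=\sigma^{\ell_\alpha-1}(\alpha)\cdots\sigma(\alpha)\alpha$ (the admissible cycle beginning with $\alpha$). Let $A$ be the completion of $kQ/I$ with respect to its arrow ideal, regarded as an algebra over $R=k\llbracket c\rrbracket$ via $c\mapsto\sum_{\alpha\in Q_1}c_\alpha$. Then $A$ is a Gorenstein $R$-algebra (finite projective over $R$ with Iwanaga--Gorenstein localisations). A differential cycle is a cyclic path $\alpha_n\cdots\alpha_1$ ($n\ge1$) in $Q$ of pairwise distinct arrows with $s(\alpha_{i+1})=t(\alpha_i)$ and $\alpha_{i+1}\alpha_i\in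 I$ for $1\le i<n$, and $s(\alpha_1)=t(\alpha_n)$ and $\alpha_1\alpha_n\in I$. $\mathbf{D}_{\mathrm{sg}}(A)$ is the Verdier quotient of the bounded derived category $\mathbf{D}^{\mathrm b}(\operatorname{mod}A)$ of finitely generated $A$-modules by the thick subcategory of perfect complexes, with suspension $\Sigma$. The dualising bimodule is $\omega_{A/R}=\operatorname{Hom}_R(A,R)$ with $(afb)(x)=f(bxa)$; the functor $\omega_{A/R}\otimes_A^{\mathrm L}-$ preserves perfect complexes and induces a functor on $\mathbf{D}_{\mathrm{sg}}(A)$. *)

(* Defs.v *)
From HB Require Import structures.
From mathcomp Require Import all_boot all_order all_algebra.
From mathcomp Require Import boolp.

Set Implicit Arguments.
Unset Strict Implicit.
Unset Printing Implicit Defensive.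

Import Order.TTheory GRing.Theory Num.Theory.
Local Open Scope ring_scope.


(* Hom-sets are setoids: [heq] is the equality of morphisms. *)
Record lincat (k : fieldType) := LinCat {
  ob :> Type;
  hom : ob -> ob -> Type;
  heq : forall X Y, hom X Y -> hom X Y -> Prop;
  idm : forall X, hom X X;
  hcomp : forall X Y Z, hom Y Z -> hom X Y -> hom X Z;
  hzero : forall X Y, hom X Y;
  hadd : forall X Y, hom X Y -> hom X Y -> hom X Y;
  hscale : forall X Y, k -> hom X Y -> hom X Y;
  heq_refl : forall X Y (f : hom X Y), heq f f;
  heq_sym : forall X Y (f g : hom X Y), heq f g -> heq g f;
  heq_trans : forall X Y (f g h : hom X Y), heq f g -> heq g h -> heq f h;
  hcomp_cong : forall X Y Z (f f' : hom Y Z) (g g' : hom X Y),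
    heq f f' -> heq g g' -> heq (hcomp f g) (hcomp f' g');
  hadd_cong : forall X Y (f f' g g' : hom X Y),
    heq f f' -> heq g g' -> heq (hadd f g) (hadd f' g');
  hscale_cong : forall X Y a (f f' : hom X Y),
    heq f f' -> heq (hscale a f) (hscale a f');
  hcompA : forall X Y Z T (f : hom Z T) (g : hom Y Z) (h : hom X Y),
    heq (hcomp f (hcomp g h)) (hcomp (hcomp f g) h);
  hcomp1f : forall X Y (f : hom X Y), heq (hcomp (idm Y) f) f;
  hcompf1 : forall X Y (f : hom X Y), heq (hcomp f (idm X)) f;
  haddA : forall X Y (f g h : hom X Y),
    heq (hadd f (hadd g h)) (hadd (hadd f g) h);
  haddC : forall X Y (f g : hom X Y), heq (hadd f g) (hadd g f);
  hadd0f : forall X Y (f : hom X Y), heq (hadd (hzero X Y) f) f;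
  haddN1f : forall X Y (f : hom X Y), heq (hadd (hscale (-1) f) f) (hzero X Y);
  hscaleA : forall X Y a b (f : hom X Y),
    heq (hscale a (hscale b f)) (hscale (a * b) f);
  hscale1 : forall X Y (f : hom X Y), heq (hscale 1 f) f;
  hscaleDr : forall X Y a (f g : hom X Y),
    heq (hscale a (hadd f g)) (hadd (hscale a f) (hscale a g));
  hscaleDl : forall X Y a b (f : hom X Y),
    heq (hscale (a + b) f) (hadd (hscale a f) (hscale b f));
  hcompDl : forall X Y Z (f f' : hom Y Z) (g : hom X Y),
    heq (hcomp (hadd f f') g) (hadd (hcomp f g) (hcomp f' g));
  hcompDr : forall X Y Z (f : hom Y Z) (g g' : hom X Y),
    heq (hcomp f (hadd g g')) (hadd (hcomp f g) (hcomp f g'));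
  hcompZl : forall X Y Z a (f : hom Y Z) (g : hom X Y),
    heq (hcomp (hscale a f) g) (hscale a (hcomp f g));
  hcompZr : forall X Y Z a (f : hom Y Z) (g : hom X Y),
    heq (hcomp f (hscale a g)) (hscale a (hcomp f g))
}.

Arguments heq {k l X Y} _ _.
Arguments idm {k l} X.
Arguments hcomp {k l X Y Z} _ _.
Arguments hzero {k l} X Y.
Arguments hadd {k l X Y} _ _.
Arguments hscale {k l X Y} _ _.

Notation "f =h g" := (heq f g) (at level 70, no associativity).

Section LinCatNotions.
Variables (k : fieldType) (C : lincat k).
Implicit Types X Y Z : C.

Definition is_inverse X Y (f : hom X Y) (g : hom Y X) : Prop :=
  hcomp g f =h idm X /\ hcomp f g =h idm Y.

Definition is_iso X Y (f : hom X Y) : Prop := exists g, is_inverse f g.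

Definition isomorphic X Y : Prop := exists f : hom X Y, is_iso f.

Definition is_zero X : Prop := idm X =h hzero X X.

Definition is_biproduct X Y Z : Prop :=
  exists (i : hom X Z) (j : hom Y Z) (p : hom Z X) (q : hom Z Y),
    [/\ hcomp p i =h idm X, hcomp q j =h idm Y,
        hcomp q i =h hzero X Y, hcomp p j =h hzero Y X
      & hadd (hcomp i p) (hcomp j q) =h idm Z].

Definition indecomposable Z : Prop :=
  ~ is_zero Z /\ forall X Y, is_biproduct X Y Z -> is_zero X \/ is_zero Y.

Definition lin_comb X Y n (e : 'I_n -> hom X Y) (c : 'I_n -> k) : hom X Y :=
  \big[hadd/hzero X Y]_(i < n) hscale (c i) (e i).

(* The vector space Hom(X, Y) has dimension [n]: it has a basis [e] indexed
   by ['I_n]. *)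
Definition hom_dim X Y (n : nat) : Prop :=
  exists e : 'I_n -> hom X Y,
    (forall f : hom X Y, exists c, f =h lin_comb e c) /\
    (forall c, lin_comb e c =h hzero X Y -> forall i, c i = 0).

End LinCatNotions.

(* The localisation C[S^-1] of a linear category at a class S of morphisms:
   it has the same objects, its morphisms are generated by those of C and by
   formal inverses of the elements of S, and its relations are those of C,
   those making the elements of S invertible, and the axioms of a linear
   category.  For a Verdier quotient this is the usual category of fractions,
   whose linear structure is the only one for which C -> C[S^-1] is linear. *)
Section Localisation.
Variables (k : fieldType) (C : lincat k).
Variable S : forall X Y : C, hom X Y -> Prop.

Inductive zigzag : C -> C -> Type :=
| zz_of X Y (f : hom X Y) : zigzag X Y
| zz_inv X Y (s : hom X Y) (Ss : S s) : zigzag Y X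
| zz_comp X Y Z (f : zigzag Y Z) (g : zigzag X Y) : zigzag X Z
| zz_add X Y (f g : zigzag X Y) : zigzag X Y
| zz_scale X Y (a : k) (f : zigzag X Y) : zigzag X Y.

Inductive zz_eq : forall X Y : C, zigzag X Y -> zigzag X Y -> Prop :=
| zz_refl X Y (f : zigzag X Y) : zz_eq f f
| zz_sym X Y (f g : zigzag X Y) : zz_eq f g -> zz_eq g f
| zz_trans X Y (f g h : zigzag X Y) : zz_eq f g -> zz_eq g h -> zz_eq f h
| zz_comp_cong X Y Z (f f' : zigzag Y Z) (g g' : zigzag X Y) :
    zz_eq f f' -> zz_eq g g' -> zz_eq (zz_comp f g) (zz_comp f' g')
| zz_add_cong X Y (f f' g g' : zigzag X Y) :
    zz_eq f f' -> zz_eq g g' -> zz_eq (zz_add f g) (zz_add f' g')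
| zz_scale_cong X Y a (f f' : zigzag X Y) :
    zz_eq f f' -> zz_eq (zz_scale a f) (zz_scale a f')
| zz_of_cong X Y (f f' : hom X Y) : f =h f' -> zz_eq (zz_of f) (zz_of f')
| zz_of_comp X Y Z (f : hom Y Z) (g : hom X Y) :
    zz_eq (zz_of (hcomp f g)) (zz_comp (zz_of f) (zz_of g))
| zz_of_add X Y (f g : hom X Y) :
    zz_eq (zz_of (hadd f g)) (zz_add (zz_of f) (zz_of g))
| zz_of_scale X Y a (f : hom X Y) :
    zz_eq (zz_of (hscale a f)) (zz_scale a (zz_of f))
| zz_invl X Y (s : hom X Y) (Ss : S s) :
    zz_eq (zz_comp (zz_inv Ss) (zz_of s)) (zz_of (idm X))
| zz_invr X Y (s : hom X Y) (Ss : S s) :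
    zz_eq (zz_comp (zz_of s) (zz_inv Ss)) (zz_of (idm Y))
| zz_compA X Y Z T (f : zigzag Z T) (g : zigzag Y Z) (h : zigzag X Y) :
    zz_eq (zz_comp f (zz_comp g h)) (zz_comp (zz_comp f g) h)
| zz_comp1f X Y (f : zigzag X Y) : zz_eq (zz_comp (zz_of (idm Y)) f) f
| zz_compf1 X Y (f : zigzag X Y) : zz_eq (zz_comp f (zz_of (idm X))) f
| zz_addA X Y (f g h : zigzag X Y) :
    zz_eq (zz_add f (zz_add g h)) (zz_add (zz_add f g) h)
| zz_addC X Y (f g : zigzag X Y) : zz_eq (zz_add f g) (zz_add g f)
| zz_add0f X Y (f : zigzag X Y) : zz_eq (zz_add (zz_of (hzero X Y)) f) f
| zz_addN1f X Y (f : zigzag X Y) :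
    zz_eq (zz_add (zz_scale (-1) f) f) (zz_of (hzero X Y))
| zz_scaleA X Y a b (f : zigzag X Y) :
    zz_eq (zz_scale a (zz_scale b f)) (zz_scale (a * b) f)
| zz_scale1 X Y (f : zigzag X Y) : zz_eq (zz_scale 1 f) f
| zz_scaleDr X Y a (f g : zigzag X Y) :
    zz_eq (zz_scale a (zz_add f g)) (zz_add (zz_scale a f) (zz_scale a g))
| zz_scaleDl X Y a b (f : zigzag X Y) :
    zz_eq (zz_scale (a + b) f) (zz_add (zz_scale a f) (zz_scale b f))
| zz_compDl X Y Z (f f' : zigzag Y Z) (g : zigzag X Y) :
    zz_eq (zz_comp (zz_add f f') g) (zz_add (zz_comp f g) (zz_comp f' g))
| zz_compDr X Y Z (f : zigzag Y Z) (g g' : zigzag X Y) :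
    zz_eq (zz_comp f (zz_add g g')) (zz_add (zz_comp f g) (zz_comp f g'))
| zz_compZl X Y Z a (f : zigzag Y Z) (g : zigzag X Y) :
    zz_eq (zz_comp (zz_scale a f) g) (zz_scale a (zz_comp f g))
| zz_compZr X Y Z a (f : zigzag Y Z) (g : zigzag X Y) :
    zz_eq (zz_comp f (zz_scale a g)) (zz_scale a (zz_comp f g)).

Definition localisation : lincat k :=
  @LinCat k C zigzag zz_eq (fun X => zz_of (idm X)) zz_comp
    (fun X Y => zz_of (hzero X Y)) zz_add zz_scale
    zz_refl zz_sym zz_trans zz_comp_cong zz_add_cong zz_scale_cong
    zz_compA zz_comp1f zz_compf1 zz_addA zz_addC zz_add0f zz_addN1f
    zz_scaleA zz_scale1 zz_scaleDr zz_scaleDl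
    zz_compDl zz_compDr zz_compZl zz_compZr.

Definition loc_map (X Y : C) (f : hom X Y) :
  @hom k localisation X Y := zz_of f.

End Localisation.


Section Modules.
Variable A : pzRingType.

Definition fin_gen (M : lmodType A) : Prop :=
  exists n (g : 'I_n -> M), forall x, exists a : 'I_n -> A,
    x = \sum_(i < n) a i *: g i.

Definition projective (P : lmodType A) : Prop :=
  forall (M N : lmodType A) (p : {linear M -> N}) (f : {linear P -> N}),
    (forall y, exists x, p x = y) ->
    exists g : {linear P -> M}, forall x, p (g x) = f x.

Lemma fin_gen_prod (M N : lmodType A) :
  fin_gen M -> fin_gen N -> fin_gen (M * N)%type.
Proof.
move=> [m [g Hg]] [n [h Hh]].
exists (m + n)%N, (fun i => match split i with
  | inl j => (g j, 0) | inr j => (0, h j) end) => -[x y].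
have [a ->] := Hg x; have [b ->] := Hh y.
exists (fun i => match split i with inl j => a j | inr j => b j end).
rewrite big_split_ord /=.
have sl (i : 'I_m) : split (lshift n i) = inl i by exact: (unsplitK (inl i)).
have sr (i : 'I_n) : split (rshift m i) = inr i by exact: (unsplitK (inr i)).
rewrite (eq_bigr (fun i => a i *: (g i, 0 : N))); last by move=> i _; rewrite sl.
rewrite [X in _ + X](eq_bigr (fun i => b i *: (0 : M, h i))); last first.
  by move=> i _; rewrite sr.
have -> : \sum_(i < m) a i *: (g i, 0 : N) = (\sum_(i < m) a i *: g i, 0).
  elim/big_rec2: _ => [//|i p q _ ->]; apply/pair_equal_spec; split=> //=.
  by rewrite scaler0 addr0.
have -> : \sum_(i < n) b i *: (0 : M, h i) = (0, \sum_(i < n) b i *: h i).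
  elim/big_rec2: _ => [//|i p q _ ->]; apply/pair_equal_spec; split=> //=.
  by rewrite scaler0 addr0.
by apply/pair_equal_spec; split; rewrite /= ?addr0 ?add0r.
Qed.

Record cplx := Cplx {
  cmod :> int -> lmodType A;
  cdif : forall n, {linear cmod n -> cmod (n + 1)};
  cdif2 : forall n x, cdif (n + 1) (cdif n x) = 0
}.
Arguments cdif : clear implicits.

Record chmap (X Y : cplx) := ChMap {
  cmap :> forall n, {linear X n -> Y n};
  cmapP : forall n x, cmap (n + 1) (cdif X n x) = cdif Y n (cmap n x)
}.

(* The condition in degree n + 1; every integer is of this form. *)
Definition homotopic X Y (f g : chmap X Y) : Prop :=
  exists h : forall n, {linear X (n + 1) -> Y n}, forall n x,
    f (n + 1) x - g (n + 1) x =
      cdif Y n (h n x) + h (n + 1) (cdif X (n + 1) x).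

(* Bijectivity on cohomology in degree n + 1. *)
Definition quasi_iso X Y (f : chmap X Y) : Prop :=
  (forall n x, cdif X (n + 1) x = 0 ->
     (exists y, f (n + 1) x = cdif Y n y) -> exists x', x = cdif X n x') /\
  (forall n y, cdif Y (n + 1) y = 0 ->
     exists x y', cdif X (n + 1) x = 0 /\ y = f (n + 1) x + cdif Y n y').

Definition bounded (X : cplx) : Prop :=
  exists m : nat, forall n : int, m%:Z < `|n| -> forall x : X n, x = 0.

Definition bounded_above (X : cplx) : Prop :=
  exists m : int, forall n : int, m < n -> forall x : X n, x = 0.

Definition degreewise (P : lmodType A -> Prop) (X : cplx) : Prop :=
  forall n, P (X n).

Definition fg_projective (P : lmodType A) : Prop := fin_gen P /\ projective P.

Section Shift.
Variable X : cplx.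

Definition shift_dif n (x : X (n + 1)) : X (n + 1 + 1) := - cdif X (n + 1) x.
Fact shift_dif_linear n : linear (@shift_dif n).
Proof. by move=> a x y; rewrite /shift_dif linearP opprD scalerN. Qed.
HB.instance Definition _ n := GRing.isLinear.Build A (X (n + 1))
  (X (n + 1 + 1)) *:%R (@shift_dif n) (shift_dif_linear (n:=n)).
Fact shift_dif2 (n : int) x : @shift_dif (n + 1) (@shift_dif n x) = 0.
Proof. by rewrite /shift_dif raddfN /= cdif2 !oppr0. Qed.

(* (Sigma X)^n = X^(n+1), with differential - d. *)
Definition shift := @Cplx (fun n => X (n + 1)) (fun n => @shift_dif n) shift_dif2.

Definition ccast m n (e : m = n) (x : X m) : X n := ecast i (X i) e x.
Fact ccast_linear m n (e : m = n) : linear (ccast e).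
Proof. by case: n / e. Qed.
HB.instance Definition _ m n (e : m = n) := GRing.isLinear.Build A (X m)
  (X n) *:%R (ccast e) (ccast_linear e).

Fact sub1_add1 (n : int) : n - 1 + 1 = n + 1 - 1.
Proof. by rewrite addrAC. Qed.

Definition unshift_dif n (x : X (n - 1)) : X (n + 1 - 1) :=
  - ccast (sub1_add1 n) (cdif X (n - 1) x).
Fact unshift_dif_linear n : linear (@unshift_dif n).
Proof.
by move=> a x y; rewrite /unshift_dif linearP /= linearP opprD scalerN.
Qed.
HB.instance Definition _ n := GRing.isLinear.Build A (X (n - 1))
  (X (n + 1 - 1)) *:%R (@unshift_dif n) (unshift_dif_linear (n:=n)).
Fact cdif_ccast m n (e : m = n) (x : X m) :
  cdif X n (ccast e x) = ccast (congr1 (+%R^~ 1) e) (cdif X m x).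
Proof. by case: n / e. Qed.
Fact unshift_dif2 (n : int) x : @unshift_dif (n + 1) (@unshift_dif n x) = 0.
Proof.
by rewrite /unshift_dif raddfN /= cdif_ccast cdif2 !raddf0.
Qed.

(* (Sigma^-1 X)^n = X^(n-1), with differential - d.  As localisation functors
   are the identity on objects, this is also Sigma^-1 on the objects of the
   derived category and of its Verdier quotients. *)
Definition unshift :=
  @Cplx (fun n => X (n - 1)) (fun n => @unshift_dif n) unshift_dif2.

End Shift.

Section Cone.
Variables (X Y : cplx) (f : chmap X Y).

Definition cone_dif n (z : X (n + 1) * Y n) : X (n + 1 + 1) * Y (n + 1) :=
  (- cdif X (n + 1) z.1, f (n + 1) z.1 + cdif Y n z.2).
Fact cone_dif_linear n : linear (@cone_dif n).
Proof.
move=> a x y; apply/pair_equal_spec; split=> /=.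
  by rewrite linearP opprD scalerN.
by rewrite !linearP /= scalerDr addrACA.
Qed.
HB.instance Definition _ n := GRing.isLinear.Build A (X (n + 1)%R * Y n)%type
  (X (n + 1 + 1)%R * Y (n + 1)%R)%type *:%R (@cone_dif n)
  (cone_dif_linear (n:=n)).
Fact cone_dif2 (n : int) x : @cone_dif (n + 1) (@cone_dif n x) = 0.
Proof.
apply/pair_equal_spec; split=> /=; first by rewrite raddfN /= cdif2 !oppr0.
by rewrite raddfN raddfD /= cdif2 addr0 cmapP addNr.
Qed.

Definition cone := @Cplx (fun n => (X (n + 1)%R * Y n)%type)
  (fun n => @cone_dif n) cone_dif2.

End Cone.

Record bcplx := BCplx {
  bc :> cplx;
  bc_bounded : bounded bc;
  bc_fg : degreewise fin_gen bc
}.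

Fact shift_bounded X : bounded X -> bounded (shift X).
Proof.
move=> [m Hm]; exists m.+1 => n hn; apply: Hm.
rewrite -(ltrD2r 1) [m%:Z + 1]addrC -intS; apply: lt_le_trans hn _.
by rewrite -[leLHS](congr1 Num.norm (addrK 1 n)) (le_trans (ler_normB _ _)).
Qed.
Fact unshift_bounded X : bounded X -> bounded (unshift X).
Proof.
move=> [m Hm]; exists m.+1 => n hn; apply: Hm.
rewrite -(ltrD2r 1) [m%:Z + 1]addrC -intS; apply: lt_le_trans hn _.
by rewrite -[leLHS](congr1 Num.norm (subrK 1 n)) (le_trans (ler_normD _ _)).
Qed.
Fact cone_bounded X Y (f : chmap X Y) :
  bounded X -> bounded Y -> bounded (cone f).
Proof.
move=> /shift_bounded[m Hm] [p Hp]; exists (maxn m p) => n hn [x y].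
have hm : m%:Z < `|n| by apply: le_lt_trans hn; rewrite lez_nat leq_maxl.
have hp : p%:Z < `|n| by apply: le_lt_trans hn; rewrite lez_nat leq_maxr.
by rewrite (Hm n hm x) (Hp n hp y).
Qed.

Definition bshift (X : bcplx) : bcplx :=
  @BCplx (shift X) (shift_bounded (bc_bounded X)) (fun n => bc_fg X (n + 1)).
Definition bunshift (X : bcplx) : bcplx :=
  @BCplx (unshift X) (unshift_bounded (bc_bounded X))
    (fun n => bc_fg X (n - 1)).
Definition bcone (X Y : bcplx) (f : chmap X Y) : bcplx :=
  @BCplx (cone f) (cone_bounded f (bc_bounded X) (bc_bounded Y))
    (fun n => fin_gen_prod (bc_fg X (n + 1)) (bc_fg Y n)).

End Modules.
Arguments cdif {A} c n.

(* A k-algebra structure on a ring A is a ring morphism from k to the centre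
   of A. *)
Record central_morph (k A : pzRingType) := CentralMorph {
  central_fun :> {rmorphism k -> A};
  centralP : forall a x, central_fun a * x = x * central_fun a
}.

Section Homotopy.
Variables (k : fieldType) (A : pzRingType) (iota : central_morph k A).

Section LinearScale.
Variables (M N : lmodType A) (a : k) (f : {linear M -> N}).
Definition lscale (x : M) : N := iota a *: f x.
Fact lscale_linear : linear lscale.
Proof.
by move=> b x y; rewrite /lscale linearP scalerDr !scalerA centralP.
Qed.
HB.instance Definition _ := GRing.isLinear.Build A M N *:%R lscale lscale_linear.
End LinearScale.

Section Maps.
Variables X Y Z : cplx A.
Implicit Types f g : chmap X Y.

Definition ch_id : chmap X X :=
  @ChMap _ X X (fun n => idfun : {linear X n -> X n}) (fun n x => erefl).

Definition ch_zero : chmap X Y.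
Proof.
by exists (fun n => \0 : {linear X n -> Y n}) => n x /=; rewrite raddf0.
Defined.

Definition ch_comp (f : chmap Y Z) (g : chmap X Y) : chmap X Z.
Proof.
exists (fun n => f n \o g n : {linear X n -> Z n}) => n x /=.
by rewrite !cmapP.
Defined.

Definition ch_add f g : chmap X Y.
Proof.
exists (fun n => f n \+ g n : {linear X n -> Y n}) => n x /=.
by rewrite !cmapP raddfD.
Defined.

Definition ch_scale (a : k) f : chmap X Y.
Proof.
exists (fun n => lscale a (f n) : {linear X n -> Y n}) => n x.
by rewrite /= /lscale cmapP linearZ.
Defined.

End Maps.

Lemma homotopic_ext (X Y : cplx A) (f g : chmap X Y) :
  (forall n x, f n x = g n x) -> homotopic f g.
Proof.
move=> e; exists (fun n => \0 : {linear X (n + 1) -> Y n}) => n x /=.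
by rewrite e subrr raddf0 addr0.
Qed.

Lemma homotopic_sym (X Y : cplx A) (f g : chmap X Y) :
  homotopic f g -> homotopic g f.
Proof.
move=> [h H]; exists (fun n => \- h n : {linear X (n + 1) -> Y n}) => n x /=.
by rewrite -opprB H raddfN opprD.
Qed.

Lemma homotopic_trans (X Y : cplx A) (f g h : chmap X Y) :
  homotopic f g -> homotopic g h -> homotopic f h.
Proof.
move=> [s Hs] [t Ht].
exists (fun n => s n \+ t n : {linear X (n + 1) -> Y n}) => n x /=.
by rewrite -(subrKA (g (n + 1) x)) Hs Ht raddfD /= addrACA.
Qed.

Lemma homotopic_comp (X Y Z : cplx A) (f f' : chmap Y Z) (g g' : chmap X Y) :
  homotopic f f' -> homotopic g g' -> homotopic (ch_comp f g) (ch_comp f' g').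
Proof.
move=> [s Hs] [t Ht]; apply: (@homotopic_trans _ _ _ (ch_comp f' g)).
  exists (fun n => s n \o g (n + 1) : {linear X (n + 1) -> Z n}) => n x /=.
  by rewrite Hs cmapP.
exists (fun n => f' n \o t n : {linear X (n + 1) -> Z n}) => n x /=.
by rewrite -raddfB Ht raddfD /= cmapP.
Qed.

Lemma homotopic_add (X Y : cplx A) (f f' g g' : chmap X Y) :
  homotopic f f' -> homotopic g g' -> homotopic (ch_add f g) (ch_add f' g').
Proof.
move=> [s Hs] [t Ht].
exists (fun n => s n \+ t n : {linear X (n + 1) -> Y n}) => n x /=.
by rewrite opprD addrACA Hs Ht raddfD /= addrACA.
Qed.

Lemma homotopic_scale (X Y : cplx A) a (f f' : chmap X Y) :
  homotopic f f' -> homotopic (ch_scale a f) (ch_scale a f').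
Proof.
move=> [s Hs].
exists (fun n => lscale a (s n) : {linear X (n + 1) -> Y n}) => n x.
by rewrite /= /lscale -scalerBr Hs scalerDr linearZ.
Qed.

Definition homotopy_cat : lincat k.
Proof.
refine (@LinCat k (bcplx A) (fun X Y => chmap X Y) (fun X Y => @homotopic A X Y)
  (fun X => ch_id X) (fun X Y Z => @ch_comp X Y Z) (fun X Y => ch_zero X Y)
  (fun X Y => @ch_add X Y) (fun X Y => @ch_scale X Y)
  _ (fun X Y => @homotopic_sym X Y) (fun X Y => @homotopic_trans X Y)
  (fun X Y Z => @homotopic_comp X Y Z) (fun X Y => @homotopic_add X Y)
  (fun X Y => @homotopic_scale X Y) _ _ _ _ _ _ _ _ _ _ _ _ _ _ _).
all: intros; apply: homotopic_ext => n x //=; rewrite /lscale /=.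
- by rewrite addrA.
- by rewrite addrC.
- by rewrite add0r.
- by rewrite rmorphN rmorph1 scaleN1r addNr.
- by rewrite scalerA rmorphM.
- by rewrite rmorph1 scale1r.
- by rewrite scalerDr.
- by rewrite rmorphD scalerDl.
- by rewrite raddfD.
- by rewrite linearZ.
Defined.

(* D^b(mod A), for A noetherian *)
Definition derived_cat : lincat k :=
  @localisation k homotopy_cat (fun X Y f => quasi_iso (f : chmap X Y)).

Definition derived_map (X Y : bcplx A) (f : chmap X Y) :
  @hom k derived_cat X Y := loc_map _ (f : @hom k homotopy_cat X Y).

Definition perfect (X : derived_cat) : Prop :=
  exists P : bcplx A, degreewise (@fg_projective A) P /\
    isomorphic X (P : derived_cat).

(* There is a distinguished triangle X -f-> Y -> Z -> Sigma X, i.e. one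
   isomorphic to the image of a mapping cone triangle. *)
Definition is_cone (X Y : derived_cat) (f : hom X Y) (Z : derived_cat) : Prop :=
  exists (X' Y' : bcplx A) (g : chmap X' Y')
    (u : @hom k derived_cat X X') (v : @hom k derived_cat Y Y'),
    [/\ is_iso u, is_iso v, hcomp v f =h hcomp (derived_map g) u
      & isomorphic Z (bcone g : derived_cat)].

(* The Verdier quotient of D^b(mod A) by the perfect complexes. *)
Definition sing_cat : lincat k :=
  @localisation k derived_cat
    (fun X Y f => exists2 Z, is_cone f Z & perfect Z).

End Homotopy.


Lemma sum_triangle (V : nmodType) n (F : nat -> nat -> V) :
  \sum_(i < n.+1) \sum_(j < i.+1) F i j =
  \sum_(j < n.+1) \sum_(m < (n - j).+1) F (j + m)%N j.
Proof.
transitivity (\sum_(i < n.+1) \sum_(j < n.+1 | (j <= i)%N) F i j).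
  by apply: eq_bigr => i _; rewrite (big_ord_widen _ (F i) (ltn_ord i)).
rewrite (exchange_big_dep predT) //=; apply: eq_bigr => j _.
have jn : (j <= n)%N by rewrite -ltnS.
rewrite -(big_mkord (fun i => (j <= i)%N) (F^~ j)).
rewrite (big_cat_nat (n := j)) //=; last exact: leqW.
rewrite big_nat_cond big_pred0 ?add0r; last first.
  by move=> i /=; case: ltngtP.
rewrite -{1}[j : nat]add0n big_addn big_mkord subSn //.
by apply: eq_big => [m|m _]; rewrite ?leq_addl // addnC.
Qed.

Section PowerSeries.
Variable k : fieldType.

Record fps := Fps { fcoef :> nat -> k }.
Implicit Types f g h : fps.

Lemma fps_ext f g : (forall n, f n = g n) -> f = g.
Proof. by case: f g => [f] [g] /= /funext ->. Qed.

HB.instance Definition _ := gen_eqMixin fps.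
HB.instance Definition _ := gen_choiceMixin fps.

Definition fps_zero := Fps (fun=> 0).
Definition fps_opp f := Fps (fun n => - f n).
Definition fps_add f g := Fps (fun n => f n + g n).

Fact fps_addA : associative fps_add.
Proof. by move=> f g h; apply: fps_ext => n /=; rewrite addrA. Qed.
Fact fps_addC : commutative fps_add.
Proof. by move=> f g; apply: fps_ext => n /=; rewrite addrC. Qed.
Fact fps_add0 : left_id fps_zero fps_add.
Proof. by move=> f; apply: fps_ext => n /=; rewrite add0r. Qed.
Fact fps_addN : left_inverse fps_zero fps_opp fps_add.
Proof. by move=> f; apply: fps_ext => n /=; rewrite addNr. Qed.
HB.instance Definition _ :=
  GRing.isZmodule.Build fps fps_addA fps_addC fps_add0 fps_addN.

Definition fps_one := Fps (fun n => (n == 0%N)%:R).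
Definition fps_mul f g := Fps (fun n => \sum_(i < n.+1) f i * g (n - i)%N).

Fact fps_mulC : commutative fps_mul.
Proof.
move=> f g; apply: fps_ext => n /=; rewrite (reindex_inj rev_ord_inj) /=.
by apply: eq_bigr => i _; rewrite mulrC subSS subKn // -ltnS.
Qed.
Fact fps_mulA : associative fps_mul.
Proof.
move=> f g h; rewrite [fps_mul f (fps_mul g h)]fps_mulC.
rewrite [fps_mul g h]fps_mulC; apply: fps_ext => n /=.
under eq_bigr => i _ do rewrite mulr_suml.
rewrite (sum_triangle n (fun i j => h j * g (i - j)%N * f (n - i)%N)).
rewrite [RHS](reindex_inj rev_ord_inj) /=; apply: eq_bigr => j _.
rewrite !subSS subKn; last by rewrite -ltnS.
rewrite mulr_suml (reindex_inj rev_ord_inj) /=; apply: eq_bigr => m _.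
rewrite subSS addKn.
have mn : (m <= n - j)%N by rewrite -ltnS.
have jn : (j <= n)%N by rewrite -ltnS.
have -> : (n - (j + (n - j - m)) = m)%N by rewrite subnDA subKn.
by rewrite mulrC -mulrA; congr (_ * _); exact: mulrC.
Qed.
Fact fps_mul1 : left_id fps_one fps_mul.
Proof.
move=> f; apply: fps_ext => n /=; rewrite big_ord_recl /= mul1r subn0.
by rewrite big1 ?addr0 // => i _; rewrite mul0r.
Qed.
Fact fps_mulD : left_distributive fps_mul fps_add.
Proof.
move=> f g h; apply: fps_ext => n /=; rewrite -big_split /=.
by apply: eq_bigr => i _; rewrite mulrDl.
Qed.
HB.instance Definition _ :=
  GRing.Zmodule_isComPzRing.Build fps fps_mulA fps_mulC fps_mul1 fps_mulD.

End PowerSeries.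

(* [zrel b a] says that the path b a (first a, then b) belongs to the ideal I;
   only its values for [src b = tgt a] are used. *)
Record bound_quiver := BoundQuiver {
  vert : finType;
  arr : finType;
  src : arr -> vert;
  tgt : arr -> vert;
  zrel : arr -> arr -> bool
}.

Section Quiver.
Variable Q : bound_quiver.
Notation V := (vert Q).
Notation E := (arr Q).
Implicit Types (a b : E) (v : V) (u : V * seq E) (w : seq E).

Definition arr_in v : {set E} := [set a | tgt a == v].
Definition arr_out v : {set E} := [set a | src a == v].

Definition two_regular v : Prop :=
  [/\ #|arr_in v| = 2, #|arr_out v| = 2,
      forall a, a \in arr_in v -> #|[set b in arr_out v | zrel b a]| = 1
    & forall b, b \in arr_out v -> #|[set a in arr_in v | zrel b a]| = 1].

Definition transition v : Prop :=
  exists a b, [/\ arr_in v = [set a], arr_out v = [set b] & ~~ zrel b a].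

Definition gentle : Prop := forall v, two_regular v \/ transition v.

Definition nzstep a b := (src b == tgt a) && ~~ zrel b a.
Definition zstep a b := (src b == tgt a) && zrel b a.

Definition sigma a : E := odflt a [pick b | nzstep a b].

Definition diff_cycle w : bool := [&& w != [::], uniq w & cycle zstep w].

Definition on_diff_cycle a : Prop := exists2 w, diff_cycle w & a \in w.

(* The path with source [u.1] whose arrows, in the order in which they are
   travelled, are [u.2]. *)
Definition is_nzpath u : bool :=
  if u.2 is a :: w then (src a == u.1) && path nzstep a w else true.

Definition pend u : V := last u.1 (map (@tgt Q) u.2).
Definition ppre n u : V * seq E := (u.1, take n u.2).
Definition psuf n u : V * seq E := (pend (ppre n u), drop n u.2).

Lemma is_nzpath_pre n u : is_nzpath u -> is_nzpath (ppre n u).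
Proof.
case: u n => v [|a w] [|n] //= /andP[e pw]; rewrite /is_nzpath /= e /=.
by move: pw; rewrite -{1}(cat_take_drop n w) cat_path => /andP[].
Qed.

Lemma is_nzpath_suf n u : is_nzpath u -> is_nzpath (psuf n u).
Proof.
case: u n => v [|a w] [|n] //=; rewrite /is_nzpath /= => /andP[e pw].
move: pw; rewrite -{1}(cat_take_drop n w) cat_path => /andP[_].
case: (drop n w) => //= b w' /andP[/andP[/eqP -> _] ->].
by rewrite /pend /= last_map eqxx.
Qed.

Definition nzpath := {p : V * seq E | is_nzpath p}.
Implicit Types (p q : nzpath).
Definition npre n (p : nzpath) : nzpath :=
  exist _ (ppre n (val p)) (is_nzpath_pre n (valP p)).
Definition nsuf n (p : nzpath) : nzpath :=
  exist _ (psuf n (val p)) (is_nzpath_suf n (valP p)).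
Definition plen (p : nzpath) : nat := size (val p).2.

Lemma plen_pre n p : (n <= plen p)%N -> plen (npre n p) = n.
Proof. exact: size_takel. Qed.
Lemma plen_suf n p : plen (nsuf n p) = (plen p - n)%N.
Proof. by rewrite /plen size_drop. Qed.
Lemma npre_pre n m p : (m <= n)%N -> npre m (npre n p) = npre m p.
Proof. by move=> mn; apply: val_inj; rewrite /= /ppre /= take_takel. Qed.
Lemma nsuf_suf n m p : nsuf m (nsuf n p) = nsuf (n + m) p.
Proof.
apply: val_inj; rewrite /= /psuf /= drop_drop addnC; congr (_, _).
by rewrite /pend /= takeD map_cat last_cat.
Qed.
Lemma nsuf_pre n m p : nsuf n (npre (n + m) p) = npre m (nsuf n p).
Proof.
apply: val_inj; rewrite /= /psuf /ppre /= take_drop addnC; congr (_, _).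
by rewrite take_takel ?leq_addl.
Qed.
Lemma npre_all n p : (plen p <= n)%N -> npre n p = p.
Proof.
move=> h; apply: val_inj; rewrite /= /ppre take_oversize //.
by case: (val p).
Qed.
Lemma nsuf0 p : nsuf 0 p = p.
Proof.
by apply: val_inj; rewrite /= /psuf /ppre /= take0 drop0; case: (val p).
Qed.

Variable k : fieldType.

(* As I is generated by paths, the nonzero paths form a basis of kQ/I, and the
   elements of its completion are arbitrary formal linear combinations of
   nonzero paths (there are finitely many of each length). *)
Record gentle_alg := GentleAlg { pcoef :> nzpath -> k }.
Implicit Types f g h : gentle_alg.

Lemma galg_ext f g : (forall p, f p = g p) -> f = g.
Proof. by case: f g => [f] [g] /= /funext ->. Qed.

HB.instance Definition _ := gen_eqMixin gentle_alg.
HB.instance Definition _ := gen_choiceMixin gentle_alg.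

Definition galg_zero := GentleAlg (fun=> 0).
Definition galg_opp f := GentleAlg (fun p => - f p).
Definition galg_add f g := GentleAlg (fun p => f p + g p).

Fact galg_addA : associative galg_add.
Proof. by move=> f g h; apply: galg_ext => p /=; rewrite addrA. Qed.
Fact galg_addC : commutative galg_add.
Proof. by move=> f g; apply: galg_ext => p /=; rewrite addrC. Qed.
Fact galg_add0 : left_id galg_zero galg_add.
Proof. by move=> f; apply: galg_ext => p /=; rewrite add0r. Qed.
Fact galg_addN : left_inverse galg_zero galg_opp galg_add.
Proof. by move=> f; apply: galg_ext => p /=; rewrite addNr. Qed.
HB.instance Definition _ :=
  GRing.isZmodule.Build gentle_alg galg_addA galg_addC galg_add0 galg_addN.

Definition galg_scalar (x : k) :=
  GentleAlg (fun p => if plen p == 0%N then x else 0).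
(* Paths are composed from right to left: a path p factors as the suffix
   (on the left) times the prefix of length i (on the right). *)
Definition galg_mul f g :=
  GentleAlg (fun p => \sum_(i < (plen p).+1) f (nsuf i p) * g (npre i p)).

Fact galg_mulA : associative galg_mul.
Proof.
move=> f g h; apply: galg_ext => p /=.
transitivity (\sum_(i < (plen p).+1) \sum_(j < i.+1)
   f (nsuf i p) * (g (nsuf j (npre i p)) * h (npre j p))).
  apply: eq_bigr => i _; have ip : (i <= plen p)%N by rewrite -ltnS.
  rewrite mulr_sumr plen_pre //; apply: eq_bigr => j _.
  by rewrite npre_pre // -ltnS.
rewrite (sum_triangle (plen p)
  (fun i j => f (nsuf i p) * (g (nsuf j (npre i p)) * h (npre j p)))).
apply: eq_bigr => j _; rewrite mulr_suml plen_suf; apply: eq_bigr => m _.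
by rewrite mulrA nsuf_suf nsuf_pre.
Qed.

Lemma galg_scalarE x f p : galg_mul (galg_scalar x) f p = x * f p.
Proof.
rewrite /= (bigD1 ord_max) //= plen_suf subnn eqxx npre_all // big1 ?addr0 //.
move=> i /negP ni; rewrite plen_suf subn_eq0 ifN ?mul0r //.
by apply/negP => h; case: ni; rewrite -val_eqE /= eqn_leq -ltnS ltn_ord.
Qed.
Lemma galg_Escalar x f p : galg_mul f (galg_scalar x) p = f p * x.
Proof.
rewrite /= big_ord_recl /= nsuf0 plen_pre // eqxx big1 ?addr0 //.
by move=> i _; rewrite plen_pre ?mulr0 // bump0.
Qed.

Fact galg_mul1 : left_id (galg_scalar 1) galg_mul.
Proof. by move=> f; apply: galg_ext => p; rewrite galg_scalarE mul1r. Qed.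
Fact galg_1mul : right_id (galg_scalar 1) galg_mul.
Proof. by move=> f; apply: galg_ext => p; rewrite galg_Escalar mulr1. Qed.
Fact galg_mulDl : left_distributive galg_mul galg_add.
Proof.
move=> f g h; apply: galg_ext => n /=; rewrite -big_split /=.
by apply: eq_bigr => i _; rewrite mulrDl.
Qed.
Fact galg_mulDr : right_distributive galg_mul galg_add.
Proof.
move=> f g h; apply: galg_ext => n /=; rewrite -big_split /=.
by apply: eq_bigr => i _; rewrite mulrDr.
Qed.
HB.instance Definition _ := GRing.Zmodule_isPzRing.Build gentle_alg
  galg_mulA galg_mul1 galg_1mul galg_mulDl galg_mulDr.

Fact galg_scalar_additive : zmod_morphism galg_scalar.
Proof.
by move=> x y; apply: galg_ext => p /=; case: ifP => // _; rewrite subr0.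
Qed.
HB.instance Definition _ := GRing.isZmodMorphism.Build k gentle_alg galg_scalar
  galg_scalar_additive.
Fact galg_scalar_monoid : monoid_morphism galg_scalar.
Proof.
split=> // x y; apply: galg_ext => p; rewrite [RHS]galg_scalarE /=.
by case: ifP => //; rewrite mulr0.
Qed.
HB.instance Definition _ := GRing.isMonoidMorphism.Build k gentle_alg
  galg_scalar galg_scalar_monoid.
Fact galg_scalar_central x f : galg_scalar x * f = f * galg_scalar x.
Proof.
by apply: galg_ext => p; rewrite [LHS]galg_scalarE [RHS]galg_Escalar mulrC.
Qed.

Definition galg_k : central_morph k gentle_alg :=
  CentralMorph galg_scalar_central.

(* The path [u], viewed as an element of the algebra. *)
Definition path_elt u : gentle_alg := GentleAlg (fun p => (val p == u)%:R).

Definition arrow_elt a : gentle_alg := path_elt (src a, [:: a]).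

(* [orbit sigma a] lists a, sigma a, ..., sigma^(l-1) a, where l is the size of
   the orbit; as sigma is injective (for gentle quivers), l is the least
   positive integer such that sigma^l a = a. *)
Definition adm_cycle a : gentle_alg := path_elt (src a, orbit sigma a).

Definition c_elt : gentle_alg := \sum_a adm_cycle a.

(* The image of the power series r is the sum of the r_i c^i; only i <= n
   contribute to the coefficient of a path of length n. *)
Definition galg_of_fps (r : fps k) : gentle_alg :=
  GentleAlg (fun p => \sum_(i < (plen p).+1) r i * (c_elt ^+ i) p).

Lemma galg_addE f g p : (f + g) p = f p + g p. Proof. by []. Qed.
Lemma galg_oppE f p : (- f) p = - f p. Proof. by []. Qed.
Lemma galg_mulE f g p :
  (f * g) p = \sum_(i < (plen p).+1) f (nsuf i p) * g (npre i p).
Proof. by []. Qed.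

Lemma c_elt_triv p : plen p = 0%N -> c_elt p = 0.
Proof.
move=> p0; rewrite /c_elt; elim/big_ind: _ => //.
  by move=> x y; rewrite galg_addE => -> ->; rewrite addr0.
move=> a _ /=; case: eqP => // e; move: p0; rewrite /plen /= e size_orbit.
by move/eqP; rewrite (gtn_eqF (order_gt0 _ _)).
Qed.

Lemma c_elt_exp n p : (plen p < n)%N -> (c_elt ^+ n) p = 0.
Proof.
elim: n p => // n IH p; rewrite ltnS => pn.
rewrite exprS galg_mulE big1 // => i _; have ip : (i <= plen p)%N by rewrite -ltnS.
case: (ltnP i (plen p)) => h.
  by rewrite IH ?mulr0 // plen_pre //; apply: leq_trans pn.
by rewrite c_elt_triv ?mul0r // plen_suf; apply/eqP; rewrite subn_eq0.
Qed.

Lemma galg_of_fpsE n r p : (plen p <= n)%N ->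
  galg_of_fps r p = \sum_(i < n.+1) r i * (c_elt ^+ i) p.
Proof.
move=> pn /=; rewrite (big_ord_widen n.+1 (fun i => r i * (c_elt ^+ i) p)) //.
rewrite big_mkcond /=; apply: eq_bigr => i _; case: ltnP => // h.
by rewrite c_elt_exp ?mulr0.
Qed.

Fact galg_of_fps_additive : zmod_morphism galg_of_fps.
Proof.
move=> r s; apply: galg_ext => p; rewrite galg_addE galg_oppE /= -sumrB.
by apply: eq_bigr => i _; rewrite -mulrBl.
Qed.
HB.instance Definition _ := GRing.isZmodMorphism.Build (fps k) gentle_alg
  galg_of_fps galg_of_fps_additive.

Fact galg_of_fps_monoid : monoid_morphism galg_of_fps.
Proof.
split=> [|r s]; apply: galg_ext => p.
  rewrite /= big_ord_recl mul1r big1 ?addr0 // => i _.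
  by rewrite mul0r.
have pre_le i : (plen (npre i p) <= plen p)%N.
  by rewrite /plen /= size_take_min geq_minr.
have suf_le i : (plen (nsuf i p) <= plen p)%N by rewrite plen_suf leq_subr.
rewrite galg_mulE.
transitivity (\sum_(a < (plen p).+1) \sum_(b < (plen p).+1)
    r a * s b * (c_elt ^+ (a + b)) p); last first.
  under [RHS]eq_bigr => i _ do
    rewrite (galg_of_fpsE r (suf_le i)) (galg_of_fpsE s (pre_le i)) mulr_suml.
  rewrite [RHS]exchange_big /=; apply: eq_bigr => a _.
  under [RHS]eq_bigr => i _ do rewrite mulr_sumr.
  rewrite [RHS]exchange_big /=; apply: eq_bigr => b _.
  rewrite exprD galg_mulE mulr_sumr; apply: eq_bigr => i _.
  by rewrite mulrACA.
transitivity (\sum_(i < (plen p).+1) \sum_(j < i.+1)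
    r j * s (i - j)%N * (c_elt ^+ i) p).
  by apply: eq_bigr => i _; rewrite mulr_suml.
rewrite (sum_triangle (plen p)
  (fun i j => r j * s (i - j)%N * (c_elt ^+ i) p)).
apply: eq_bigr => a _.
have ap : ((plen p - a).+1 <= (plen p).+1)%N by rewrite ltnS leq_subr.
rewrite (big_ord_widen (plen p).+1
  (fun m => r a * s (a + m - a)%N * (c_elt ^+ (a + m)) p)) //.
rewrite big_mkcond /=; apply: eq_bigr => b _; rewrite addKn.
case: ltnP => // h; rewrite c_elt_exp ?mulr0 //.
by move: h; rewrite ltn_subLR // -ltnS.
Qed.
HB.instance Definition _ := GRing.isMonoidMorphism.Build (fps k) gentle_alg
  galg_of_fps galg_of_fps_monoid.

End Quiver.


(* The following shows that [gentle_alg Q k], with the elements vanishing on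
   paths of length < n as n-th step of its filtration, is the inverse limit of
   the rings kQ / (I + J^n), where J is the arrow ideal. *)
Section Completion.
Variables (Q : bound_quiver) (k : fieldType).

Definition free_quiver :=
  @BoundQuiver (vert Q) (arr Q) (@src Q) (@tgt Q) (fun _ _ => false).
Local Notation B := (gentle_alg free_quiver k).
Local Notation A := (gentle_alg Q k).

(* kQ, inside its completion *)
Definition in_path_alg (f : B) : Prop :=
  exists N, forall p, (N <= plen p)%N -> f p = 0.

(* the ideal I + J^n of kQ *)
Inductive in_ideal (n : nat) : B -> Prop :=
| in_ideal0 : in_ideal n 0
| in_idealD f g : in_ideal n f -> in_ideal n g -> in_ideal n (f + g)
| in_ideal_rel f g (a b : arr Q) : in_path_alg f -> in_path_alg g ->
    src b = tgt a -> zrel b a ->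
    in_ideal n (f * (@arrow_elt free_quiver k b * @arrow_elt free_quiver k a) * g)
| in_ideal_path f g (u : vert Q * seq (arr Q)) :
    in_path_alg f -> in_path_alg g -> size u.2 = n ->
    in_ideal n (f * @path_elt free_quiver k u * g).

Lemma nzpath_free u : is_nzpath (Q := Q) u -> is_nzpath (Q := free_quiver) u.
Proof.
case: u => v [//|a w] /andP[e h]; apply/andP; split=> //.
by apply: sub_path h => b c /andP[]; rewrite /nzstep andbT.
Qed.

Definition path_incl (p : nzpath Q) : nzpath free_quiver :=
  exist _ (val p) (nzpath_free (valP p)).

Definition galg_proj (f : B) : A := GentleAlg (fun p => f (path_incl p)).

Lemma galg_projD f g : galg_proj (f + g) = galg_proj f + galg_proj g.
Proof. exact: galg_ext. Qed.
Lemma galg_proj1 : galg_proj 1 = 1.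
Proof. exact: galg_ext. Qed.
Lemma galg_projM f g : galg_proj (f * g) = galg_proj f * galg_proj g.
Proof.
apply: galg_ext => p; rewrite [LHS]/= [RHS]galg_mulE.
apply: eq_bigr => i _ /=.
by congr (f _ * g _); apply: val_inj.
Qed.

Lemma path_split_inj (P : bound_quiver) i j (u u' : vert P * seq (arr P)) :
  psuf j u = psuf i u' -> ppre j u = ppre i u' -> u = u'.
Proof.
case: u u' => [v w] [v' w']; rewrite /psuf /ppre /= => -[_ e] [-> e'].
by rewrite -[w](cat_take_drop j) e e' cat_take_drop.
Qed.

Lemma path_elt_cat (P : bound_quiver) (p : nzpath P) i : (i <= plen p)%N ->
  path_elt k (val p) = path_elt k (psuf i (val p)) * path_elt k (ppre i (val p)).
Proof.
move=> ip; apply: galg_ext => q; rewrite galg_mulE.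
case: (eqVneq (val q) (val p)) => [/val_inj-> {q}|qp].
  have ip' : (i < (plen p).+1)%N by [].
  rewrite (bigD1 (Ordinal ip')) //= !eqxx mulr1 big1 ?addr0 //.
  move=> j; rewrite -val_eqE /= => ji; case: (eqVneq (ppre j _)) => [e|_]; last by rewrite mulr0.
  have := congr1 (size \o snd) e; rewrite /= !size_takel //; last by rewrite -ltnS.
  by move=> e'; rewrite e' eqxx in ji.
rewrite /= (negbTE qp) big1 // => j _.
case: eqVneq => [e|_]; last by rewrite mul0r.
case: eqVneq => [e'|_]; last by rewrite mulr0.
by case/eqP: qp; apply: path_split_inj e e'.
Qed.

Lemma path_elt_supp (P : bound_quiver) u (p : nzpath P) :
  path_elt k u p != 0 -> val p = u.
Proof. by case: (eqVneq (val p) u) => // /negbTE h; rewrite /= h eqxx. Qed.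

Lemma in_path_alg_elt u : in_path_alg (path_elt k u).
Proof.
exists (size u.2).+1 => p pn; apply/eqP; apply: contraLR pn => /path_elt_supp <-.
by rewrite ltnn.
Qed.

Lemma in_path_alg_scalar x : in_path_alg (galg_scalar free_quiver x).
Proof. by exists 1%N => p /=; case: (plen p). Qed.

Lemma vanish_mul (P : bound_quiver) n (f g h : gentle_alg P k) :
  (forall p, (plen p < n)%N -> g p = 0) ->
  forall p, (plen p < n)%N -> (f * g * h) p = 0.
Proof.
move=> Hg p pn; rewrite galg_mulE big1 // => i _.
rewrite galg_mulE big1 ?mul0r // => j _; rewrite Hg ?mulr0 //.
apply: leq_ltn_trans pn; rewrite /plen /= size_take_min.
by apply: leq_trans (geq_minr _ _) _; rewrite size_drop leq_subr.
Qed.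

Lemma is_free_split u : is_nzpath (Q := free_quiver) u ->
  ~~ is_nzpath (Q := Q) u ->
  exists i (a b : arr Q) w,
    [/\ drop i u.2 = [:: a, b & w], src b = tgt a & zrel b a].
Proof.
case: u => v [//|a w]; rewrite /is_nzpath /= => /andP[-> /= h] hn.
elim: w a h hn => //= b w IH a /andP[ab h].
move: ab; rewrite /nzstep /= andbT => ab; rewrite ab /= negb_and negbK.
have [ba _|ba /= hn] := boolP (zrel b a).
  by exists 0%N, a, b, w; split=> //; exact/eqP.
by have [i [a' [b' [w' [e1 e2 e3]]]]] := IH b h hn; exists i.+1, a', b', w'.
Qed.

Lemma in_path_alg_scale x (f : B) :
  in_path_alg f -> in_path_alg (galg_scalar free_quiver x * f).
Proof.
move=> [N hf]; exists N => p Np.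
by rewrite [LHS](@galg_scalarE free_quiver k) hf ?mulr0.
Qed.

Lemma path_elt_ideal n x (p : nzpath free_quiver) :
  (n <= plen p)%N || ~~ is_nzpath (Q := Q) (val p) ->
  in_ideal n (galg_scalar free_quiver x * path_elt k (val p)).
Proof.
case/orP => [np|hp].
  rewrite (path_elt_cat np) mulrA -[X in in_ideal _ X]mulr1.
  apply: in_ideal_path; last exact: size_takel np.
    exact/in_path_alg_scale/in_path_alg_elt.
  exact: in_path_alg_scalar.
have [i [a [b [w [e1 e2 e3]]]]] := is_free_split (valP p) hp.
have ip : (i <= plen p)%N.
  by apply: ltnW; rewrite -subn_gt0 -plen_suf /plen /= e1.
rewrite (path_elt_cat ip); set u := psuf i (val p).
have pu : is_nzpath (Q := free_quiver) u by exact: is_nzpath_suf (valP p).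
have uE : u = (src a, [:: a, b & w]).
  have u2 : u.2 = [:: a, b & w] by exact: e1.
  by move: pu u2; case: (u) => v l /= pu e; move: pu; rewrite e => /andP[/eqP ->].
have u2 : (2 <= plen (exist _ u pu : nzpath free_quiver))%N.
  by change (2 <= size u.2)%N; rewrite uE.
rewrite (path_elt_cat u2) /= {u2}.
have -> : ppre 2 u = (src a, [:: a; b]) by rewrite uE /ppre /= take0.
have pab : is_nzpath (Q := free_quiver) (src a, [:: a; b]).
  by rewrite /is_nzpath /= /nzstep /= e2 !eqxx.
have l1 : (1 <= plen (exist (fun u0 => is_nzpath (Q := free_quiver) u0) (src a, [:: a; b]) pab : nzpath free_quiver))%N by [].
rewrite (path_elt_cat l1) /= /psuf /ppre /pend /= -e2 !mulrA.
have E (f g h l : B) : f * g * h * l = f * (g * h) * l by rewrite !mulrA.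
rewrite E {E}.
apply: in_ideal_rel => //; last exact: in_path_alg_elt.
exact/in_path_alg_scale/in_path_alg_elt.
Qed.

Lemma in_ideal_sum n (I : Type) (r : seq I) (P : pred I) (F : I -> B) :
  (forall i, P i -> in_ideal n (F i)) -> in_ideal n (\sum_(i <- r | P i) F i).
Proof.
move=> h; elim/big_ind: _ => //; first exact: in_ideal0.
exact: in_idealD.
Qed.

Lemma path_alg_sum (f : B) N : (forall p, (N <= plen p)%N -> f p = 0) ->
  f = \sum_(u : vert Q * N.-bseq (arr Q))
        (if (insub (u.1, u.2 : seq (arr Q)) : option (nzpath free_quiver)) is Some p
         then galg_scalar free_quiver (f p) * @path_elt free_quiver k (val p) else 0).
Proof.
move=> hf; apply: galg_ext => p.
rewrite (big_morph (fun g : B => g p) (id1 := 0) (op1 := +%R)) //.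
have [pN|/ltnW Np] := leqP (plen p) N; last first.
  rewrite hf // big1 // => u _; case: insubP => [q _ eq|//].
  rewrite [LHS](@galg_scalarE free_quiver k) /=; case: eqP => [e|_]; last exact: mulr0.
  by rewrite hf ?mul0r //; rewrite /plen -[val q]e.
rewrite (bigD1 ((val p).1, Bseq pN)) //= big1 ?addr0 => [|[v s] /eqP ns].
  rewrite -surjective_pairing; case: insubP => [q _ e|]; last by rewrite (valP p).
  have /val_inj -> : val q = val p by exact: e.
  by rewrite [RHS](@galg_scalarE free_quiver k) /= eqxx mulr1.
case: insubP => [q _ e|//].
rewrite [LHS](@galg_scalarE free_quiver k) /=; case: eqP => [pq|_]; last exact: mulr0.
case: ns; move: pq; rewrite -[sval q]/(val q) e => pq.
congr (_, _); first by rewrite /= pq.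
by apply: val_inj; rewrite /= pq.
Qed.

Theorem galg_proj_kernel n (f : B) : in_path_alg f ->
  (forall p, (plen p < n)%N -> galg_proj f p = 0) <-> in_ideal n f.
Proof.
move=> [N hf]; split=> [h|].
  rewrite (path_alg_sum hf); apply: in_ideal_sum => u _.
  case: insubP => [p _ _|_]; last exact: in_ideal0.
  have [hp|] := boolP ((n <= @plen free_quiver p)%N || ~~ is_nzpath (Q := Q) (val p)).
    exact: path_elt_ideal.
  rewrite negb_or negbK -ltnNge => /andP[pn hp].
  have := h (exist _ (val p) hp) pn; rewrite /=.
  have -> : path_incl (exist _ (val p) hp) = p by exact: val_inj.
  by move=> ->; rewrite raddf0 mul0r; apply: in_ideal0.
elim=> {N f hf} [|f g _ hf _ hg|f g a b _ _ e z|f g u _ _ un] p pn //.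
- by rewrite galg_projD galg_addE hf // hg // addr0.
- have z0 : galg_proj (@arrow_elt free_quiver k b * @arrow_elt free_quiver k a) = 0.
    apply: galg_ext => q; rewrite [LHS]/= big1 // => i _ /=.
    case: eqP => [h1|_]; last by rewrite mul0r.
    case: eqP => [h2|_]; last by rewrite mulr0.
    have : val q = (src a, [:: a; b]).
      have h1' : psuf i (val q) = _ := h1; have h2' : ppre i (val q) = _ := h2.
      apply: (@path_split_inj Q 1 i); first rewrite h1'; last by rewrite h2'.
      by rewrite /psuf /ppre /pend /= e.
    by have := valP q; move=> /[swap] ->; rewrite /is_nzpath /= /nzstep z andbF andbF.
  by rewrite galg_projM in z0; rewrite !galg_projM z0 mulr0 mul0r.
rewrite !galg_projM; apply: vanish_mul pn => q qn /=.
case: eqP => // e; move: qn; have -> : plen q = size u.2 by rewrite /plen -e.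
by rewrite un ltnn.
Qed.

Theorem galg_proj_dense n (g : A) :
  exists2 f, in_path_alg f & forall p, (plen p < n)%N -> galg_proj f p = g p.
Proof.
exists (GentleAlg (fun p : nzpath free_quiver => if (plen p < n)%N then
  (if insub (val p) is Some q then g q else 0) else 0)) => [|p pn /=].
  by exists n => p np /=; rewrite ltnNge np.
by rewrite pn valK.
Qed.

Theorem galg_complete (g : nat -> A) :
  (forall n p, (plen p < n)%N -> g n.+1 p = g n p) ->
  exists! h : A, forall n p, (plen p < n)%N -> h p = g n p.
Proof.
move=> hg; exists (GentleAlg (fun p => g (plen p).+1 p)); split=> [n p|h hh].
  elim: n => // n IH; rewrite ltnS leq_eqVlt => /orP[/eqP <- //|pn].
  by rewrite hg // -IH.
by apply: galg_ext => p /=; rewrite (hh (plen p).+1).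
Qed.

End Completion.


Section GentleAlgebra.
Variables (Q : bound_quiver) (hQ : gentle Q) (k : fieldType).
Notation V := (vert Q).
Notation E := (arr Q).
Local Notation A := (gentle_alg Q k).
Implicit Types (a b : E).

Lemma compl_card1 (T : finType) (S : {set T}) (P : pred T) :
  #|S| = 2 -> #|[set x in S | P x]| = 1 ->
  exists y, forall x, (x \in S) && ~~ P x = (x == y).
Proof.
move=> S2 SP; have : #|S :\: [set x in S | P x]| == 1.
  by rewrite cardsD (setIidPr _) ?S2 ?SP //; apply/subsetP=> x; rewrite inE => /andP[].
case/cards1P => y Hy; exists y => x; rewrite -in_set1 -Hy !inE.
by case: (x \in S); rewrite ?andbT.
Qed.

Lemma nzstep_next a : exists b, forall b', nzstep a b' = (b' == b).
Proof.
case: (hQ (tgt a)) => [[_ o2 /(_ a) + _]|[a' [b [ai bo nz]]]].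
  rewrite inE eqxx => /(_ isT) o1; have [y Hy] := compl_card1 o2 o1.
  by exists y => b; rewrite -Hy inE.
have: a \in arr_in (tgt a) by rewrite inE.
rewrite ai in_set1 => /eqP e; subst a'; exists b => b'.
have := in_set1 b' b; rewrite -bo inE /nzstep => ->.
by case: eqP => // ->.
Qed.

Lemma nzstep_prev b : exists a, forall a', nzstep a' b = (a' == a).
Proof.
case: (hQ (src b)) => [[i2 _ _ /(_ b)]|[a [b' [ai bo nz]]]].
  rewrite inE eqxx => /(_ isT) i1; have [y Hy] := compl_card1 i2 i1.
  by exists y => a; rewrite -Hy inE /nzstep eq_sym.
have: b \in arr_out (src b) by rewrite inE.
rewrite bo in_set1 => /eqP e; subst b'; exists a => a'.
have := in_set1 a' a; rewrite -ai inE /nzstep eq_sym => ->.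
by case: eqP => // ->.
Qed.

Lemma nzstep_sigma a b : nzstep a b = (b == sigma a).
Proof.
have [c Hc] := nzstep_next a; rewrite Hc /sigma; case: pickP => [d|/(_ c)].
  by rewrite Hc => /eqP ->.
by rewrite Hc eqxx.
Qed.

Lemma sigma_inj : injective (@sigma Q).
Proof.
move=> a b e; have [c Hc] := nzstep_prev (sigma a).
have ha : nzstep a (sigma a) by rewrite nzstep_sigma.
have hb : nzstep b (sigma a) by rewrite nzstep_sigma e.
by move: ha hb; rewrite !Hc => /eqP -> /eqP ->.
Qed.

Lemma src_sigma a : src (sigma a) = tgt a.
Proof. by have := nzstep_sigma a (sigma a); rewrite eqxx => /andP[/eqP]. Qed.

Lemma nzpath_traject (a : E) w : path (@nzstep Q) a w ->
  a :: w = traject (@sigma Q) a (size w).+1.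
Proof.
elim: w a => //= b w IH a /andP[]; rewrite nzstep_sigma => /eqP -> pw.
by rewrite (IH _ pw).
Qed.

Lemma c_eltE (p : nzpath Q) : c_elt Q k p =
  (if (val p).2 is a :: w then size w == (order (@sigma Q) a).-1 else false)%:R.
Proof.
have pE (a : E) (u : V * seq E) : u = (src a, orbit (@sigma Q) a) ->
    u.2 = a :: behead (orbit (@sigma Q) a).
  by move=> -> /=; rewrite /orbit -orderSpred.
have cs : c_elt Q k p = \sum_a (val p == (src a, orbit (@sigma Q) a))%:R.
  by rewrite /c_elt; elim/big_rec2: _ => //= a x y _ <-.
have := valP p; rewrite cs; case e: (val p) => [v [|a w]] /=.
  by move=> _; rewrite big1 // => b _; case: eqP => // /pE.
rewrite /is_nzpath /= => /andP[/eqP sa pw].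
rewrite (bigD1 a) //= big1 ?addr0 => [|b /negP ba]; last first.
  by case: eqP => // /pE [ab _]; case: ba; rewrite ab.
congr (_%:R); congr nat_of_bool; rewrite -sa.
apply/eqP/eqP => [[h]|h].
  by have := congr1 size h; rewrite size_orbit -orderSpred => -[].
by rewrite (nzpath_traject pw) h orderSpred.
Qed.

Lemma nzpathE (p : nzpath Q) : plen p != 0%N ->
  exists a, val p = (src a, traject (@sigma Q) a (plen p)).
Proof.
case: p => [[v [|a w]] hp] //= _; exists a; move: hp.
rewrite /plen /is_nzpath /= => /andP[/eqP <- pw]; congr (_, _).
by rewrite [LHS](nzpath_traject pw).
Qed.

Lemma drop_traject (T : Type) (f : T -> T) x m n :
  drop m (traject f x n) = traject f (iter m f x) (n - m).
Proof.
elim: m n x => [|m IH] n x; first by rewrite drop0 subn0.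
by case: n => [|n] //; rewrite iterSr subSS /= IH.
Qed.

Lemma order_iter_sigma a n :
  order (@sigma Q) (iter n (@sigma Q) a) = order (@sigma Q) a.
Proof.
have /eq_card : fconnect (@sigma Q) (iter n (@sigma Q) a) =i
    fconnect (@sigma Q) a.
  move=> b; rewrite !inE; apply/esym/same_connect; first exact: fconnect_sym sigma_inj.
  exact: fconnect_iter.
by [].
Qed.

Lemma c_elt_central (x : A) : c_elt Q k * x = x * c_elt Q k.
Proof.
apply: galg_ext => p; rewrite !galg_mulE.
case: (eqVneq (plen p) 0%N) => [p0|/nzpathE[a]].
  by rewrite p0 !big_ord1 !c_elt_triv ?mulr0 ?mul0r // ?plen_suf ?plen_pre ?p0.
set n := plen p; set o := order (@sigma Q) a => pE.
have o_gt0 : (0 < o)%N by exact: order_gt0.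
have cpre (i : nat) : (i <= n)%N -> c_elt Q k (npre i p) = (i == o)%:R.
  move=> ip; rewrite c_eltE /= pE /ppre /= take_traject //.
  case: i {ip} => [|i] /=; first by rewrite eq_sym (gtn_eqF o_gt0).
  by rewrite size_traject /o -orderSpred eqSS.
have csuf (i : nat) : (i <= n)%N -> c_elt Q k (nsuf i p) = ((n - i)%N == o)%:R.
  move=> ip; rewrite c_eltE /= pE /psuf /= drop_traject.
  case: (n - i)%N => [|m] /=; first by rewrite eq_sym (gtn_eqF o_gt0).
  by rewrite size_traject order_iter_sigma /o -orderSpred eqSS.
transitivity (\sum_(i < n.+1) ((n - i)%N == o)%:R * x (npre i p)).
  by apply: eq_bigr => i _; rewrite csuf // -ltnS.
transitivity (\sum_(i < n.+1) x (nsuf i p) * (i == o :> nat)%:R); last first.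
  by apply: eq_bigr => i _; rewrite cpre // -ltnS.
case: (leqP o n) => [on|no]; last first.
  rewrite !big1 // => i _.
    by rewrite ltn_eqF ?mulr0 //; apply: leq_ltn_trans no; rewrite -ltnS.
  by rewrite ltn_eqF ?mul0r //; apply: leq_ltn_trans no; rewrite leq_subr.
have lt1 : (n - o < n.+1)%N by rewrite ltnS leq_subr.
have lt2 : (o < n.+1)%N by [].
rewrite (bigD1 (Ordinal lt1)) //= subKn // eqxx mul1r big1 ?addr0; last first.
  move=> i; rewrite -val_eqE /= => ni; case: eqP => [e|]; last by rewrite mul0r.
  by case/negP: ni; rewrite -e subKn // -ltnS.
rewrite (bigD1 (Ordinal lt2)) //= eqxx mulr1 big1 ?addr0; last first.
  by move=> i; rewrite -val_eqE /= => /negbTE ->; rewrite mulr0.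
congr (x _); apply: val_inj; rewrite /= pE /ppre /psuf /= drop_traject.
rewrite take_traject ?leq_subr // iter_order; last exact: sigma_inj.
congr (_, _); rewrite /pend /ppre /= take_traject //.
have oE : o = o.-1.+1 by rewrite /o orderSpred.
rewrite oE /= last_map last_traject -src_sigma -iterS -oE iter_order //.
exact: sigma_inj.
Qed.

Lemma galg_fps_central (r : fps k) (x : A) :
  galg_of_fps Q r * x = x * galg_of_fps Q r.
Proof.
have cx n : c_elt Q k ^+ n * x = x * c_elt Q k ^+ n.
  exact/commr_sym/commrX/esym/c_elt_central.
apply: galg_ext => p.
have pre_le i : (plen (npre i p) <= plen p)%N.
  by rewrite /plen /= size_take_min geq_minr.
have suf_le i : (plen (nsuf i p) <= plen p)%N by rewrite plen_suf leq_subr.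
transitivity (\sum_(i < (plen p).+1) r i * (c_elt Q k ^+ i * x) p).
  rewrite galg_mulE.
  under eq_bigr => i _ do rewrite (galg_of_fpsE r (suf_le i)) mulr_suml.
  rewrite exchange_big; apply: eq_bigr => i _.
  by rewrite galg_mulE mulr_sumr; apply: eq_bigr => j _; rewrite mulrA.
rewrite galg_mulE.
under [RHS]eq_bigr => i _ do rewrite (galg_of_fpsE r (pre_le i)) mulr_sumr.
rewrite [RHS]exchange_big; apply: eq_bigr => i _.
by rewrite cx galg_mulE mulr_sumr; apply: eq_bigr => j _; rewrite mulrCA.
Qed.

(* The structure of algebra over k[[c]]. *)
Definition galg_R : central_morph (fps k) A := CentralMorph galg_fps_central.

End GentleAlgebra.

Section Dualising.
Variables (R : comPzRingType) (A : pzRingType) (phi : central_morph R A).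

Record dualising := Dualising {
  dual_fun :> A -> R;
  dualD : forall x y, dual_fun (x + y) = dual_fun x + dual_fun y;
  dualZ : forall r x, dual_fun (phi r * x) = r * dual_fun x
}.
Implicit Types f g : dualising.

Lemma dual_ext f g : (forall x, f x = g x) -> f = g.
Proof.
case: f g => [f Df Zf] [g Dg Zg] /= /funext e; subst g.
by congr Dualising; apply: Prop_irrelevance.
Qed.

HB.instance Definition _ := gen_eqMixin dualising.
HB.instance Definition _ := gen_choiceMixin dualising.

Definition dual_zero : dualising.
Proof. by exists (fun=> 0) => *; rewrite ?addr0 ?mulr0. Defined.
Definition dual_opp f : dualising.
Proof.
by exists (fun x => - f x) => *; rewrite ?dualD ?dualZ ?opprD ?mulrN.
Defined.
Definition dual_add f g : dualising.
Proof.
exists (fun x => f x + g x) => *; first by rewrite !dualD addrACA.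
by rewrite !dualZ mulrDr.
Defined.

Fact dual_addA : associative dual_add.
Proof. by move=> f g h; apply: dual_ext => x /=; rewrite addrA. Qed.
Fact dual_addC : commutative dual_add.
Proof. by move=> f g; apply: dual_ext => x /=; rewrite addrC. Qed.
Fact dual_add0 : left_id dual_zero dual_add.
Proof. by move=> f; apply: dual_ext => x /=; rewrite add0r. Qed.
Fact dual_addN : left_inverse dual_zero dual_opp dual_add.
Proof. by move=> f; apply: dual_ext => x /=; rewrite addNr. Qed.
HB.instance Definition _ :=
  GRing.isZmodule.Build dualising dual_addA dual_addC dual_add0 dual_addN.

(* (a f b)(x) = f (b x a) *)
Definition dual_lmul (a : A) f : dualising.
Proof.
exists (fun x => f (x * a)) => *; first by rewrite mulrDl dualD.
by rewrite -mulrA dualZ.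
Defined.
Definition dual_rmul f (b : A) : dualising.
Proof.
exists (fun x => f (b * x)) => *; first by rewrite mulrDr dualD.
by rewrite mulrA -centralP -mulrA dualZ.
Defined.

Fact dual_lmulA a b f : dual_lmul a (dual_lmul b f) = dual_lmul (a * b) f.
Proof. by apply: dual_ext => x /=; rewrite mulrA. Qed.
Fact dual_lmul1 : left_id 1 dual_lmul.
Proof. by move=> f; apply: dual_ext => x /=; rewrite mulr1. Qed.
Fact dual_lmulDr : right_distributive dual_lmul +%R.
Proof. by move=> a f g; apply: dual_ext. Qed.
Fact dual_lmulDl f : {morph dual_lmul^~ f : a b / a + b}.
Proof. by move=> a b; apply: dual_ext => x /=; rewrite mulrDr dualD. Qed.
HB.instance Definition _ := GRing.Zmodule_isLmodule.Build A dualising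
  dual_lmulA dual_lmul1 dual_lmulDr dual_lmulDl.

Section Tensor.
Variable M : lmodType A.

Definition balanced (U : zmodType) (t : dualising -> M -> U) : Prop :=
  [/\ forall f g x, t (f + g) x = t f x + t g x,
      forall f x y, t f (x + y) = t f x + t f y
    & forall f a x, t (dual_rmul f a) x = t f (a *: x)].

(* [t] exhibits T as the left module omega (x)_A M (universal property). *)
Definition is_tensor (T : lmodType A) (t : dualising -> M -> T) : Prop :=
  [/\ balanced t,
      forall a f x, t (a *: f) x = a *: t f x
    & forall (U : zmodType) (u : dualising -> M -> U), balanced u ->
        exists v : {additive T -> U}, (forall f x, v (t f x) = u f x) /\
          forall v' : {additive T -> U},
            (forall f x, v' (t f x) = u f x) -> v' =1 v].

End Tensor.

(* W is the complex omega (x)_A P. *)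
Definition is_tensor_cplx (P W : cplx A) : Prop :=
  exists t : forall n, dualising -> P n -> W n,
    (forall n, is_tensor (t n)) /\
    (forall n f x, cdif W n (t n f x) = t (n + 1) f (cdif P n x)).

(* T represents omega (x)^L_A X: there are a resolution P -> X by a bounded
   above complex of finitely generated projective modules and an isomorphism
   omega (x)_A P <- Z -> T in the derived category of all A-modules (the
   complex omega (x)_A P itself is not bounded in general). *)
Definition is_dtensor (X T : bcplx A) : Prop :=
  exists (P : cplx A) (e : chmap P X) (W Z : cplx A)
    (u : chmap Z W) (v : chmap Z T),
    [/\ bounded_above P, degreewise (@fg_projective A) P, quasi_iso e,
        is_tensor_cplx P W & quasi_iso u /\ quasi_iso v].

End Dualising.

(* The left ideal A a of A. *)
Section LeftIdeal.
Variables (A : pzRingType) (a : A).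

Definition lideal : {pred A^o} := fun x => `[< exists b, x = b * a >].
Fact lideal_submod : submod_closed lideal.
Proof.
split=> [|b x y]; first by apply/asboolP; exists 0; rewrite mul0r.
move=> /asboolP[c ->] /asboolP[d ->]; apply/asboolP; exists (b * c + d).
by rewrite mulrDl -mulrA.
Qed.
HB.instance Definition _ := GRing.isSubmodClosed.Build A A^o lideal
  lideal_submod.

Record left_ideal := LeftIdeal {
  lideal_val :> A^o;
  _ : lideal_val \in lideal
}.
HB.instance Definition _ := [isSub for lideal_val].
HB.instance Definition _ := [Choice of left_ideal by <:].
HB.instance Definition _ := [SubChoice_isSubLmodule of left_ideal by <:].

Fact left_ideal_fg : fin_gen left_ideal.
Proof.
have ha : (a : A^o) \in lideal by apply/asboolP; exists 1; rewrite mul1r.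
exists 1%N, (fun=> LeftIdeal ha) => -[x hx]; have /asboolP[b e] := hx.
by exists (fun=> b); rewrite big_ord1; apply: val_inj.
Qed.

End LeftIdeal.

Section Stalk.
Variables (A : pzRingType) (M : lmodType A).

Definition stalk_mod (n : int) : lmodType A :=
  if n is Posz 0 then M else 'rV[A]_0.
Definition stalk : cplx A :=
  @Cplx A stalk_mod (fun n => \0) (fun n x => erefl).

Fact stalk_bounded : bounded stalk.
Proof.
by exists 0%N => -[[|n]|n] //= _ x; apply/rowP => -[].
Qed.
Fact stalk_fg : fin_gen M -> degreewise (@fin_gen A) stalk.
Proof.
move=> h; have h0 : fin_gen 'rV[A]_0.
  by exists 0%N, (fun=> 0) => x; exists (fun=> 0); apply/rowP => -[].
by case=> [[|n]|n].
Qed.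
Definition bstalk (h : fin_gen M) : bcplx A :=
  BCplx stalk_bounded (stalk_fg h).

End Stalk.

Section GentleSing.
Variables (k : fieldType) (Q : bound_quiver).

Definition Dsg : lincat k := sing_cat (galg_k Q k).

(* The left ideal A a, in degree 0. *)
Definition L (a : arr Q) : bcplx (gentle_alg Q k) :=
  bstalk (left_ideal_fg (arrow_elt k a)).

End GentleSing.

(* Main.v *)
(* For an arrow a on a differential cycle put b_0 = a and let b_(n-1) be the
   arrow following b_n for which b_(n-1) b_n = 0; this gives a doubly infinite
   exact complex T of right multiplications by the b_n on the projectives
   A e_(t(b_n)), whose left half resolves L_a = A a.  Chain maps from T to X
   modulo homotopy are computed by families of elements of X ("twisted
   cocycles"); this functor inverts quasi-isomorphisms and kills perfect
   complexes, hence factors through D_sg(A), and a Yoneda argument identifies it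
   with Hom(L_a, -).  Its value on L_b is k or 0, which gives (2), and shows that
   the L_a are indecomposable and pairwise non-isomorphic.

   Any complex becomes isomorphic in D_sg(A) to a module M in a single degree;
   the second syzygy of M is contained in the radical of a projective module and
   is stable under the projections onto the paths with a given last arrow.  As the
   A a are uniserial, it is a direct sum of modules A c.  Such a module has finite
   projective dimension if c is not on a differential cycle, and is a suspension
   of some L_a otherwise.

   For the dualising bimodule, evaluation along the admissible cycles, with
   opposite signs for the two arrows starting at a 2-regular vertex v, defines a
   functional f_v such that x |-> x f_v is an isomorphism from A e_v to omega e_v,
   and f_(t(b)) b = +-b f_(s(b)).  Hence omega (x)_A - maps the resolution of
   L_a to itself up to signs.  Independence of the choice of a resolution P follows
   from a comparison with this one, whose cone is contractible. *)

From HB Require Import structures.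
Require Import Defs.
From mathcomp Require Import all_boot all_order all_algebra.
From mathcomp Require Import boolp.
From mathcomp Require Import zify.
From Stdlib Require Import Setoid Morphisms.
Import Defs.

Set Implicit Arguments.
Unset Strict Implicit.
Unset Printing Implicit Defensive.

Import Order.TTheory GRing.Theory Num.Theory.
Local Open Scope ring_scope.

(** * Linear categories and their localisations *)

(** Morphisms of the localisations are words in formal inverses, so no calculus of fractions is at
    hand for computing Hom spaces. What does extend to words, by induction on them, is a functor
    that inverts the localised morphisms, and a transformation that is natural before localising.
    Applied to Tate cohomology F and to the map [eta] from Tate classes of X to morphisms L_a -> X,
    this gives f = [eta] (F(f)(tautological class)) for every f : L_a -> X. It bounds Hom from
    above; that the tautological class does not vanish bounds it from below. The complex T is
    unbounded, hence no object of the bounded derived category. It is replaced by truncations to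
    [-N, N], closed off on the left by a left ideal, and the choice of N has to be shown irrelevant.
    Two syzygies are needed because a relation between generators x_j can be cut according to last
    arrows only if the x_j have coordinates in A, that is, if they already lie in a first syzygy. *)

#[local] Instance heq_equiv (k : fieldType) (C : lincat k) (X Y : C) :
  Equivalence (@heq k C X Y).
Proof.
split; first by move=> f; exact: heq_refl.
  by move=> f g; exact: heq_sym.
by move=> f g h; exact: heq_trans.
Qed.
#[local] Instance hcomp_proper (k : fieldType) (C : lincat k) (X Y Z : C) :
  Proper (@heq k C Y Z ==> @heq k C X Y ==> @heq k C X Z) (@hcomp k C X Y Z).
Proof. by move=> f f' e g g' e'; exact: hcomp_cong. Qed.
#[local] Instance hadd_proper (k : fieldType) (C : lincat k) (X Y : C) :
  Proper (@heq k C X Y ==> @heq k C X Y ==> @heq k C X Y) (@hadd k C X Y).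
Proof. by move=> f f' e g g' e'; exact: hadd_cong. Qed.
#[local] Instance hscale_proper (k : fieldType) (C : lincat k) (X Y : C) a :
  Proper (@heq k C X Y ==> @heq k C X Y) (@hscale k C X Y a).
Proof. by move=> f f' e; exact: hscale_cong. Qed.

#[local] Hint Resolve heq_refl : core.

Section LinCatTheory.
Variables (k : fieldType) (C : lincat k).
Implicit Types X Y Z : C.

Lemma haddf0 X Y (f : hom X Y) : hadd f (hzero X Y) =h f.
Proof. by rewrite haddC hadd0f. Qed.

Lemma hscale0f X Y (f : hom X Y) : hscale 0 f =h hzero X Y.
Proof. by rewrite -(addNr 1) hscaleDl hscale1 haddN1f. Qed.

Lemma hcomp0f X Y Z (g : hom X Y) : hcomp (hzero Y Z) g =h hzero X Z.
Proof. by rewrite -(hscale0f (hzero Y Z)) hcompZl hscale0f. Qed.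

Lemma hcompf0 X Y Z (f : hom Y Z) : hcomp f (hzero X Y) =h hzero X Z.
Proof. by rewrite -(hscale0f (hzero X Y)) hcompZr hscale0f. Qed.

Lemma is_iso_idm X : is_iso (idm X).
Proof. by exists (idm X); split; rewrite hcomp1f. Qed.

Lemma is_iso_comp X Y Z (f : hom Y Z) (g : hom X Y) :
  is_iso f -> is_iso g -> is_iso (hcomp f g).
Proof.
move=> [f' [f1 f2]] [g' [g1 g2]]; exists (hcomp g' f'); split.
  by rewrite hcompA -[hcomp (hcomp g' f') f]hcompA f1 hcompf1.
by rewrite hcompA -[hcomp (hcomp f g) g']hcompA g2 hcompf1.
Qed.

Lemma is_iso_heq X Y (f g : hom X Y) : f =h g -> is_iso f -> is_iso g.
Proof. by move=> e [h [h1 h2]]; exists h; split; rewrite -e. Qed.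

Lemma isomorphic_refl X : isomorphic X X.
Proof. by exists (idm X); exact: is_iso_idm. Qed.

Lemma isomorphic_sym X Y : isomorphic X Y -> isomorphic Y X.
Proof. by move=> [f [g [h1 h2]]]; exists g, f. Qed.

Lemma isomorphic_trans X Y Z :
  isomorphic X Y -> isomorphic Y Z -> isomorphic X Z.
Proof. by move=> [f hf] [g hg]; exists (hcomp g f); exact: is_iso_comp. Qed.

Lemma is_zero_iso X Y : isomorphic X Y -> is_zero X -> is_zero Y.
Proof.
move=> [f [g [h1 h2]]] z.
have -> : is_zero Y <-> hcomp f g =h hzero Y Y by rewrite /is_zero h2.
by rewrite -[g]hcomp1f z hcomp0f hcompf0.
Qed.

Lemma biproduct_iso X Y Z Z' :
  isomorphic Z Z' -> is_biproduct X Y Z -> is_biproduct X Y Z'.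
Proof.
move=> [f [g [h1 h2]]] [i [j [p [q [e1 e2 e3 e4 e5]]]]].
have E W W' (a : hom Z W') (b : hom W Z) :
    hcomp (hcomp a g) (hcomp f b) =h hcomp a b.
  by rewrite hcompA -[hcomp (hcomp a g) f]hcompA h1 hcompf1.
exists (hcomp f i), (hcomp f j), (hcomp p g), (hcomp q g).
split; rewrite ?E //.
have E' (W : C) (a : hom Z W) (b : hom W Z) :
    hcomp (hcomp f b) (hcomp a g) =h hcomp (hcomp f (hcomp b a)) g.
  by rewrite !hcompA.
by rewrite !E' -hcompDl -hcompDr e5 hcompf1.
Qed.

Lemma indecomposable_iso X Y :
  isomorphic X Y -> indecomposable X -> indecomposable Y.
Proof.
move=> h [h0 hX]; split.
  by move=> z; apply: h0; apply: is_zero_iso z; exact: isomorphic_sym.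
by move=> U V b; apply: hX; apply: biproduct_iso b; exact: isomorphic_sym.
Qed.

Lemma biproduct_zero X Y Z : is_biproduct X Y Z -> is_zero X -> isomorphic Y Z.
Proof.
move=> [i [j [p [q [e1 e2 e3 e4 e5]]]]] z; exists j, q; split=> //.
have pz : p =h hzero Z X by rewrite -[p]hcomp1f z hcomp0f.
by rewrite -e5 pz hcompf0 hadd0f.
Qed.

Lemma biproductC X Y Z : is_biproduct X Y Z -> is_biproduct Y X Z.
Proof.
move=> [i [j [p [q [e1 e2 e3 e4 e5]]]]]; exists j, i, q, p; split=> //.
by rewrite haddC.
Qed.

Lemma hom_dim0 X Y : hom_dim X Y 0 -> forall f g : hom X Y, f =h g.
Proof.
move=> [e [he _]] f g.
have h0 (f' : hom X Y) : f' =h hzero X Y.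
  by have [c ->] := he f'; rewrite /lin_comb big_ord0.
by rewrite (h0 f) (h0 g).
Qed.

Lemma hom_dim1P X Y : hom_dim X Y 1 <->
  exists2 e : hom X Y, ~ e =h hzero X Y & forall f, exists c, f =h hscale c e.
Proof.
split=> [[e [he hc]]|[e e0 he]].
  exists (e ord0) => [e0|f].
    have l0 : lin_comb e (fun=> 1) =h hzero X Y.
      by rewrite /lin_comb big_ord_recl big_ord0 hscale1 e0 haddf0.
    by have /eqP := hc _ l0 ord0; rewrite oner_eq0.
  have [c hc'] := he f; exists (c ord0); rewrite hc'.
  by rewrite /lin_comb big_ord_recl big_ord0 haddf0.
exists (fun=> e); split=> [f|c].
  have [c hc] := he f; exists (fun=> c); rewrite hc.
  by rewrite /lin_comb big_ord_recl big_ord0 haddf0.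
rewrite /lin_comb big_ord_recl big_ord0 haddf0 => ce i; rewrite ord1.
have [//|c0] := eqVneq (c ord0) 0; case: e0.
by rewrite -[e]hscale1 -(mulVf c0) -hscaleA ce -(hscale0f e) hscaleA mulr0.
Qed.

(** The idempotent i p of a decomposition is a scalar multiple of the identity. If the scalar is
    zero then p = 0; otherwise q i p = 0 forces q = 0. *)
Lemma indecomposable_hom_dim X : hom_dim X X 1 -> indecomposable X.
Proof.
move=> /hom_dim1P[e e0 he]; split=> [z|U V [i [j [p [q [e1 e2 e3 e4 e5]]]]]].
  by apply: e0; rewrite -[e]hcomp1f z hcomp0f.
have ee : exists2 c, c != 0 & idm X =h hscale c e.
  have [c hc] := he (idm X); exists c => //; apply/eqP => c0.
  by apply: e0; rewrite -[e]hcomp1f hc c0 hscale0f hcomp0f.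
have [c c0 ce] := ee; have [d hd] := he (hcomp i p).
have eI : e =h hscale c^-1 (idm X).
  by rewrite ce hscaleA mulVf // hscale1.
have ip : hcomp i p =h hscale (d / c) (idm X) by rewrite hd eI hscaleA.
have pip : p =h hscale (d / c) p.
  by rewrite -{1}[p]hcomp1f -e1 -hcompA ip hcompZr hcompf1.
case: (eqVneq d 0) ip pip => [-> ip pip|d0 ip _].
  left; rewrite /is_zero -e1 pip mul0r hcompZl.
  by rewrite hscale0f.
right; have qip : hcomp q (hcomp i p) =h hzero X V by rewrite hcompA e3 hcomp0f.
have q0 : q =h hzero X V.
  rewrite -[q]hscale1 -(mulVf (mulf_neq0 d0 (invr_neq0 c0))) -hscaleA.
  rewrite -[X in hscale _ (hscale _ X)]hcompf1 -hcompZr -ip qip.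
  by rewrite -(hscale0f (hzero X V)) hscaleA mulr0.
by rewrite /is_zero -e2 q0 hcomp0f.
Qed.

End LinCatTheory.

(** * Linear functors and the universal property of localisations *)

Record linfun (k : fieldType) (C D : lincat k) := LinFun {
  fob :> C -> D;
  fmap : forall X Y : C, hom X Y -> hom (fob X) (fob Y);
  fmap_cong : forall X Y (f g : hom X Y), f =h g -> fmap f =h fmap g;
  fmap1 : forall X, fmap (idm X) =h idm (fob X);
  fmap_comp : forall X Y Z (f : hom Y Z) (g : hom X Y),
    fmap (hcomp f g) =h hcomp (fmap f) (fmap g);
  fmapD : forall X Y (f g : hom X Y), fmap (hadd f g) =h hadd (fmap f) (fmap g);
  fmapZ : forall X Y a (f : hom X Y), fmap (hscale a f) =h hscale a (fmap f)
}.

#[local] Instance fmap_proper (k : fieldType) (C D : lincat k) (F : linfun C D)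
  (X Y : C) : Proper (@heq k C X Y ==> @heq k D _ _) (@fmap k C D F X Y).
Proof. by move=> f f' e; exact: fmap_cong. Qed.

Section LinFunTheory.
Variables (k : fieldType) (C D : lincat k) (F : linfun C D).
Implicit Types X Y : C.

Lemma fmap0 X Y : fmap F (hzero X Y) =h hzero (F X) (F Y).
Proof. by rewrite -(hscale0f (hzero X Y)) fmapZ hscale0f. Qed.

Lemma fmap_iso X Y (f : hom X Y) : is_iso f -> is_iso (fmap F f).
Proof.
move=> [g [h1 h2]]; exists (fmap F g).
by split; rewrite -fmap_comp ?h1 ?h2 fmap1.
Qed.

Lemma fmap_zero X : is_zero X -> is_zero (F X).
Proof. by move=> z; rewrite /is_zero -fmap1 z fmap0. Qed.

Lemma fmap_biproduct X Y Z : is_biproduct X Y Z -> is_biproduct (F X) (F Y) (F Z).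
Proof.
move=> [i [j [p [q [e1 e2 e3 e4 e5]]]]].
exists (fmap F i), (fmap F j), (fmap F p), (fmap F q).
by split; rewrite -!fmap_comp ?e1 ?e2 ?e3 ?e4 ?fmap1 ?fmap0 // -fmapD e5 fmap1.
Qed.

End LinFunTheory.

Definition id_fun (k : fieldType) (C : lincat k) : linfun C C :=
  @LinFun k C C (fun X => X) (fun _ _ f => f) (fun _ _ _ _ e => e)
    (fun _ => heq_refl _) (fun _ _ _ _ _ => heq_refl _)
    (fun _ _ _ _ => heq_refl _) (fun _ _ _ _ => heq_refl _).

Section LocalisationTheory.
Variables (k : fieldType) (C : lincat k).
Variable S : forall X Y : C, hom X Y -> Prop.
Local Notation CS := (localisation S).

Definition loc_fun : linfun C CS :=
  @LinFun k C CS (fun X => X) (fun X Y => @loc_map k C S X Y)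
    (fun X Y f g => @zz_of_cong k C S X Y f g)
    (fun X => @zz_refl k C S X X _)
    (fun X Y Z => @zz_of_comp k C S X Y Z)
    (fun X Y => @zz_of_add k C S X Y) (fun X Y => @zz_of_scale k C S X Y).

Lemma loc_map_iso X Y (s : hom X Y) : S s -> is_iso (loc_map S s).
Proof.
move=> Ss; exists (zz_inv Ss : @hom k CS Y X).
by split; [exact: zz_invl | exact: zz_invr].
Qed.

Variables (D : lincat k) (F : linfun C D).
Hypothesis FS : forall X Y (s : hom X Y), S s -> is_iso (fmap F s).

Definition iso_inv X Y (s : hom X Y) (Ss : S s) : hom (F Y) (F X) :=
  projT1 (cid (FS Ss)).

Lemma iso_invP X Y (s : hom X Y) (Ss : S s) :
  is_inverse (fmap F s) (iso_inv Ss).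
Proof. exact: projT2 (cid _). Qed.

Fixpoint lift_map X Y (f : zigzag S X Y) : hom (F X) (F Y) :=
  match f in zigzag _ X Y return hom (F X) (F Y) with
  | zz_of X Y f => fmap F f
  | zz_inv X Y s Ss => iso_inv Ss
  | zz_comp X Y Z f g => hcomp (lift_map f) (lift_map g)
  | zz_add X Y f g => hadd (lift_map f) (lift_map g)
  | zz_scale X Y a f => hscale a (lift_map f)
  end.

Lemma lift_map_cong X Y (f g : zigzag S X Y) :
  zz_eq f g -> lift_map f =h lift_map g.
Proof.
elim=> {X Y f g} /=; intros.
- reflexivity.
- by symmetry.
- by rewrite H0.
- exact: hcomp_cong.
- exact: hadd_cong.
- exact: hscale_cong.
- exact: fmap_cong.
- exact: fmap_comp.
- exact: fmapD.
- exact: fmapZ.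
- by rewrite fmap1; have [] := iso_invP Ss.
- by rewrite fmap1; have [] := iso_invP Ss.
- exact: hcompA.
- by rewrite fmap1 hcomp1f.
- by rewrite fmap1 hcompf1.
- exact: haddA.
- exact: haddC.
- by rewrite fmap0 hadd0f.
- by rewrite fmap0 haddN1f.
- exact: hscaleA.
- exact: hscale1.
- exact: hscaleDr.
- exact: hscaleDl.
- exact: hcompDl.
- exact: hcompDr.
- exact: hcompZl.
- exact: hcompZr.
Qed.

Definition loc_lift : linfun CS D :=
  @LinFun k CS D (fob F) lift_map lift_map_cong
    (fun X => fmap1 F X) (fun _ _ _ _ _ => heq_refl _)
    (fun _ _ _ _ => heq_refl _) (fun _ _ _ _ => heq_refl _).

End LocalisationTheory.

(* Vector spaces whose equality is an arbitrary equivalence relation, since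
   Hom-sets are setoids. *)
Record svect (k : fieldType) := SVect {
  sv_car :> Type;
  sveq : sv_car -> sv_car -> Prop;
  sv0 : sv_car;
  svadd : sv_car -> sv_car -> sv_car;
  svscale : k -> sv_car -> sv_car;
  sveq_refl : forall x, sveq x x;
  sveq_sym : forall x y, sveq x y -> sveq y x;
  sveq_trans : forall x y z, sveq x y -> sveq y z -> sveq x z;
  svadd_cong : forall x x' y y',
    sveq x x' -> sveq y y' -> sveq (svadd x y) (svadd x' y');
  svscale_cong : forall a x x', sveq x x' -> sveq (svscale a x) (svscale a x');
  svaddA : forall x y z, sveq (svadd x (svadd y z)) (svadd (svadd x y) z);
  svaddC : forall x y, sveq (svadd x y) (svadd y x);
  svadd0 : forall x, sveq (svadd sv0 x) x;
  svaddN : forall x, sveq (svadd (svscale (-1) x) x) sv0;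
  svscaleA : forall a b x, sveq (svscale a (svscale b x)) (svscale (a * b) x);
  svscale1 : forall x, sveq (svscale 1 x) x;
  svscaleDr : forall a x y,
    sveq (svscale a (svadd x y)) (svadd (svscale a x) (svscale a y));
  svscaleDl : forall a b x,
    sveq (svscale (a + b) x) (svadd (svscale a x) (svscale b x))
}.
Arguments sveq {k s} _ _.
Arguments sv0 {k} s.
Arguments svadd {k s} _ _.
Arguments svscale {k s} _ _.

#[local] Instance sveq_equiv (k : fieldType) (V : svect k) :
  Equivalence (@sveq k V).
Proof.
split; first by move=> f; exact: sveq_refl.
  by move=> f g; exact: sveq_sym.
by move=> f g h; exact: sveq_trans.
Qed.
#[local] Instance svadd_proper (k : fieldType) (V : svect k) :
  Proper (@sveq k V ==> @sveq k V ==> @sveq k V) (@svadd k V).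
Proof. by move=> f f' e g g' e'; exact: svadd_cong. Qed.
#[local] Instance svscale_proper (k : fieldType) (V : svect k) a :
  Proper (@sveq k V ==> @sveq k V) (@svscale k V a).
Proof. by move=> f f' e; exact: svscale_cong. Qed.
#[local] Hint Resolve sveq_refl : core.

Record svhom (k : fieldType) (V W : svect k) := SVHom {
  sv_fun :> V -> W;
  svhom_cong : forall x y, sveq x y -> sveq (sv_fun x) (sv_fun y);
  svhomD : forall x y, sveq (sv_fun (svadd x y)) (svadd (sv_fun x) (sv_fun y));
  svhomZ : forall a x, sveq (sv_fun (svscale a x)) (svscale a (sv_fun x))
}.

#[local] Instance svhom_proper (k : fieldType) (V W : svect k) (f : svhom V W) :
  Proper (@sveq k V ==> @sveq k W) f.
Proof. by move=> x y; exact: svhom_cong. Qed.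

Section SVectCat.
Variable k : fieldType.
Implicit Types U V W : svect k.

Lemma svscale0 V (x : V) : sveq (svscale 0 x) (sv0 V).
Proof. by rewrite -(addNr 1) svscaleDl svscale1 svaddN. Qed.

Lemma svscaler0 V (a : k) : sveq (svscale a (sv0 V)) (sv0 V).
Proof. by rewrite -(svscale0 (sv0 V)) svscaleA mulr0. Qed.

Lemma svaddACA V (x y z t : V) :
  sveq (svadd (svadd x y) (svadd z t)) (svadd (svadd x z) (svadd y t)).
Proof.
by rewrite -svaddA [svadd y _]svaddA [svadd y z]svaddC -[svadd (svadd z y) t]svaddA svaddA.
Qed.

Definition svid V : svhom V V.
Proof. by exists (fun x => x). Defined.
Definition svcomp U V W (f : svhom V W) (g : svhom U V) : svhom U W.
Proof.
exists (fun x => f (g x)) => [x y ->|x y|a x] //; first by rewrite !svhomD.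
by rewrite !svhomZ.
Defined.
Definition svzero V W : svhom V W.
Proof.
by exists (fun=> sv0 W) => *; rewrite ?svadd0 ?svscaler0.
Defined.
Definition svhadd V W (f g : svhom V W) : svhom V W.
Proof.
exists (fun x => svadd (f x) (g x)) => [x y ->|x y|a x] //.
  by rewrite !svhomD svaddACA.
by rewrite !svhomZ svscaleDr.
Defined.
Definition svhscale V W (a : k) (f : svhom V W) : svhom V W.
Proof.
exists (fun x => svscale a (f x)) => [x y ->|x y|b x] //.
  by rewrite !svhomD svscaleDr.
by rewrite !svhomZ !svscaleA mulrC.
Defined.

Definition svect_cat : lincat k.
Proof.
refine (@LinCat k (svect k) (@svhom k)
  (fun V W f g => forall x : V, sveq (f x) (g x))
  svid svcomp svzero svhadd svhscale
  _ _ _ _ _ _ _ _ _ _ _ _ _ _ _ _ _ _ _ _ _) => //=.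
- by move=> X Y f g e x; rewrite e.
- by move=> X Y f g h e e' x; rewrite e.
- by move=> X Y Z f f' g g' e e' x; rewrite e e'.
- by move=> X Y f f' g g' e e' x; rewrite e e'.
- by move=> X Y a f f' e x; rewrite e.
- by move=> X Y f g h x; rewrite svaddA.
- by move=> X Y f g x; rewrite svaddC.
- by move=> X Y f x; rewrite svadd0.
- by move=> X Y f x; rewrite svaddN.
- by move=> X Y a b f x; rewrite svscaleA.
- by move=> X Y f x; rewrite svscale1.
- by move=> X Y a f g x; rewrite svscaleDr.
- by move=> X Y a b f x; rewrite svscaleDl.
- by move=> X Y Z f g g' x; rewrite svhomD.
- by move=> X Y Z a f g x; rewrite svhomZ.
Defined.

(** The inverse comes from a choice of preimages; injectivity modulo [sveq] makes any such choice
    compatible with [sveq] and linear. *)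
Lemma svect_iso V W (f : svhom V W) :
  (forall x, sveq (f x) (sv0 W) -> sveq x (sv0 V)) ->
  (forall y, exists x, sveq (f x) y) -> is_iso (f : @hom k svect_cat V W).
Proof.
move=> inj surj.
have inj2 x y : sveq (f x) (f y) -> sveq x y.
  move=> e; rewrite -[y]svadd0 -(inj (svadd x (svscale (-1) y))); last first.
    by rewrite svhomD svhomZ e svaddC svaddN.
  by rewrite -svaddA svaddN svaddC svadd0.
have [g fg] := choice surj.
have gc x y : sveq x y -> sveq (g x) (g y) by move=> e; apply: inj2; rewrite !fg.
have gD x y : sveq (g (svadd x y)) (svadd (g x) (g y)).
  by apply: inj2; rewrite svhomD !fg.
have gZ (a : k) x : sveq (g (svscale a x)) (svscale a (g x)).
  by apply: inj2; rewrite svhomZ !fg.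
by exists (SVHom gc gD gZ); split=> [x|x] //=; apply: inj2; rewrite fg.
Qed.

Lemma svect_iso_inj V W (f : @hom k svect_cat V W) (x y : V) :
  is_iso f -> sveq ((f : svhom V W) x) ((f : svhom V W) y) -> sveq x y.
Proof.
move=> [g [h _]] e; have h' z : sveq ((g : svhom W V) ((f : svhom V W) z)) z.
  exact: h.
by rewrite -(h' x) e h'.
Qed.

End SVectCat.

Section LiftNatural.
Variables (k : fieldType) (C : lincat k).
Variable S : forall X Y : C, hom X Y -> Prop.
Variables (F : linfun C (svect_cat k)).
Hypothesis FS : forall X Y (s : hom X Y), S s -> is_iso (fmap F s).
Variables (D : lincat k) (G : linfun (localisation S) D) (c : D).
Variable eta : forall X : C, (F X : svect k) -> hom c (G X).
Hypothesis eta_cong : forall (X : C) (x y : (F X : svect k)),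
  sveq x y -> eta x =h eta y.
Hypothesis etaD : forall (X : C) (x y : (F X : svect k)),
  eta (svadd x y) =h hadd (eta x) (eta y).
Hypothesis etaZ : forall (X : C) (a : k) (x : (F X : svect k)),
  eta (svscale a x) =h hscale a (eta x).
Hypothesis eta_nat : forall (X Y : C) (f : hom X Y) (x : (F X : svect k)),
  hcomp (fmap G (loc_map S f)) (eta x) =h eta ((fmap F f : svhom _ _) x).

(* Extends to the localisation a map eta : F -> Hom(c, -) that is natural on C. *)
Lemma lift_natural (X Y : localisation S) (f : hom X Y) (x : (F X : svect k)) :
  hcomp (fmap G f) (eta x) =h eta ((fmap (loc_lift FS) f : svhom _ _) x).
Proof.
move: x; elim: f => {X Y} [X Y f|X Y s Ss|X Y Z f IHf g IHg|X Y f IHf g IHg|X Y a f IHf] x /=.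
- exact: eta_nat.
(* For a formal inverse of s, the element x is F(s)(y), and naturality for s itself brings s next to
   its inverse. *)
- have [e1 e2] := iso_invP FS Ss; set y := (iso_inv FS Ss : svhom _ _) x.
  have -> : eta x =h eta ((fmap F s : svhom _ _) y).
    by apply: eta_cong; symmetry; exact: e2.
  rewrite -eta_nat hcompA -fmap_comp.
  have -> : hcomp (zz_inv Ss : @hom k (localisation S) Y X) (loc_map S s)
      =h idm (X : localisation S) by exact: zz_invl.
  by rewrite fmap1 hcomp1f.
- have -> : (zz_comp f g) = hcomp (f : @hom k (localisation S) Y Z) g by [].
  by rewrite fmap_comp -hcompA IHg IHf.
- have -> : (zz_add f g) = hadd (f : @hom k (localisation S) X Y) g by [].
  by rewrite fmapD hcompDl IHf IHg etaD.
- have -> : (zz_scale a f) = hscale a (f : @hom k (localisation S) X Y) by [].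
  by rewrite fmapZ hcompZl IHf etaZ.
Qed.

End LiftNatural.

(** * Recursion over the integers *)

Section IntRecursion.
Variables (K : int -> Type) (T : forall n, K n -> K (n + 1) -> Prop).
Variables (z : forall n, K n) (m : int).
Arguments T : clear implicits.

Lemma int_forall_succ (P : int -> Prop) : (forall n, P (n + 1)) -> forall n, P n.
Proof. by move=> h n; rewrite -(subrK 1 n). Qed.

Lemma int_reindex (s : forall n, K (n + 1)) :
  exists x : forall n, K n, forall n, x (n + 1) = s n.
Proof.
exists (fun n => ecast i (K i) (subrK 1 n) (s (n - 1))) => n.
have e : n + 1 - 1 = n by rewrite addrK.
move: (subrK 1 (n + 1)); rewrite e => e'.
by rewrite (eq_irrelevance e' erefl).
Qed.

(** The recursion runs over natural numbers j, in degree m - j. The value in degree n is then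
    characterised by agreeing with the cast of [d j] for every j with m - j = n, which keeps casts
    out of the conclusion. *)
Lemma int_rec_down : (forall n p', exists p, T n p p') ->
  exists h, (forall n, n < m -> T n (h n) (h (n + 1))) /\
    forall n, m <= n -> h n = z n.
Proof.
move=> Tstep.
have ej (j : nat) : m - j%:Z = m - j.+1%:Z + 1 by lia.
pose step j (x : K (m - j%:Z)) : K (m - j.+1%:Z) :=
  projT1 (cid (Tstep _ (ecast i (K i) (ej j) x))).
pose d := fix d j : K (m - j%:Z) :=
  if j is j'.+1 then step j' (d j') else z (m - 0%:Z).
have dP j : T _ (d j.+1) (ecast i (K i) (ej j) (d j)).
  by rewrite /= /step; case: cid.
have h n : exists x : K n, (m <= n -> x = z n) /\
    forall j (e : m - j%:Z = n), x = ecast i (K i) e (d j).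
  have [mn|nm] := leP m n.
    exists (z n); split=> // -[|j] e; last by lia.
    by case: n / e mn.
  have e : m - `|m - n|%:Z = n by lia.
  exists (ecast i (K i) e (d `|m - n|%N)); split; first by lia.
  move=> j e'; have ejj : `|m - n|%N = j by lia.
  by case: j / ejj e' => e'; rewrite (eq_irrelevance e e').
pose hh n := projT1 (cid (h n)).
have hhP n : (_ : Prop) := projT2 (cid (h n)).
exists hh; split=> n; last by have [+ _] := hhP n.
move=> nm; have [j e] : exists j : nat, m - j.+1%:Z = n.
  by exists (`|m - n|.-1)%N; lia.
subst n; clear nm.
have [_ /(_ _ erefl) hx] := hhP (m - j.+1%:Z).
have [_ /(_ _ (ej j)) hy] := hhP (m - j.+1%:Z + 1).
by rewrite /hh hx hy; exact: dP.
Qed.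

Lemma int_rec_up : (forall n p, exists p', T n p p') ->
  exists h, (forall n, m <= n -> T n (h n) (h (n + 1))) /\
    forall n, n <= m -> h n = z n.
Proof.
move=> Tstep.
have ej (j : nat) : m + j%:Z + 1 = m + j.+1%:Z by lia.
pose step j (x : K (m + j%:Z)) : K (m + j.+1%:Z) :=
  ecast i (K i) (ej j) (projT1 (cid (Tstep _ x))).
pose d := fix d j : K (m + j%:Z) :=
  if j is j'.+1 then step j' (d j') else z (m + 0%:Z).
have dP j : T _ (d j) (ecast i (K i) (esym (ej j)) (d j.+1)).
  by rewrite /= /step; case: cid => x hx /=; case: _ / (ej j).
have h n : exists x : K n, (n <= m -> x = z n) /\
    forall j (e : m + j%:Z = n), x = ecast i (K i) e (d j).
  have [mn|nm] := leP n m.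
    exists (z n); split=> // -[|j] e; last by lia.
    by case: n / e mn.
  have e : m + `|m - n|%:Z = n by lia.
  exists (ecast i (K i) e (d `|m - n|%N)); split; first by lia.
  move=> j e'; have ejj : `|m - n|%N = j by lia.
  by case: j / ejj e' => e'; rewrite (eq_irrelevance e e').
pose hh n := projT1 (cid (h n)).
have hhP n : (_ : Prop) := projT2 (cid (h n)).
exists hh; split=> n; last by have [+ _] := hhP n.
move=> nm; have [j e] : exists j : nat, m + j%:Z = n.
  by exists (`|m - n|)%N; lia.
subst n; clear nm.
have [_ /(_ _ erefl) hx] := hhP (m + j%:Z).
have [_ /(_ _ (esym (ej j))) hy] := hhP (m + j%:Z + 1).
by rewrite /hh hx hy; exact: dP.
Qed.

End IntRecursion.

Section IntChoice.
Variables (H : int -> Type) (R : forall n, H n -> H (n + 1) -> Prop).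
Variables (z : forall n, H n) (m : int).
Arguments R : clear implicits.

(** A value in degree n can be chosen only once the relation above it holds, so the recursion is on
    pairs of consecutive values. The relation [T] is an implication, which makes its step total: if
    the premise fails, any pair will do. *)
Lemma int_choice_down : (forall n, m <= n -> R n (z n) (z (n + 1))) ->
  (forall n x y, R (n + 1) x y -> exists w, R n w x) ->
  exists h, (forall n, R n (h n) (h (n + 1))) /\ forall n, m <= n -> h n = z n.
Proof.
move=> hz hR; pose K n : Type := (H n * H (n + 1))%type.
pose T n (p : K n) (p' : K (n + 1)) :=
  R _ p'.1 p'.2 -> R _ p.1 p.2 /\ p.2 = p'.1.
have [|h [h1 h2]] := @int_rec_down K T (fun n => (z n, z (n + 1))) m.
  move=> n [x y]; have [/hR[w hw]|nR] := EM (R _ x y).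
    by exists (w, x) => _.
  by exists (z n, z (n + 1)) => /nR.
have hR' n : m <= n + 1 -> R _ (h (n + 1)).1 (h (n + 1)).2.
  by move=> mn; rewrite h2 //=; apply: hz.
have RR n : R _ (h n).1 (h n).2 /\ (n < m -> (h n).2 = (h (n + 1)).1).
  have [mn|nm] := leP m n; first by rewrite h2 //; split; [exact: hz|lia].
  have [j e] : exists j : nat, n = m - j.+1%:Z by exists (`|m - n|.-1)%N; lia.
  elim: j n e nm => [|j IH] n e nm.
    have [|? ?] := h1 n nm; last by split.
    by apply: hR'; lia.
  have [||r _] := IH (n + 1); [by lia|by lia|].
  by have [] := h1 n nm r; split.
exists (fun n => (h n).1); split=> n; last by move=> mn; rewrite h2.
have [r e] := RR n; have [mn|nm] := leP m n; last by rewrite -e.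
by move: r; rewrite !h2 //; lia.
Qed.

Lemma int_choice_up : (forall n, n < m -> R n (z n) (z (n + 1))) ->
  (forall n x y, R n x y -> exists w, R (n + 1) y w) ->
  exists h, (forall n, R n (h n) (h (n + 1))) /\ forall n, n <= m -> h n = z n.
Proof.
move=> hz hR; pose K n : Type := (H n * H (n + 1))%type.
pose T n (p : K n) (p' : K (n + 1)) :=
  R _ p.1 p.2 -> R _ p'.1 p'.2 /\ p.2 = p'.1.
have [|h [h1 h2]] := @int_rec_up K T (fun n => (z n, z (n + 1))) (m - 1).
  move=> n [x y]; have [/hR[w hw]|nR] := EM (R _ x y).
    by exists (y, w) => _.
  by exists (z (n + 1), z (n + 1 + 1)) => /nR.
have RR n : R _ (h n).1 (h n).2.
  have [nm|mn] := leP n (m - 1); first by rewrite h2 //; apply: hz; lia.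
  have [j] : exists j : nat, n = m - 1 + j%:Z by exists (absz (n - m + 1)); lia.
  elim: j n {mn} => [|j IH] n e; first by rewrite h2; [apply: hz|]; lia.
  have {e} -> : n = m - 1 + j%:Z + 1 by lia.
  have mj : m - 1 <= m - 1 + j%:Z by lia.
  by have [] := h1 _ mj (IH _ erefl).
have RE n : (h n).2 = (h (n + 1)).1.
  have [mn|nm] := leP (m - 1) n; first by have [] := h1 n mn (RR n).
  by rewrite !h2 //; lia.
exists (fun n => (h n).1); split=> n; first by rewrite -RE.
rewrite le_eqVlt => /orP[/eqP->|nm]; last by rewrite h2 //; lia.
have := RE (m - 1); rewrite h2 //=.
by rewrite -[X in forall _ : _, (h X).1 = z X](subrK 1 m) => ->.
Qed.

End IntChoice.

(** * Tate cohomology of complexes *)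

Lemma addrKl (V : zmodType) (x y : V) : x + y - x = y.
Proof. by rewrite addrAC subrr add0r. Qed.

Section ChainMapTheory.
Variable A : pzRingType.
Implicit Types X Y Z : cplx A.

Definition acyclic X : Prop :=
  forall n (x : X (n + 1)), cdif X (n + 1) x = 0 -> exists y, x = cdif X n y.

Lemma cone_acyclic X Y (f : chmap X Y) : quasi_iso f -> acyclic (cone f).
Proof.
move=> [inj surj] n [x y] /= /pair_equal_spec /= [/eqP]; rewrite oppr_eq0.
move=> /eqP dx fxy; rewrite /= in x y dx fxy *.
have [|x' xE] := inj _ _ dx.
  by exists (- y); rewrite raddfN; apply: oppr_inj; rewrite opprK; exact: addr0_eq.
have dy : cdif Y (n + 1) (y + f (n + 1) x') = 0.
  by rewrite raddfD /= -cmapP -xE [LHS]addrC.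
have [x1 [y1 [dx1 yE]]] := surj _ _ dy.
exists (x1 - x', y1); apply/pair_equal_spec; split=> /=.
  by rewrite raddfB /= dx1 sub0r opprK.
by rewrite raddfB /= addrAC -yE addrK.
Qed.

Lemma acyclic_cone X Y (f : chmap X Y) : acyclic (cone f) -> quasi_iso f.
Proof.
move=> H; split.
  apply: int_forall_succ => n x dx [y fx].
  have [|[x' y'] /pair_equal_spec[/= xE _]] := H n (x, - y).
    apply/pair_equal_spec; split; first by rewrite /= dx oppr0.
    by rewrite /= raddfN fx subrr.
  by exists (- x'); rewrite raddfN.
move=> n y dy; have [|[x' y'] /pair_equal_spec[/= xE yE]] := H n (0, y).
  by apply/pair_equal_spec; split; rewrite /= ?raddf0 ?oppr0 ?dy ?addr0.
by exists x', y'; split=> //; apply/eqP; rewrite -oppr_eq0 -xE.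
Qed.

Lemma homotopic_cocycle X Y (f g : chmap X Y) : homotopic f g ->
  exists h : forall n, {linear X (n + 1) -> Y n}, forall n x,
    cdif X (n + 1) x = 0 -> f (n + 1) x = g (n + 1) x + cdif Y n (h n x).
Proof.
move=> [h hh]; exists h => n x dx; have := hh n x.
by rewrite dx raddf0 addr0 => <-; rewrite subrKC.
Qed.

Lemma quasi_iso_homotopic X Y (f g : chmap X Y) :
  homotopic f g -> quasi_iso f -> quasi_iso g.
Proof.
move=> /homotopic_cocycle[h hh] [inj surj]; split.
  move=> n x dx [y gx]; apply: (inj n x dx).
  by exists (y + h n x); rewrite raddfD /= -gx hh.
move=> n y dy; have [x [y' [dx ->]]] := surj n y dy.
by exists x, (h n x + y'); split=> //; rewrite raddfD hh //= addrA.
Qed.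

End ChainMapTheory.

Section Comp.
Variables (k : fieldType) (A : pzRingType) (iota : central_morph k A).
Implicit Types X Y Z : cplx A.

Lemma quasi_iso_comp X Y Z (f : chmap Y Z) (g : chmap X Y) :
  quasi_iso f -> quasi_iso g -> quasi_iso (ch_comp f g).
Proof.
move=> [fi fs] [gi gs]; split.
  move=> n x dx /= e; apply: gi => //; apply: fi e.
  by rewrite -cmapP dx raddf0.
move=> n z dz; have [y [z' [dy ->]]] := fs n z dz.
have [x [y' [dx ->]]] := gs n y dy; exists x, (f n y' + z'); split=> //=.
by rewrite !raddfD /= cmapP addrA.
Qed.

Lemma quasi_iso_cancel X Y Z (f : chmap Y Z) (g : chmap X Y) :
  quasi_iso f -> quasi_iso (ch_comp f g) -> quasi_iso g.
Proof.
move=> [fi fs] [gi gs]; split.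
  move=> n x dx [y gx]; apply: gi => //; exists (f n y).
  by rewrite /= gx cmapP.
move=> n y dy; have [|x [z [dx fy]]] := gs n (f (n + 1) y).
  by rewrite -cmapP dy raddf0.
have [||y' yE] := fi n (y - g (n + 1) x).
- by rewrite raddfB /= dy -cmapP dx raddf0 subr0.
- by exists z; rewrite raddfB /= fy addrKl.
by exists x, y'; split=> //; rewrite -yE subrKC.
Qed.

End Comp.

Section Twist.
Variables (k : fieldType) (A : pzRingType) (iota : central_morph k A).

(* The data [e], [u] encode the complex of right modules
   ... <- e_n A <-(u_n .)- e_(n+1) A <- ...; tcocycles modulo coboundaries
   compute the degree 0 cohomology of its tensor product with X, that is
   homotopy classes of chain maps to X from the complex with terms A e_n and
   differentials (. u_n). *)
Record twist := Twist {
  te : int -> A;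
  tu : int -> A;
  te_idem : forall n, te n * te n = te n;
  teu : forall n, te n * tu n = tu n;
  tue : forall n, tu n * te (n + 1) = tu n;
  tuu : forall n, tu n * tu (n + 1) = 0
}.

(** Exactness of the complex of right modules e_n A, the A-dual of the complex of the A e_n; this is
    what makes Tate cohomology vanish on perfect complexes. [left_exact] is exactness of the complex
    of the A e_n itself, by which its left half is a resolution. *)
Definition right_exact (t : twist) : Prop :=
  forall n x, te t (n + 1) * x = x -> tu t n * x = 0 ->
    exists y, x = tu t (n + 1) * y.

Definition left_exact (t : twist) : Prop :=
  forall n x, x * te t (n + 1) = x -> x * tu t (n + 1) = 0 ->
    exists y, x = y * tu t n.

Definition twist_shift (t : twist) : twist.
Proof.
exists (fun n => te t (n + 1)) (fun n => - tu t (n + 1)) => n.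
- exact: te_idem.
- by rewrite mulrN teu.
- by rewrite mulNr tue.
- by rewrite mulrNN tuu.
Defined.

Lemma right_exact_shift t : right_exact t -> right_exact (twist_shift t).
Proof.
move=> ht n x ex /eqP; rewrite mulNr oppr_eq0 => /eqP ux.
by have [y ->] := ht _ x ex ux; exists (- y); rewrite mulrNN.
Qed.

Implicit Types X Y Z : cplx A.

Record tcocycle (t : twist) X := TCocycle {
  tc :> forall n, X n;
  tc_e : forall n, te t n *: tc n = tc n;
  tc_d : forall n, cdif X n (tc n) = tu t n *: tc (n + 1)
}.

(** A null-homotopy sends the generator e_(n+1), of degree n + 1, to the element h n of degree n;
    hence the shifted idempotent. *)
Definition tbound (t : twist) X (x : forall n, X n) : Prop :=
  exists h : forall n, X n, (forall n, te t (n + 1) *: h n = h n) /\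
    forall n, x (n + 1) = cdif X n (h n) + tu t (n + 1) *: h (n + 1).

Section Ops.
Variables (t : twist) (X : cplx A).
Implicit Types x y : tcocycle t X.

Definition tc0 : tcocycle t X.
Proof. by exists (fun n => 0) => n; rewrite ?raddf0 ?scaler0. Defined.
Definition tcadd x y : tcocycle t X.
Proof.
exists (fun n => x n + y n) => n; first by rewrite scalerDr !tc_e.
by rewrite raddfD /= !tc_d scalerDr.
Defined.
Definition tcscale (a : k) x : tcocycle t X.
Proof.
exists (fun n => iota a *: x n) => n.
  by rewrite scalerA -centralP -scalerA tc_e.
by rewrite linearZ /= tc_d !scalerA centralP.
Defined.

Definition tceq x y : Prop := tbound t (fun n => x n - y n).

Lemma tceq_ext x y : (forall n, x n = y n) -> tceq x y.
Proof.
move=> e; exists (fun n => 0); split=> n; first by rewrite scaler0.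
by rewrite e subrr raddf0 scaler0 addr0.
Qed.

Definition tc_svect : svect k.
Proof.
refine (@SVect k (tcocycle t X) tceq tc0 tcadd tcscale
  _ _ _ _ _ _ _ _ _ _ _ _ _).
- by move=> x; apply: tceq_ext.
- move=> x y [h [h1 h2]]; exists (fun n => - h n); split=> n.
    by rewrite scalerN h1.
  by rewrite -opprB h2 raddfN scalerN opprD.
- move=> x y z [h [h1 h2]] [g [g1 g2]]; exists (fun n => h n + g n).
  split=> n; first by rewrite scalerDr h1 g1.
  by rewrite -(subrKA (y (n + 1))) h2 g2 raddfD /= scalerDr addrACA.
- move=> x x' y y' [h [h1 h2]] [g [g1 g2]]; exists (fun n => h n + g n).
  split=> n; first by rewrite scalerDr h1 g1.
  by rewrite /= opprD addrACA h2 g2 raddfD /= scalerDr addrACA.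
- move=> a x x' [h [h1 h2]]; exists (fun n => iota a *: h n).
  split=> n; first by rewrite scalerA -centralP -scalerA h1.
  by rewrite /= -scalerBr h2 scalerDr linearZ /= !scalerA centralP.
all: intros; apply: tceq_ext => n /=.
- by rewrite addrA.
- by rewrite addrC.
- by rewrite add0r.
- by rewrite rmorphN rmorph1 scaleN1r addNr.
- by rewrite scalerA rmorphM.
- by rewrite rmorph1 scale1r.
- by rewrite scalerDr.
- by rewrite rmorphD scalerDl.
Defined.

End Ops.

Section Functor.
Variable t : twist.

Definition tc_push X Y (f : chmap X Y) (x : tcocycle t X) : tcocycle t Y.
Proof.
exists (fun n => f n (x n)) => n; first by rewrite -linearZ /= tc_e.
by rewrite -cmapP tc_d linearZ.
Defined.

Definition tc_map X Y (f : chmap X Y) : svhom (tc_svect t X) (tc_svect t Y).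
Proof.
exists (tc_push f) => [x y [h [h1 h2]]|x y|a x].
- exists (fun n => f n (h n)); split=> n; first by rewrite -linearZ /= h1.
  by rewrite -raddfB h2 raddfD /= cmapP linearZ.
- by apply: tceq_ext => n /=; rewrite raddfD.
- by apply: tceq_ext => n /=; rewrite linearZ.
Defined.

Lemma tc_map_homotopic X Y (f g : chmap X Y) (x : tcocycle t X) :
  homotopic f g -> tceq (tc_push f x) (tc_push g x).
Proof.
move=> [s hs]; exists (fun n => s n (x (n + 1))); split=> n.
  by rewrite -linearZ /= tc_e.
by rewrite hs tc_d linearZ.
Qed.

Definition tate_fun : linfun (homotopy_cat iota) (svect_cat k).
Proof.
refine (@LinFun k (homotopy_cat iota) (svect_cat k)
  (fun U => tc_svect t (U : bcplx A))
  (fun U V f => tc_map (f : chmap (U : bcplx A) (V : bcplx A))) _ _ _ _ _).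
- by move=> U V f g e x; exact: tc_map_homotopic e.
all: by intros; move=> x; apply: tceq_ext => n.
Defined.

End Functor.

(** The equation x(n+1) = d h(n) + u_(n+1) h(n+1) is solved downwards from where x vanishes: given
    h(n+1), the difference is a cycle, hence a boundary, and multiplying a preimage by e_(n+1) puts
    it into the right summand. *)
Lemma tc_acyclic (t : twist) X (x : tcocycle t X) (m : int) :
  acyclic X -> (forall n, m < n -> x n = 0) ->
  exists h : forall n, X n, [/\ forall n, te t (n + 1) *: h n = h n,
    forall n, x (n + 1) = cdif X n (h n) + tu t (n + 1) *: h (n + 1)
    & forall n, m <= n -> h n = 0].
Proof.
move=> HX xm; pose R n (h : X n) (h' : X (n + 1)) :=
  te t (n + 1) *: h = h /\ x (n + 1) = cdif X n h + tu t (n + 1) *: h'.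
have [||h [h1 h2]] := @int_choice_down (fun n => X n) R (fun n => 0) m.
- by move=> n mn; split; rewrite ?scaler0 // raddf0 addr0; apply: xm; lia.
- move=> n y z [ey xE].
  have [|w wE] := HX n (x (n + 1) - tu t (n + 1) *: y).
    rewrite raddfB /= tc_d linearZ /= -scalerBr xE addrKl scalerA.
    by rewrite tuu scale0r.
  exists (te t (n + 1) *: w); split; first by rewrite scalerA te_idem.
  rewrite linearZ /= -wE scalerBr tc_e scalerA teu subrK //.
- by exists h; split=> // n; case: (h1 n).
Qed.

(** P is a direct summand of some A^r by a section of a finite cover, and [right_exact] is applied
    to each coordinate. *)
Lemma proj_exact (t : twist) (P : lmodType A) n (x : P) :
  right_exact t -> fg_projective P ->
  te t (n + 1) *: x = x -> tu t n *: x = 0 -> exists y, x = tu t (n + 1) *: y.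
Proof.
move=> ht [[r [g hg]] pP] ex ux.
pose p (v : 'rV[A]_r) : P := \sum_i v 0 i *: g i.
have pl : linear p.
  move=> a v w; rewrite /p scaler_sumr -big_split /=; apply: eq_bigr => i _.
  by rewrite !mxE scalerDl scalerA.
pose pL : {linear 'rV[A]_r -> P} := HB.pack p
  (GRing.isLinear.Build A _ _ _ p pl).
have [|s hs] := pP _ _ pL (idfun : {linear P -> P}).
  move=> y; have [a ->] := hg y; exists (\row_i a i); apply: eq_bigr => i _.
  by rewrite mxE.
have hy i : exists y, (s x) 0 i = tu t (n + 1) * y.
  apply: ht.
    by rewrite -[in RHS]ex linearZ mxE.
  have := congr1 (fun v : 'rV_r => v 0 i) (congr1 s ux).
  by rewrite linearZ raddf0 !mxE.
have [y hy'] := choice hy; exists (p (\row_i y i)).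
rewrite -[LHS]hs /= /p scaler_sumr; apply: eq_bigr => i _.
by rewrite hy' mxE scalerA.
Qed.

(** The equation of [tc_acyclic], now solved upwards from below the support of X: exactness on the
    projective X^(n+1) allows x(n+1) - d h(n) to be divided by u_(n+1). *)
Lemma tc_perfect (t : twist) (X : cplx A) (x : tcocycle t X) :
  right_exact t ->  degreewise (@fg_projective A) X -> bounded X -> tbound t x.
Proof.
move=> ht PX [m hm]; pose R n (h : X n) (h' : X (n + 1)) :=
  [/\ te t (n + 1) *: h = h, te t (n + 1 + 1) *: h' = h' &
  x (n + 1) = cdif X n h + tu t (n + 1) *: h'].
have [||h [h1 h2]] := @int_choice_up (fun n => X n) R (fun n => 0) (- m.+2%:Z).
- move=> n nm; split; rewrite ?scaler0 // raddf0 addr0.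
  by apply: hm; lia.
- move=> n y z [ey ez xE].
  have [||w wE] := @proj_exact t _ (n + 1) (x (n + 1 + 1) - cdif X (n + 1) z) ht (PX _).
  - by rewrite scalerBr tc_e -linearZ /= ez.
  - rewrite scalerBr -tc_d -linearZ /= -raddfB xE addrK.
    exact: cdif2.
  exists (te t (n + 1 + 1 + 1) *: w); split=> //; first by rewrite scalerA te_idem.
  by rewrite scalerA tue -wE subrKC.
- by exists h; split=> n; case: (h1 n).
Qed.

End Twist.

Section TateFunctor.
Variables (k : fieldType) (A : pzRingType) (iota : central_morph k A).
Implicit Types X Y Z : cplx A.

(** A piece of the long exact sequence of the cone: the first components of a chain bounding (0, y)
    form a cocycle of X, and the second ones a homotopy between its image and y. *)
Lemma tc_cone_lift (t : twist A) X Y (f : chmap X Y) (y : tcocycle t Y)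
    (h : forall n, cone f n) :
  (forall n, te t (n + 1) *: h n = h n) ->
  (forall n, (0, y (n + 1)) = cdif (cone f) n (h n) + tu t (n + 1) *: h (n + 1)) ->
  exists x : tcocycle t X, (forall n, x (n + 1) = (h n).1) /\
    forall n, y (n + 1) - f (n + 1) (x (n + 1)) =
      cdif Y n (h n).2 + tu t (n + 1) *: (h (n + 1)).2.
Proof.
move=> eh hh; have [x xE] := @int_reindex (fun n => X n) (fun n => (h n).1).
have xe n : te t n *: x n = x n.
  by move: n; apply: int_forall_succ => n; rewrite xE -[in RHS]eh.
have xd n : cdif X n (x n) = tu t n *: x (n + 1).
  move: n; apply: int_forall_succ => n; rewrite !xE.
  have /pair_equal_spec[/esym /= /addr0_eq + _] := hh n.
  by rewrite opprK.
exists (TCocycle xe xd); split=> //= n.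
have /pair_equal_spec[_ /= ->] := hh n.
by rewrite xE -[X in X - _]addrA addrKl.
Qed.

Lemma tc_cone_surj (t : twist A) X Y (f : chmap X Y) :
  (forall z : tcocycle t (cone f), tbound t z) ->
  forall y : tcocycle t Y, exists x : tcocycle t X, tceq (tc_push f x) y.
Proof.
move=> H y.
have ze n : te t n *: ((0, y n) : cone f n) = (0, y n).
  by apply/pair_equal_spec; split; rewrite /= ?scaler0 ?tc_e.
have zd n : cdif (cone f) n (0, y n) = tu t n *: ((0, y (n + 1)) : cone f (n + 1)).
  apply/pair_equal_spec; split; rewrite /= ?raddf0 ?oppr0 ?scaler0 //.
  by rewrite add0r tc_d.
have [h [h1 h2]] := H (TCocycle ze zd).
have [x [_ hx]] := tc_cone_lift h1 h2.
exists x; exists (fun n => - (h n).2); split=> n; first by rewrite scalerN -[in RHS]h1.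
by rewrite -opprB hx raddfN scalerN opprD.
Qed.

(** If h bounds f x, then (x, -h) is a cocycle of the cone for the shifted twist, since the cone has
    X^(n+1) in degree n. The first component of a chain bounding it bounds x up to sign. *)
Lemma tc_cone_inj (t : twist A) X Y (f : chmap X Y) :
  (forall z : tcocycle (twist_shift t) (cone f), tbound (twist_shift t) z) ->
  forall x : tcocycle t X, tbound t (tc_push f x) -> tbound t x.
Proof.
move=> H x [h [h1 h2]].
have ze n : te (twist_shift t) n *: ((x (n + 1), - h n) : cone f n) =
    (x (n + 1), - h n).
  by apply/pair_equal_spec; split; rewrite /= ?scalerN ?h1 ?tc_e.
have zd n : cdif (cone f) n (x (n + 1), - h n) =
    tu (twist_shift t) n *: ((x (n + 1 + 1), - h (n + 1)) : cone f (n + 1)).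
  apply/pair_equal_spec; split; rewrite /= ?tc_d ?scaleNr //.
  have fx : f (n + 1) (x (n + 1)) = _ := h2 n.
  by rewrite fx raddfN scalerN opprK addrKl.
have [s [s1 s2]] := H (TCocycle ze zd).
have [g gE] := @int_reindex (fun n => X n) (fun n => - (s n).1).
exists g; split; apply: int_forall_succ => n; rewrite gE.
  by rewrite scalerN -[in RHS]s1.
have /pair_equal_spec[/= -> _] := s2 n.
by rewrite gE raddfN scalerN scaleNr.
Qed.

Lemma tc_quasi_iso (t : twist A) (X Y : bcplx A) (f : chmap X Y) :
  quasi_iso f -> is_iso (fmap (tate_fun iota t) (f : @hom _ (homotopy_cat iota) X Y)).
Proof.
move=> /cone_acyclic acy; have [m hm] := bc_bounded (bcone f).
have H t' (z : tcocycle t' (cone f)) : tbound t' z.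
  have [n mn|h [h1 h2 _]] := @tc_acyclic A t' _ z m acy.
    by apply: hm; lia.
  by exists h.
apply: svect_iso => [x xb|y]; last exact: tc_cone_surj.
have xb' : tbound t (tc_push f x).
  by have [h [h1 h2]] := xb; exists h; split=> // n; rewrite -h2 /= subr0.
have [g [g1 g2]] := tc_cone_inj (H _) xb'.
by exists g; split=> // n; rewrite /= subr0.
Qed.

Definition tate_der (t : twist A) : linfun (derived_cat iota) (svect_cat k) :=
  loc_lift (F := tate_fun iota t)
    (S := fun (U V : homotopy_cat iota) f =>
      quasi_iso (f : chmap (U : bcplx A) (V : bcplx A)))
    (fun (U V : homotopy_cat iota) f => @tc_quasi_iso t U V f).

Lemma derived_map_iso (X Y : bcplx A) (f : chmap X Y) :
  quasi_iso f -> is_iso (derived_map iota f).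
Proof. by move=> qf; apply: loc_map_iso. Qed.

Lemma tate_perfect (t : twist A) (X : derived_cat iota) :
  right_exact t -> perfect X -> forall x : tcocycle t (X : bcplx A), tbound t x.
Proof.
move=> ht [P [PP XP]] x.
have [f fi] := XP.
pose Tf := fmap (tate_der t) f : svhom (tc_svect iota t (X : bcplx A)) (tc_svect iota t P).
have Tx0 (y : tc_svect iota t P) : sveq y (sv0 _).
  have [h [h1 h2]] := tc_perfect y ht PP (bc_bounded P).
  by exists h; split=> // n; rewrite subr0.
have x0 : sveq (x : tc_svect iota t (X : bcplx A)) (sv0 _).
  apply: (@svect_iso_inj k _ _ (fmap (tate_der t) f)).
    exact: fmap_iso fi.
  exact: sveq_trans (Tx0 _) (sveq_sym (Tx0 _)).
have [h [h1 h2]] := x0; exists h; split=> // n.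
by rewrite -h2 /= subr0.
Qed.

Lemma tate_cone_perfect (t : twist A) (ht : right_exact t)
    (X Y : derived_cat iota) (f : hom X Y) :
  (exists2 Z, is_cone f Z & perfect Z) -> is_iso (fmap (tate_der t) f).
Proof.
move=> [Z [X' [Y' [g [u [v [iu iv vfgu ZC]]]]]] pZ].
have pC : perfect (bcone g : derived_cat iota).
  have [P [PP ZP]] := pZ; exists P; split=> //.
  by apply: isomorphic_trans ZP; exact: isomorphic_sym.
have ig : is_iso (fmap (tate_fun iota t) (g : @hom _ (homotopy_cat iota) X' Y')).
  apply: svect_iso => [x xb|y]; last exact: tc_cone_surj (tate_perfect ht pC) y.
  have xb' : tbound t (tc_push g x).
    by have [h [h1 h2]] := xb; exists h; split=> // n; rewrite -h2 /= subr0.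
  have [h [h1 h2]] := tc_cone_inj (tate_perfect (right_exact_shift ht) pC) xb'.
  by exists h; split=> // n; rewrite /= subr0.
(* The triangle is only isomorphic to that of the chain map g, so the conclusion for g is
   transported along u and v. *)
have [u' [uu' u'u]] := fmap_iso (tate_der t) iu.
have [v' [vv' v'v]] := fmap_iso (tate_der t) iv.
have E : fmap (tate_der t) f =h
    hcomp v' (hcomp (fmap (tate_der t) (derived_map iota g)) (fmap (tate_der t) u)).
  by rewrite -fmap_comp -vfgu fmap_comp hcompA vv' hcomp1f.
apply: is_iso_heq (heq_sym E) _; apply: is_iso_comp; last apply: is_iso_comp.
- by exists (fmap (tate_der t) v); split.
- exact: ig.
- exact: fmap_iso.
Qed.

Definition tate (t : twist A) (ht : right_exact t) : linfun (sing_cat iota) (svect_cat k) :=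
  loc_lift (F := tate_der t)
    (S := fun (X Y : derived_cat iota) f => exists2 Z, is_cone f Z & perfect Z)
    (fun (X Y : derived_cat iota) f => @tate_cone_perfect t ht X Y f).

Definition sing_fun : linfun (derived_cat iota) (sing_cat iota) := loc_fun _.

Definition sing_map (X Y : bcplx A) (f : chmap X Y) :
    @hom k (sing_cat iota) X Y :=
  fmap sing_fun (derived_map iota f).

Lemma is_cone_derived_map (X Y : bcplx A) (f : chmap X Y) :
  is_cone (derived_map iota f) (bcone f).
Proof.
exists X, Y, f, (idm _), (idm _).
split; [exact: is_iso_idm|exact: is_iso_idm| |exact: isomorphic_refl].
by rewrite hcomp1f hcompf1.
Qed.

Lemma sing_map_iso (X Y : bcplx A) (f : chmap X Y) :
  perfect (bcone f : derived_cat iota) -> is_iso (sing_map f).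
Proof.
move=> pf; apply: loc_map_iso; exists (bcone f : derived_cat iota) => //.
exact: is_cone_derived_map.
Qed.

Lemma sing_map_qiso (X Y : bcplx A) (f : chmap X Y) :
  quasi_iso f -> is_iso (sing_map f).
Proof. by move=> qf; exact: (fmap_iso sing_fun (derived_map_iso qf)). Qed.

Lemma sing_map_comp (X Y Z : bcplx A) (f : chmap Y Z) (g : chmap X Y) :
  sing_map (ch_comp f g) =h hcomp (sing_map f) (sing_map g).
Proof.
apply: heq_trans (fmap_comp sing_fun _ _); apply: (fmap_cong sing_fun).
exact: (fmap_comp (loc_fun _)
  (f : @hom k (homotopy_cat iota) Y Z) (g : @hom k (homotopy_cat iota) X Y)).
Qed.

Lemma sing_map_homotopic (X Y : bcplx A) (f g : chmap X Y) :
  homotopic f g -> sing_map f =h sing_map g.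
Proof.
move=> e; apply: (fmap_cong sing_fun).
exact: (fmap_cong (loc_fun _) (e : (f : @hom k (homotopy_cat iota) X Y) =h g)).
Qed.

Lemma sing_mapD (X Y : bcplx A) (f g : chmap X Y) :
  sing_map (ch_add f g) =h hadd (sing_map f) (sing_map g).
Proof.
apply: heq_trans (fmapD sing_fun _ _); apply: (fmap_cong sing_fun).
exact: (fmapD (loc_fun _)
  (f : @hom k (homotopy_cat iota) X Y) (g : @hom k (homotopy_cat iota) X Y)).
Qed.

Lemma sing_mapZ (X Y : bcplx A) a (f : chmap X Y) :
  sing_map (ch_scale iota a f) =h hscale a (sing_map f).
Proof.
apply: heq_trans (fmapZ sing_fun _ _); apply: (fmap_cong sing_fun).
exact: (fmapZ (loc_fun _) a (f : @hom k (homotopy_cat iota) X Y)).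
Qed.

End TateFunctor.

Section LinearMaps.
Variable A : pzRingType.

Definition mklin (M N : lmodType A) (f : M -> N) (fl : linear f) :
  {linear M -> N} := HB.pack f (GRing.isLinear.Build A M N *:%R f fl).

Variables (X Y : cplx A) (f : chmap X Y).

Fact cone_in_linear n : linear (fun y : Y n => (0, y) : cone f n).
Proof.
by move=> a x y; apply/pair_equal_spec; split; rewrite /= ?scaler0 ?addr0.
Qed.

Definition cone_in : chmap Y (cone f).
Proof.
exists (fun n => mklin (@cone_in_linear n)) => n x.
by apply/pair_equal_spec; split; rewrite /= !raddf0 ?oppr0 ?add0r.
Defined.

End LinearMaps.

Section Zero.
Variables (k : fieldType) (A : pzRingType) (iota : central_morph k A).

Definition zero_cplx : cplx A :=
  @Cplx A (fun=> 'rV[A]_0) (fun n => \0) (fun n x => erefl).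

Lemma rV0_eq0 (x : 'rV[A]_0) : x = 0.
Proof. by apply/rowP => -[]. Qed.

Definition zero_bcplx : bcplx A.
Proof.
exists zero_cplx; first by exists 0%N => n _ x; exact: rV0_eq0.
move=> n; exists 0%N, (fun=> 0) => x; exists (fun=> 0).
by rewrite big_ord0; exact: rV0_eq0.
Defined.

Lemma sing_map_zero (X : bcplx A) : (forall n (x : X n), x = 0) ->
  is_zero (X : sing_cat iota).
Proof.
move=> X0; have e : homotopic (ch_id X) (ch_zero X X).
  by apply: homotopic_ext => n x; exact: X0.
exact: (sing_map_homotopic iota e).
Qed.

Lemma cone_in_zero (X : bcplx A) :
  quasi_iso (cone_in (ch_zero zero_bcplx X)).
Proof.
split.
  move=> n x dx [[z y] /pair_equal_spec[_ /= xE]].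
  by exists y; rewrite xE add0r.
move=> n [z y] /pair_equal_spec[_ /= dy]; exists y, 0; split.
  by move: dy; rewrite add0r.
by rewrite raddf0 addr0 (rV0_eq0 z).
Qed.

(** The cone of 0 -> X is X up to quasi-isomorphism, so this map is inverted as soon as X is
    perfect. *)
Lemma perfect_is_zero (X : bcplx A) :
  perfect (X : derived_cat iota) -> is_zero (X : sing_cat iota).
Proof.
move=> [P [PP XP]]; pose z := ch_zero zero_bcplx X.
have iz : is_iso (sing_map iota z).
  apply: sing_map_iso; exists P; split=> //; apply: isomorphic_trans XP.
  apply: isomorphic_sym; exists (derived_map iota (cone_in z : chmap X (bcone z))).
  by apply: derived_map_iso; exact: cone_in_zero.
apply: (@is_zero_iso _ _ (zero_bcplx : sing_cat iota)).
  by exists (sing_map iota z).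
by apply: sing_map_zero => n x; exact: rV0_eq0.
Qed.

End Zero.

(** * Resolutions by left ideals *)

Lemma cdif0 (A : pzRingType) (X : cplx A) n : cdif X n 0 = 0.
Proof. exact: raddf0. Qed.

Section IdealComplex.
Variable A : pzRingType.

Lemma lidealP (a : A) (x : A) : reflect (exists b, x = b * a) ((x : A^o) \in lideal a).
Proof. exact: asboolP. Qed.

Local Notation lv x := (lideal_val x : A).

Lemma left_idealP (a : A) (x : left_ideal a) : exists b, lv x = b * a.
Proof. by case: x => x hx; have /lidealP := hx. Qed.

Lemma left_ideal0 (a : A) (x : left_ideal a) : a = 0 -> x = 0.
Proof.
by move=> a0; apply: val_inj => /=; have [b ->] := left_idealP x; rewrite a0 mulr0.
Qed.

Lemma left_ideal_idem (e : A) (x : left_ideal e) : e * e = e ->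
  lv x * e = lv x.
Proof. by move=> ee; have [b ->] := left_idealP x; rewrite -mulrA ee. Qed.

Lemma left_ideal_proj (e : A) : e * e = e -> projective (left_ideal e).
Proof.
move=> ee M N p f psurj.
have he : (e : A^o) \in lideal e by apply/lidealP; exists 1; rewrite mul1r.
have [m pm] := psurj (f (LeftIdeal he)).
pose g (x : left_ideal e) : M := (lv x) *: m.
have gl : linear g by move=> a x y; rewrite /g /= scalerDl scalerA.
exists (mklin gl) => x; rewrite /= /g linearZ /= pm -linearZ; congr (f _).
by apply: val_inj; rewrite /= -[RHS](left_ideal_idem x ee).
Qed.

Lemma left_ideal_fgproj (e : A) : e * e = e -> fg_projective (left_ideal e).
Proof. by move=> ee; split; [exact: left_ideal_fg | exact: left_ideal_proj]. Qed.

Variables g w : int -> A.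
Hypothesis gw : forall n, (g n * w n : A^o) \in lideal (g (n + 1)).
Hypothesis gww : forall n, g n * w n * w (n + 1) = 0.

Fact imul_subproof n (y : left_ideal (g n)) :
  ((lv y) * w n : A^o) \in lideal (g (n + 1)).
Proof.
have [b ->] := left_idealP y; have /lidealP[c gc] := gw n.
by apply/lidealP; exists (b * c); rewrite -mulrA gc mulrA.
Qed.

Definition imul n (y : left_ideal (g n)) : left_ideal (g (n + 1)) :=
  LeftIdeal (imul_subproof y).
Lemma imul0 n : imul (0 : left_ideal (g n)) = 0.
Proof. by apply: val_inj; exact: mul0r. Qed.
Fact imul_linear n : linear (@imul n).
Proof. by move=> a x y; apply: val_inj; rewrite /= mulrDl -mulrA. Qed.

Definition icplx : cplx A.
Proof.
exists (fun n => left_ideal (g n)) (fun n => mklin (@imul_linear n)) => n x.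
apply: val_inj; rewrite /=; have [b ->] := left_idealP x.
by rewrite -!mulrA [g n * _]mulrA gww mulr0.
Defined.

Lemma icplx_bounded (m : nat) :
  (forall n : int, m%:Z < `|n| -> g n = 0) -> bounded icplx.
Proof. by move=> h; exists m => n /h gn x; exact: left_ideal0. Qed.

Variables (X : cplx A) (x : forall n, X n).
Hypothesis gx : forall n, g n *: cdif X n (x n) = (g n * w n) *: x (n + 1).

Fact iact_linear n : linear (fun y : icplx n => (lv y) *: x n).
Proof. by move=> a y z /=; rewrite scalerDl scalerA. Qed.

(** The condition [gx] carries the factor g_n because d x_n = w_n x_(n+1) may fail at the left end
    of a truncated complex, where w_n = 1. *)
Definition iact : chmap icplx X.
Proof.
exists (fun n => mklin (@iact_linear n)) => n y /=.
have [b ->] := left_idealP y.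
by rewrite linearZ /= -[in RHS]scalerA gx scalerA mulrA.
Defined.

End IdealComplex.

Section Resolution.
Variables (A : pzRingType) (t : twist A).
Local Notation e := (te t).
Local Notation u := (tu t).
Local Notation lv x := (lideal_val x : A).

(* 0 -> A u_(a-1) -> A e_a -> ... -> A e_M -> 0, with A e_n in degree n *)
Section Trunc.
Variables a M : int.

Definition trunc_g (n : int) : A :=
  if n + 1 == a then u n else if (a <= n <= M) then e n else 0.
(** The differential leaving the end term A u_(a-1) is its inclusion into A e_a, hence the value
    1. *)
Definition trunc_w (n : int) : A :=
  if n + 1 == a then 1 else if (a <= n < M) then u n else 0.

Lemma trunc_w_edge n : n + 1 = a -> trunc_w n = 1.
Proof. by rewrite /trunc_w => ->; rewrite eqxx. Qed.

Lemma trunc_w_in n : a <= n < M -> trunc_w n = u n.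
Proof. by move=> h; rewrite /trunc_w h ifN //; lia. Qed.

Fact trunc_gw : a <= M -> forall n,
  (trunc_g n * trunc_w n : A^o) \in lideal (trunc_g (n + 1)).
Proof.
move=> aM n; rewrite /trunc_g /trunc_w.
have [ea|na] := eqVneq (n + 1) a.
  rewrite mulr1 ifN; last by lia.
  rewrite ifT; last by lia.
  by apply/lidealP; exists (u n); rewrite tue.
case: ifP => h1; last by apply/lidealP; exists 0; rewrite !mul0r.
case: ifP => h2; last by apply/lidealP; exists 0; rewrite mulr0 mul0r.
rewrite ifN; last by lia.
rewrite ifT; last by lia.
by apply/lidealP; exists (u n); rewrite teu tue.
Qed.

Fact trunc_gww n : trunc_g n * trunc_w n * trunc_w (n + 1) = 0.
Proof.
rewrite /trunc_g /trunc_w; have [ea|na] := eqVneq (n + 1) a.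
  rewrite mulr1 ifN; last by lia.
  by case: ifP => _; rewrite ?mulr0 ?tuu.
case: ifP => h1; last by rewrite !mul0r.
case: ifP => h2; last by rewrite mulr0 mul0r.
rewrite ifN; last by lia.
by case: ifP => h3; rewrite ?mulr0 // teu tuu.
Qed.

Hypothesis aM : a <= M.

Definition trunc : cplx A := icplx (trunc_gw aM) trunc_gww.

Lemma trunc_g_out (n : int) : `|a|%:Z + `|M|%:Z + 1 < `|n| -> trunc_g n = 0.
Proof. by move=> h; rewrite /trunc_g !ifN //; lia. Qed.

Definition btrunc : bcplx A.
Proof.
exists trunc; last by move=> n; exact: left_ideal_fg.
by apply: (@icplx_bounded _ _ _ _ _ (`|a| + `|M| + 1)) => n h; apply: trunc_g_out; lia.
Defined.

Lemma trunc_in n c : a <= n <= M -> (c * e n : A^o) \in lideal (trunc_g n).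
Proof.
move=> h; rewrite /trunc_g ifN; last by lia.
by rewrite h; apply/lidealP; exists c.
Qed.

Lemma trunc_in_edge n c : n + 1 = a -> (c * u n : A^o) \in lideal (trunc_g n).
Proof. by move=> h; rewrite /trunc_g h eqxx; apply/lidealP; exists c. Qed.

Lemma trunc_mem n (y : trunc n) : a <= n <= M -> (lv y) * e n = lv y.
Proof.
move=> h; have [b ->] := left_idealP y; rewrite /trunc_g ifN; last by lia.
by rewrite h -mulrA te_idem.
Qed.

Lemma trunc_out n (y : trunc n) : (n + 1 < a) || (M < n) -> y = 0.
Proof. by move=> h; apply: left_ideal0; rewrite /trunc_g !ifN //; lia. Qed.

Section Action.
Variables (X : cplx A) (x : tcocycle t X).
Hypothesis xa : forall n, n < a -> x n = 0.
Hypothesis xM : forall n, M < n -> x n = 0.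

Fact trunc_gx n :
  trunc_g n *: cdif X n (x n) = (trunc_g n * trunc_w n) *: x (n + 1).
Proof.
rewrite /trunc_g /trunc_w; have [ea|na] := eqVneq (n + 1) a.
  rewrite mulr1 -tc_d (xa (n := n)); last by lia.
  by rewrite raddf0 scaler0.
case: ifP => h1; last by rewrite mul0r !scale0r.
rewrite tc_d scalerA; case: ifP => h2 //.
by rewrite xM ?scaler0 //; lia.
Qed.

Definition trunc_act : chmap trunc X := iact (trunc_gw aM) trunc_gww trunc_gx.

End Action.

Section Cone.
Variables (Y : cplx A) (x : tcocycle t Y) (n0 : int).
Hypothesis an0 : a <= n0 <= M.
Hypothesis Y0 : forall n (y : Y n), n != n0 -> y = 0.
Hypothesis Yx : forall n (y : Y n), n = n0 -> exists b, y = b *: x n.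
Hypothesis xtop : forall y n, n + 1 = n0 -> y * e (n + 1) = y -> y *: x (n + 1) = 0 ->
  y * u (n + 1) = 0 /\ exists z, y = z * u n.
Hypothesis uL : forall y n, n + 1 < n0 -> y * e (n + 1) = y ->
  y * u (n + 1) = 0 -> exists z, y = z * u n.

Fact tres_xa n : n < a -> x n = 0.
Proof. by move=> na; apply: Y0; lia. Qed.
Fact tres_xM n : M < n -> x n = 0.
Proof. by move=> nM; apply: Y0; lia. Qed.

Definition tres : chmap trunc Y := trunc_act tres_xa tres_xM.

(** The terms of the truncation in degrees above n0, shifted by one: what is left of the cone once
    the resolution of Y has cancelled against Y. *)
Definition tail_g (n : int) : A := if n0 <= n < M then e (n + 1) else 0.
Definition tail_w (n : int) : A := if n0 <= n < M - 1 then - u (n + 1) else 0.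

Fact tail_gw n : (tail_g n * tail_w n : A^o) \in lideal (tail_g (n + 1)).
Proof.
rewrite /tail_g /tail_w; case: ifP => h1; last by apply/lidealP; exists 0; rewrite !mul0r.
case: ifP => h2; last by apply/lidealP; exists 0; rewrite mulr0 mul0r.
rewrite ifT; last by lia.
by apply/lidealP; exists (- u (n + 1)); rewrite mulrN teu mulNr tue.
Qed.
Fact tail_gww n : tail_g n * tail_w n * tail_w (n + 1) = 0.
Proof.
rewrite /tail_g /tail_w; case: ifP => h1; last by rewrite !mul0r.
case: ifP => h2; last by rewrite mulr0 mul0r.
by case: ifP => h3; rewrite ?mulr0 // -mulrA mulrNN tuu mulr0.
Qed.

Definition tail_cplx : cplx A := icplx tail_gw tail_gww.

Definition tail_bcplx : bcplx A.
Proof.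
exists tail_cplx; last by move=> n; exact: left_ideal_fg.
apply: (@icplx_bounded _ _ _ _ _ (`|n0| + `|M|)) => n h.
by rewrite /tail_g ifN //; lia.
Defined.

Lemma tail_fgproj : degreewise (@fg_projective A) tail_cplx.
Proof.
move=> n; apply: left_ideal_fgproj; rewrite /tail_g.
by case: ifP => _; rewrite ?te_idem ?mulr0.
Qed.

Fact tail_in n (y : tail_cplx n) : (lv y : A^o) \in lideal (trunc_g (n + 1)).
Proof.
have [b ->] := left_idealP y; rewrite /tail_g; case: ifP => h.
  by apply: trunc_in; lia.
by apply/lidealP; exists 0; rewrite mulr0 mul0r.
Qed.

Fact tail_incl_linear n :
  linear (fun y : tail_cplx n => (LeftIdeal (tail_in y), 0) : cone tres n).
Proof.
move=> b y z; apply/pair_equal_spec; split; rewrite /= ?scaler0 ?addr0 //.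
exact: val_inj.
Qed.

Definition tail_incl : chmap tail_cplx (cone tres).
Proof.
exists (fun n => mklin (@tail_incl_linear n)) => n y.
apply/pair_equal_spec; split; rewrite /= ?raddf0 ?addr0; last first.
  have [b ->] := left_idealP y; rewrite /tail_g; case: ifP => h.
    by rewrite (Y0 (x (n + 1))) ?scaler0 //; lia.
  by rewrite mulr0 scale0r.
apply: val_inj; rewrite /=; have [b ->] := left_idealP y; rewrite /tail_g /tail_w /trunc_w.
case: ifP => h; last by rewrite mulr0 !mul0r oppr0.
case: ifP => h1; rewrite [if n + 1 + 1 == a then _ else _]ifN; try by lia.
  by rewrite ifT ?mulrN //; lia.
by rewrite ifN ?mulr0 ?oppr0 //; lia.
Defined.

(** The tail is a subcomplex of the cone, with quotient 0 -> A u_(a-1) -> ... -> A e_n0 -> Y -> 0 up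
    to shift and signs. This is exact by [Yx], [xtop] and [uL]; the chase is done without forming
    the quotient. *)
Lemma tail_qiso : quasi_iso tail_incl.
Proof.
split=> n.
  move=> z dz [[y l] /pair_equal_spec[/= zE /esym le]].
  have dl : cdif Y n l = 0.
    have [nn|nn] := eqVneq n n0; last by rewrite (Y0 l nn) raddf0.
    by apply: Y0; lia.
  rewrite dl addr0 in le.
  have zE' : (lv z) = - ((lv y) * trunc_w (n + 1)) by have := congr1 val zE.
  have [h1|h1] := leP n0 n.
    have [h2|h2] := ltP n M; last first.
      exists 0; rewrite ?imul0 ?cdif0; apply: val_inj; rewrite /= zE'.
      by rewrite (trunc_out y) ?mul0r ?oppr0 //; lia.
    have hy : (lv y : A^o) \in lideal (tail_g n).
      rewrite /tail_g h1 h2 /=; apply/lidealP; exists (lv y).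
      by rewrite trunc_mem //; lia.
    exists (LeftIdeal hy); apply: val_inj; rewrite /= zE' /tail_w /trunc_w.
    rewrite ifN; last by lia.
    case: ifP => h3; first by rewrite ifT ?mulrN //; lia.
    by rewrite ifN ?mulr0 ?oppr0 //; lia.
  exists 0; rewrite ?imul0 ?cdif0; apply: val_inj; rewrite /= zE'.
  have [h2|h2] := eqVneq (n + 1) n0.
    have [|yu _] := xtop h2 _ le; first by rewrite trunc_mem //; lia.
    rewrite /trunc_w ifN; last by lia.
    by case: ifP => _; rewrite ?yu ?mulr0 oppr0.
  rewrite -zE'; have [b ->] := left_idealP z.
  by rewrite /tail_g ifN ?mulr0 //; lia.
move=> [y l] /pair_equal_spec[/= dy fy].
have dl : cdif Y (n + 1) l = 0.
  have [nn|nn] := eqVneq (n + 1) n0; last by rewrite (Y0 l nn) raddf0.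
  by apply: Y0; lia.
rewrite dl addr0 in fy.
have yw : (lv y) * trunc_w (n + 1 + 1) = 0.
  by apply: oppr_inj; rewrite oppr0; exact: (congr1 val dy).
have [h1|h1] := leP n0 (n + 1).
  have [y' y'l] : exists y' : trunc (n + 1), (lv y') *: x (n + 1) = l.
    have [nn|nn] := eqVneq (n + 1) n0; last first.
      by exists 0; rewrite scale0r (Y0 l nn).
    have [b ->] := Yx l nn; have hb : a <= n + 1 <= M by lia.
    by exists (LeftIdeal (trunc_in b hb)); rewrite /= -scalerA tc_e.
  (* Subtracting the boundary of (y', 0) removes the component l in Y and leaves z, which lies in
     the tail. *)
  pose z : A := (lv y) + (lv y') * trunc_w (n + 1).
  have hz : (z : A^o) \in lideal (tail_g (n + 1)).
    have -> : tail_g (n + 1) = trunc_g (n + 1 + 1).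
      rewrite /tail_g /trunc_g [RHS]ifN; last by lia.
      by have -> : (n0 <= n + 1 < M) = (a <= n + 1 + 1 <= M) by lia.
    apply: (rpredD (valP y)).
    by have := valP (imul (trunc_gw aM) y').
  exists (LeftIdeal hz), (y', 0); split.
    apply: val_inj; rewrite /= /z mulrDl.
    have E c : c * trunc_w (n + 1 + 1) = 0 -> c * tail_w (n + 1) = 0.
      rewrite /trunc_w /tail_w ifN; last by lia.
      have -> : (n0 <= n + 1 < M - 1) = (a <= n + 1 + 1 < M) by lia.
      by case: ifP => _; rewrite ?mulr0 // mulrN => ->; rewrite oppr0.
    rewrite !E ?addr0 //.
    have [b ->] := left_idealP y'; rewrite -!mulrA [_ * (trunc_w _ * _)]mulrA.
    by rewrite trunc_gww mulr0.
  apply/pair_equal_spec; split; last by rewrite /= raddf0 addr0 y'l add0r.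
  by apply: val_inj; rewrite /= /z addrK.
have l0 : l = 0 by apply: Y0; lia.
have [y' [y'y y'0]] : exists y' : trunc (n + 1), (lv y) = (lv y') * trunc_w (n + 1) /\
    (lv y') *: x (n + 1) = 0.
  have D (y' : trunc (n + 1)) : (lv y') *: x (n + 1) = 0.
    by rewrite (Y0 (x (n + 1))) ?scaler0 //; lia.
  have [h2|h2] := ltP (n + 1 + 1 + 1) a.
    by exists 0; rewrite (trunc_out y) ?mul0r ?h2.
  have [h3|h3] := eqVneq (n + 1 + 1 + 1) a.
    exists 0; rewrite mul0r; split; last exact: D.
    by rewrite -yw trunc_w_edge ?mulr1.
  have [c yc] : exists c, (lv y) = c * u (n + 1).
    have ye : lv y * e (n + 1 + 1) = lv y by apply: trunc_mem; lia.
    have [h4|h4] := eqVneq (n + 1 + 1) n0.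
      by have [_ [c ->]] := xtop h4 ye fy; exists c.
    apply: uL ye _; first by lia.
    rewrite -[RHS]yw /trunc_w ifN; last by lia.
    by rewrite ifT //; lia.
  have [h4|h4] := eqVneq (n + 1 + 1) a.
    exists (LeftIdeal (trunc_in_edge c h4)); split; last exact: D.
    by rewrite yc trunc_w_edge ?mulr1.
  have h5 : a <= n + 1 <= M by lia.
  exists (LeftIdeal (trunc_in c h5)); split; last exact: D.
  rewrite trunc_w_in; last by lia.
  by rewrite yc /= -mulrA teu.
exists 0, (- y', 0); split; first by rewrite ?imul0 ?cdif0.
apply/pair_equal_spec; split; rewrite /= ?raddf0 ?addr0 ?scaleNr ?y'0 ?oppr0 ?addr0 ?l0 //.
by apply: val_inj; rewrite /= mulNr opprK add0r.
Qed.

End Cone.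
End Trunc.
End Resolution.

Section ResolutionSing.
Variables (k : fieldType) (A : pzRingType) (iota : central_morph k A).
Variable (t : twist A).
Local Notation e := (te t).
Local Notation u := (tu t).
Variables (a M : int) (aM : a <= M).
Variables (Y : bcplx A) (x : tcocycle t Y) (n0 : int).
Hypothesis an0 : a <= n0 <= M.
Hypothesis Y0 : forall n (y : Y n), n != n0 -> y = 0.
Hypothesis Yx : forall n (y : Y n), n = n0 -> exists b, y = b *: x n.
Hypothesis xtop : forall y n, n + 1 = n0 -> y * e (n + 1) = y -> y *: x (n + 1) = 0 ->
  y * u (n + 1) = 0 /\ exists z, y = z * u n.
Hypothesis uL : forall y n, n + 1 < n0 -> y * e (n + 1) = y ->
  y * u (n + 1) = 0 -> exists z, y = z * u n.

Lemma trunc_act_cone xa xM :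
  perfect (bcone (@trunc_act A t a M aM Y x xa xM : chmap (btrunc t aM) Y) : derived_cat iota).
Proof.
have -> : trunc_act aM xa xM = tres aM x an0 Y0.
  by congr trunc_act; exact: Prop_irrelevance.
exists (tail_bcplx t aM an0); split; first exact: tail_fgproj.
apply: isomorphic_sym; exists (derived_map iota (tail_incl aM x an0 Y0
   : chmap (tail_bcplx t aM an0) (bcone (tres aM x an0 Y0 : chmap (btrunc t aM) Y)))).
by apply: derived_map_iso; exact: tail_qiso.
Qed.

Lemma trunc_act_iso xa xM :
  is_iso (sing_map iota (@trunc_act A t a M aM Y x xa xM : chmap (btrunc t aM) Y)).
Proof. by apply: sing_map_iso; exact: trunc_act_cone. Qed.

(** For M = n0 the tail is zero, so the cone is acyclic. *)
Lemma trunc_act_qiso xa xM : M = n0 ->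
  quasi_iso (@trunc_act A t a M aM Y x xa xM).
Proof.
move=> Mn0; apply: acyclic_cone.
have -> : trunc_act aM xa xM = tres aM x an0 Y0.
  by congr trunc_act; exact: Prop_irrelevance.
move=> n y dy.
have [_ /(_ n y dy)[z [y' [_ ->]]]] := tail_qiso aM an0 Y0 Yx xtop uL.
exists y'; have -> : z = 0.
  by apply: left_ideal0; rewrite /tail_g ifN //; lia.
by rewrite raddf0 add0r.
Qed.

(** The end term A u_(a-1) vanishes, so the truncation is a finite projective resolution of Y. *)
Lemma trunc_perfect : M = n0 -> (forall n, n + 1 = a -> u n = 0) ->
  perfect (Y : derived_cat iota).
Proof.
move=> Mn0 ua; exists (btrunc t aM); split.
  move=> n; apply: left_ideal_fgproj; rewrite /trunc_g.
  have [/ua ->|_] := eqVneq (n + 1) a; first by rewrite mulr0.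
  by case: ifP => _; rewrite ?te_idem ?mulr0.
have xa n : n < a -> x n = 0 by move=> na; apply: Y0; lia.
have xM n : M < n -> x n = 0 by move=> nM; apply: Y0; lia.
apply: isomorphic_sym; exists (derived_map iota (@trunc_act A t a M aM Y x xa xM : chmap (btrunc t aM) Y)).
by apply: derived_map_iso; exact: trunc_act_qiso.
Qed.

End ResolutionSing.

Section Stalk.
Variables (A : pzRingType) (t : twist A) (M : lmodType A) (m : M).

Definition stalk_elt (n : int) : stalk M n :=
  match n return stalk_mod M n with Posz 0 => m | _ => 0 end.

Lemma stalk_eq0 n (y : stalk M n) : n != 0 -> y = 0.
Proof. by case: n y => [[|n]|n] //= y _; exact: rV0_eq0. Qed.

Hypotheses (em : te t 0 *: m = m) (um : forall n, n + 1 = 0 -> tu t n *: m = 0).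

Definition stalk_cocycle : tcocycle t (stalk M).
Proof.
exists stalk_elt => [[[|n]|n]|n] //=; rewrite ?scaler0 //.
have [n0|n0] := eqVneq (n + 1) 0; last by rewrite (stalk_eq0 (stalk_elt (n + 1)) n0) scaler0.
move: (n + 1) n0 (um n0) => i ->; exact: esym.
Defined.

End Stalk.

Section Eta.
Variables (k : fieldType) (A : pzRingType) (iota : central_morph k A).
Variables (t : twist A) (tR : right_exact t) (tL : left_exact t).
Local Notation e := (te t).
Local Notation u := (tu t).
Variable a0 : A.
Hypotheses (ea0 : e 0 * a0 = a0) (ua0 : forall n, n + 1 = 0 -> u n * a0 = 0).
Hypothesis annu : forall y, y * e 0 = y -> y * a0 = 0 -> y * u 0 = 0.

Local Notation LI := (left_ideal a0).

Fact gen_in : (a0 : A^o) \in lideal a0.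
Proof. by apply/lidealP; exists 1; rewrite mul1r. Qed.
Definition lgen : LI := LeftIdeal gen_in.
Definition Lst : bcplx A := bstalk (left_ideal_fg a0).

Definition lcoc : tcocycle t Lst.
Proof.
apply: (@stalk_cocycle A t LI lgen) => [|n n0]; apply: val_inj => //=.
exact: ua0.
Defined.

Fact NN (N : nat) : - N%:Z <= N%:Z. Proof. lia. Qed.
Definition res_cplx (N : nat) : bcplx A := btrunc t (NN N).

Definition bounds (X : cplx A) (N : nat) : Prop :=
  forall n : int, N%:Z < `|n| -> forall x : X n, x = 0.

Fact bounds_lo X N (x : tcocycle t X) : bounds X N -> forall n, n < - N%:Z -> x n = 0.
Proof. by move=> h n nN; apply: h; lia. Qed.
Fact bounds_hi X N (x : tcocycle t X) : bounds X N -> forall n, N%:Z < n -> x n = 0.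
Proof. by move=> h n nN; apply: h; lia. Qed.

Definition phi (X : bcplx A) (N : nat) (hN : bounds X N) (x : tcocycle t X) :
    chmap (res_cplx N) X :=
  trunc_act (NN N) (bounds_lo x hN) (bounds_hi x hN).

Fact Lst_bounds N : bounds Lst N.
Proof. by move=> n h x; apply: stalk_eq0; lia. Qed.

Lemma lcoc_gen n (y : Lst n) : n = 0 -> exists b, y = b *: lcoc n.
Proof.
case: n y => [[|n]|n] //= y _; have [b yb] := left_idealP y.
by exists b; apply: val_inj.
Qed.

Lemma lcoc_ann n y : n = 0 -> y * e n = y -> y *: lcoc n = 0 -> y * u n = 0.
Proof.
by case: n => [[|n]|n] //= _ ye /(congr1 val); exact: annu.
Qed.

(** The truncation continues to the right of degree 0, beyond the resolution of A a0; the surplus is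
    a bounded complex of projectives, which the singularity category ignores. *)
Lemma Lst_iso N : is_iso (sing_map iota (phi (@Lst_bounds N) lcoc)).
Proof.
apply: (@trunc_act_iso _ _ _ _ _ _ _ _ _ 0); first by lia.
- by move=> n y; exact: stalk_eq0.
- exact: lcoc_gen.
- move=> y n n0 ye /(lcoc_ann n0 ye) yu.
  by split=> //; exact: tL ye yu.
- by move=> y n _; exact: tL.
Qed.

Definition Lst_inv N : hom (Lst : sing_cat iota) (res_cplx N : sing_cat iota) :=
  projT1 (cid (Lst_iso N)).
Lemma Lst_invP N : is_inverse (sing_map iota (phi (@Lst_bounds N) lcoc)) (Lst_inv N).
Proof. exact: projT2 (cid (Lst_iso N)). Qed.

Definition etaN (X : bcplx A) (N : nat) (hN : bounds X N) (x : tcocycle t X) :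
    hom (Lst : sing_cat iota) (X : sing_cat iota) :=
  hcomp (sing_map iota (phi hN x)) (Lst_inv N).

Fact can_in N n : (let g := trunc_g t (- N%:Z) N n in (g : A^o) \in lideal g).
Proof. by apply/lidealP; exists 1; rewrite mul1r. Qed.

Lemma regular_scaleE (a b : A) : a *: (b : A^o) = a * b.
Proof. by []. Qed.

(** The tautological cocycle, given by the generator of each term; acting by it compares truncations
    of different lengths. *)
Definition can N : tcocycle t (res_cplx N).
Proof.
exists (fun n => LeftIdeal (can_in N n)) => n; apply: val_inj; rewrite /= regular_scaleE.
  rewrite /trunc_g. have [_|_] := eqVneq (n + 1) (- N%:Z); [by rewrite teu|].
  by case: ifP => _; rewrite ?te_idem ?mulr0.
rewrite /trunc_w; have [n1|n1] := eqVneq (n + 1) (- N%:Z).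
  rewrite mulr1 /trunc_g n1 eqxx ifN; last by lia.
  by rewrite ifT ?tue //; [rewrite -n1 tue|lia].
rewrite /trunc_g (negbTE n1).
have [n2|n2] := eqVneq (n + 1 + 1) (- N%:Z).
  by rewrite tuu ifN ?mul0r //; lia.
have [n3|n3] := boolP (- N%:Z <= n < N%:Z).
  rewrite ifT; last by lia.
  by rewrite ifT ?teu ?tue //; lia.
rewrite mulr0; case: ifP => n4; rewrite ?mulr0 //.
by lia.
Defined.

(** The chain map of a cocycle on the longer truncation factors through the shorter one by [can],
    because the target vanishes outside [-N, N]. For the generator of A a0 this also relates the two
    inverses. *)
Lemma etaS (X : bcplx A) (N N' : nat) (hN : bounds X N) (hN' : bounds X N')
  (x : tcocycle t X) : (N' = N.+1)%N -> etaN hN x =h etaN hN' x.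
Proof.
move=> NN'.
have hE : bounds (res_cplx N) N'.
  by move=> n h y; apply: trunc_out; lia.
have C (Y : bcplx A) (hY : bounds Y N) (hY' : bounds Y N') (y : tcocycle t Y) :
    sing_map iota (phi hY' y) =h
    hcomp (sing_map iota (phi hY y)) (sing_map iota (phi hE (can N))).
  apply: heq_trans (sing_map_comp iota _ _).
  apply: sing_map_homotopic; apply: homotopic_ext => n z /=.
  rewrite -scalerA; congr (_ *: _).
  have [h|h] := boolP (- N%:Z <= n <= N%:Z).
    change (y n = trunc_g t (- N%:Z) N n *: y n).
    by rewrite /trunc_g ifN ?h ?tc_e //; lia.
  by rewrite (hY _ _ (y n)) ?scaler0 //; lia.
have [p1 p2] := Lst_invP N; have [p1' p2'] := Lst_invP N'.
apply: heq_trans (heq_sym (hcomp_cong (C X hN hN' x) (heq_refl _))).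
have : hcomp (hcomp (sing_map iota (phi (@Lst_bounds N) lcoc)) (sing_map iota (phi hE (can N)))) (Lst_inv N') =h idm _.
  by apply: heq_trans p2'; apply: hcomp_cong => //; apply: heq_sym; exact: C.
move=> h; have {h} h : hcomp (sing_map iota (phi hE (can N))) (Lst_inv N') =h Lst_inv N.
  by rewrite -[X in X =h _]hcomp1f -p1 -hcompA [X in hcomp _ X]hcompA h hcompf1.
by rewrite -hcompA h.
Qed.

Lemma eta_indep (X : bcplx A) (N N' : nat) (hN : bounds X N) (hN' : bounds X N')
  (x : tcocycle t X) : etaN hN x =h etaN hN' x.
Proof.
wlog NN' : N N' hN hN' / (N <= N')%N.
  by case/orP: (leq_total N N') => h H; [|symmetry]; exact: H.
have [d dE] : exists d, N' = (N + d)%N by exists (N' - N)%N; lia.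
elim: d N' dE hN' {NN'} => [|d IH] N' dE hN'.
  move: hN'; rewrite dE addn0 => hN'.
  by have -> : hN' = hN by exact: Prop_irrelevance.
have hN1 : bounds X (N + d)%N by move=> n h; apply: (hN); lia.
by rewrite (IH _ erefl hN1); apply: etaS; lia.
Qed.

Definition eta (X : bcplx A) (x : tcocycle t X) :
    hom (Lst : sing_cat iota) (X : sing_cat iota) :=
  etaN (projT2 (cid (bc_bounded X))) x.

Lemma etaE (X : bcplx A) N (hN : bounds X N) (x : tcocycle t X) :
  eta x =h etaN hN x.
Proof. exact: eta_indep. Qed.

Lemma eta_gen : eta lcoc =h idm (Lst : sing_cat iota).
Proof. by rewrite (etaE (@Lst_bounds 0)); have [] := Lst_invP 0. Qed.

Lemma eta_cong (X : bcplx A) (x y : tcocycle t X) : tceq x y -> eta x =h eta y.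
Proof.
move=> [h [h1 h2]]; have [N hN] := bc_bounded X.
(* One degree of slack: in the top degree N of the truncation to [-N, N] the differential is 0
   instead of u_N, while h N need not vanish. *)
have hN1 : bounds X N.+1 by move=> n nN; apply: hN; lia.
rewrite !(etaE hN1) /etaN.
apply: hcomp_cong => //; apply: sing_map_homotopic.
pose s n (y : res_cplx N.+1 (n + 1)) : X n := (lideal_val y : A) *: h n.
have sl n : linear (@s n) by move=> b y1 y2; rewrite /s /= scalerDl scalerA.
exists (fun n => mklin (@sl n)) => n z; rewrite /= /s /=.
rewrite -scalerBr h2 scalerDr -linearZ /=; congr (_ + _).
have [n1|n1] := boolP (- N.+1%:Z <= n + 1 < N.+1%:Z).
  by rewrite trunc_w_in // scalerA.
by rewrite (hN (n + 1) _ (h (n + 1))) ?scaler0 //; lia.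
Qed.

Lemma etaD (X : bcplx A) (x y : tcocycle t X) :
  eta (tcadd x y) =h hadd (eta x) (eta y).
Proof.
have [N hN] := bc_bounded X; rewrite !(etaE hN) /etaN -hcompDl.
apply: hcomp_cong => //; apply: heq_trans (sing_mapD iota _ _).
apply: sing_map_homotopic; apply: homotopic_ext => n z /=.
by rewrite scalerDr.
Qed.

Lemma etaZ (X : bcplx A) (a : k) (x : tcocycle t X) :
  eta (tcscale iota a x) =h hscale a (eta x).
Proof.
have [N hN] := bc_bounded X; rewrite !(etaE hN) /etaN -hcompZl.
apply: hcomp_cong => //; apply: heq_trans (sing_mapZ iota _ _).
apply: sing_map_homotopic; apply: homotopic_ext => n z /=.
by rewrite /lscale /= !scalerA centralP.
Qed.

Lemma eta_nat (X Y : bcplx A) (f : chmap X Y) (x : tcocycle t X) :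
  hcomp (sing_map iota f) (eta x) =h eta (tc_push f x).
Proof.
have [N hX] := bc_bounded X; have [M hY] := bc_bounded Y.
have hX' : bounds X (N + M)%N by move=> n nN; apply: hX; lia.
have hY' : bounds Y (N + M)%N by move=> n nN; apply: hY; lia.
rewrite (etaE hX') (etaE hY') /etaN hcompA; apply: hcomp_cong => //.
apply: heq_trans (heq_sym (sing_map_comp iota _ _)) _.
apply: sing_map_homotopic; apply: homotopic_ext => n z /=.
by rewrite linearZ.
Qed.

Lemma eta_sing_nat (X Y : sing_cat iota) (f : hom X Y) (x : tcocycle t (X : bcplx A)) :
  hcomp f (eta x) =h
  eta ((fmap (tate iota tR) f : svhom (tc_svect iota t _) (tc_svect iota t _)) x).
Proof.
have der (U V : derived_cat iota) (g : hom U V) (y : tcocycle t (U : bcplx A)) :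
    hcomp (fmap (sing_fun iota) g) (eta y) =h
    eta ((fmap (tate_der iota t) g : svhom (tc_svect iota t _) (tc_svect iota t _)) y).
  exact: (@lift_natural _ _ _ (tate_fun iota t) (@tc_quasi_iso _ _ iota t)
    _ (sing_fun iota) Lst eta eta_cong etaD etaZ eta_nat U V g y).
exact: (@lift_natural _ _ _ (tate_der iota t) (@tate_cone_perfect _ _ iota t tR)
    _ (id_fun _) Lst eta eta_cong etaD etaZ der X Y f x).
Qed.

(* Yoneda: eta identifies Hom(L, X) with the degree 0 Tate cohomology of X. *)
Lemma hom_Lst (X : sing_cat iota) (f : hom (Lst : sing_cat iota) X) :
  f =h eta ((fmap (tate iota tR) f : svhom (tc_svect iota t _) (tc_svect iota t _)) lcoc).
Proof. by rewrite -eta_sing_nat eta_gen hcompf1. Qed.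

Lemma Lst_zero : is_zero (Lst : sing_cat iota) -> tbound t lcoc.
Proof.
move=> z; have z' : sveq (lcoc : tc_svect iota t Lst) (sv0 _).
  exact: (fmap_zero (tate iota tR) z lcoc).
have [h [h1 h2]] := z'; exists h; split=> // n.
by rewrite -h2 /= subr0.
Qed.

End Eta.

(** * Paths and exact sequences in gentle algebras *)

Section GentlePaths.
Variables (Q : bound_quiver) (hQ : gentle Q) (k : fieldType).
Notation V := (vert Q).
Notation E := (arr Q).
Local Notation G := (gentle_alg Q k).
Local Notation sg := (@sigma Q).
Implicit Types (a b c : E) (x y : G).

Lemma exists_out (v : V) : exists a, src a = v.
Proof.
case: (hQ v) => [[_ o2 _ _]|[_ [b [_ bo _]]]].
  have /card_gt0P[a] : (0 < #|arr_out v|)%N by rewrite o2.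
  by rewrite inE => /eqP <-; exists a.
by exists b; apply/eqP; rewrite -[_ == _](in_set (fun a => src a == v)) -/(arr_out v) bo inE.
Qed.

Fact ptraj_subproof a n : is_nzpath (src a, traject sg a n).
Proof.
case: n => [//|n]; rewrite /is_nzpath /= eqxx /=.
elim: n a => //= n IH a; rewrite nzstep_sigma // eqxx /=; exact: IH.
Qed.

(* For n = 0 this is the trivial path at [src a]. *)
Definition ptraj a n : nzpath Q := 
  exist (fun u => is_nzpath u) (src a, traject sg a n) (ptraj_subproof a n).

Lemma plen_ptraj a n : plen (ptraj a n) = n.
Proof. exact: size_traject. Qed.

Lemma nzpath_ptraj (p : nzpath Q) : exists a, p = ptraj a (plen p).
Proof.
have [p0|/(nzpathE hQ)[a pE]] := eqVneq (plen p) 0%N; last first.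
  by exists a; apply: val_inj; rewrite /= {1}pE.
have [a sa] := exists_out (val p).1; exists a; apply: val_inj; rewrite /= p0 sa /=.
by case: p p0 {sa} => [[v []]].
Qed.

Lemma ptraj0 a b : src a = src b -> ptraj a 0 = ptraj b 0.
Proof. by move=> e; apply: val_inj; rewrite /= e. Qed.

Lemma npre_ptraj a n i : (i <= n)%N -> npre i (ptraj a n) = ptraj a i.
Proof. by move=> h; apply: val_inj; rewrite /= /ppre /= take_traject. Qed.

Lemma nsuf_ptraj a n i : (i <= n)%N ->
  nsuf i (ptraj a n) = ptraj (iter i sg a) (n - i).
Proof.
move=> h; apply: val_inj; rewrite /= /psuf /= drop_traject; congr (_, _).
rewrite /pend /ppre /= take_traject //; case: i {h} => [|i] //=.
by rewrite last_map last_traject src_sigma.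
Qed.

(** Along nonzero paths each arrow determines the next, so elements of the algebra become functions
    of a first arrow and a length, subject at length 0 to depending on the source only. *)
Lemma galg_extP x y : (forall a n, x (ptraj a n) = y (ptraj a n)) -> x = y.
Proof. by move=> h; apply: galg_ext => p; have [a ->] := nzpath_ptraj p. Qed.

Lemma galg_mul_ptraj x y a n : (x * y) (ptraj a n) =
  \sum_(i < n.+1) x (ptraj (iter i sg a) (n - i)) * y (ptraj a i).
Proof.
rewrite galg_mulE plen_ptraj; apply: eq_bigr => i _.
have h : (i <= n)%N by rewrite -ltnS.
by rewrite npre_ptraj // nsuf_ptraj.
Qed.

Definition idem v : G := path_elt k (v, [::]).
Local Notation ar := (arrow_elt k).

Lemma idemE v a n : idem v (ptraj a n) = ((n == 0%N) && (src a == v))%:R.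
Proof.
by case: n => [|n]; rewrite /idem /path_elt /= xpair_eqE ?andbT // andbF.
Qed.

Lemma arrowE b a n : ar b (ptraj a n) = ((n == 1%N) && (a == b))%:R.
Proof.
rewrite /arrow_elt /path_elt; case: n => [|[|n]] /=; first by rewrite xpair_eqE andbF.
  have [->|/eqP ne] := eqVneq a b; first by rewrite eqxx.
  by case: eqP => // -[_ /ne].
by case: eqP => // -[].
Qed.

Lemma mul_arrowE x b a n : (x * ar b) (ptraj a n) =
  if (n != 0%N) && (a == b) then x (ptraj (sg a) n.-1) else 0.
Proof.
rewrite galg_mul_ptraj; case: n => [|n].
  by rewrite big_ord1 arrowE mulr0.
rewrite (bigD1 (Ordinal (isT : 1 < n.+2)%N)) // arrowE big1 ?addr0; last first.
  by move=> i /negbTE; rewrite arrowE -val_eqE => /= ->; rewrite mulr0.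
by rewrite /= addr0 subSS subn0; case: (a == b); rewrite ?mulr1 ?mulr0.
Qed.

Lemma arrow_mulE x b a n : (ar b * x) (ptraj a n) =
  if (n != 0%N) && (iter n.-1 sg a == b) then x (ptraj a n.-1) else 0.
Proof.
rewrite galg_mul_ptraj; case: n => [|n].
  by rewrite big_ord1 arrowE mul0r.
rewrite (bigD1 (Ordinal (ltnW (ltnSn n.+1)))) // arrowE big1 ?addr0; last first.
  move=> i ni; rewrite arrowE; case: eqP => [e|_]; last by rewrite mul0r.
  by case/negP: ni; rewrite -val_eqE /=; apply/eqP; lia.
by rewrite /= ?addr0 subSnn eqxx /=; case: eqP; rewrite ?mul1r ?mul0r.
Qed.

Lemma mul_idemE x v a n : (x * idem v) (ptraj a n) =
  if src a == v then x (ptraj a n) else 0.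
Proof.
rewrite galg_mul_ptraj big_ord_recl idemE subn0 big1 ?addr0; last first.
  by move=> i _; rewrite idemE mulr0.
by rewrite /= ?addr0; case: eqP; rewrite ?mulr1 ?mulr0.
Qed.

Lemma idem_mulE x v a n : (idem v * x) (ptraj a n) =
  if src (iter n sg a) == v then x (ptraj a n) else 0.
Proof.
rewrite galg_mul_ptraj big_ord_recr subnn idemE big1 ?add0r; last first.
  move=> i _; rewrite idemE; case: eqP => [e|_]; last by rewrite mul0r.
  by have := ltn_ord i; move: e => /=; lia.
by rewrite /= ?add0r; case: eqP; rewrite ?mul1r ?mul0r.
Qed.

Lemma idem_idem v : idem v * idem v = idem v.
Proof.
apply: galg_extP => a n; rewrite mul_idemE idemE.
by case: (src a == v); rewrite ?andbF.
Qed.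

Lemma sum_idem : \sum_v idem v = 1.
Proof.
apply: galg_extP => a n.
rewrite (big_morph (fun g : G => g (ptraj a n)) (id1 := 0) (op1 := +%R)) //.
rewrite (bigD1 (src a)) // big1 => [|v /negbTE va].
  rewrite [LHS](addr0 (idem (src a) (ptraj a n))).
  by rewrite idemE eqxx andbT -[RHS]/(galg_scalar Q 1 (ptraj a n)) /= plen_ptraj; case: eqP.
by rewrite idemE [src a == v]eq_sym va andbF.
Qed.

Lemma idem_arrow a : idem (tgt a) * ar a = ar a.
Proof.
apply: galg_extP => b n; rewrite idem_mulE arrowE.
case: eqP => //; case: eqP => //= ->; case: eqP => //= ->.
by rewrite src_sigma.
Qed.

Lemma arrow_idem a : ar a * idem (src a) = ar a.
Proof.
apply: galg_extP => b n; rewrite mul_idemE arrowE.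
by case: eqP => //; case: (b =P a) => [->|]; rewrite ?andbF.
Qed.

Lemma zstep_neq a b : zstep a b -> b != sg a.
Proof.
move=> /andP[s z]; rewrite -(nzstep_sigma hQ) /nzstep s z //.
Qed.

Lemma zstep_out a b c : zstep a b -> src c = tgt a -> c = b \/ c = sg a.
Proof.
move=> /andP[/eqP s z] sc.
have cn : c \in arr_out (tgt a) by rewrite inE sc.
have bn : b \in arr_out (tgt a) by rewrite inE s.
have sn : sg a \in arr_out (tgt a) by rewrite inE src_sigma.
have sb : b != sg a by apply: zstep_neq; rewrite /zstep s eqxx.
case: (hQ (tgt a)) => [[_ o2 _ _]|[a' [b' [ai bo nz]]]]; last first.
  by move: bn sn sb; rewrite bo !inE => /eqP -> /eqP ->; rewrite eqxx.
have /eqP/setP/(_ c) : [set b; sg a] == arr_out (tgt a).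
  by rewrite eqEcard subUset !sub1set bn sn o2 cards2 sb.
by rewrite cn !inE => /orP[/eqP|/eqP]; [left|right].
Qed.

Lemma no_zstep_out a c : (forall b, ~~ zstep a b) -> src c = tgt a -> c = sg a.
Proof.
move=> h sc; apply/eqP; rewrite -(nzstep_sigma hQ) /nzstep sc eqxx /=.
by have := h c; rewrite /zstep sc eqxx.
Qed.

Lemma zstep_uniq a b b' : zstep a b -> zstep a b' -> b = b'.
Proof.
move=> ab ab'; have /andP[/eqP s' _] := ab'.
have [->|e] := zstep_out ab s' => //.
by have := zstep_neq ab'; rewrite e eqxx.
Qed.

Lemma arrow_zmul a b : zstep a b -> ar b * ar a = 0.
Proof.
move=> ab; apply: galg_extP => c n; rewrite mul_arrowE.
case: ifP => // /andP[_ /eqP ->]; rewrite arrowE.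
by rewrite [sg a == b]eq_sym (negbTE (zstep_neq ab)) andbF.
Qed.

Lemma mul_arrow_eq0 x a : x * ar a = 0 -> forall n, x (ptraj (sg a) n) = 0.
Proof.
move=> h n; have := congr1 (fun f : G => f (ptraj a n.+1)) h.
by rewrite mul_arrowE eqxx.
Qed.

(** A path starting at t(a) is trivial or begins with b or with [sigma a]. The condition x a = 0
    kills the trivial path and those beginning with [sigma a]; the others are right divisible by
    b. *)
Lemma left_exact_arrow a b x : zstep a b -> x * idem (tgt a) = x ->
  x * ar a = 0 -> exists y, x = y * ar b.
Proof.
move=> ab xe /mul_arrow_eq0 xa.
exists (GentleAlg (fun p => x (ptraj b (plen p).+1))).
apply: galg_extP => c n; rewrite mul_arrowE /= plen_ptraj.
have xc : src c != tgt a -> x (ptraj c n) = 0.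
  by move=> /negbTE sc; rewrite -xe mul_idemE sc.
have xt : x (ptraj b 0) = 0.
  rewrite (@ptraj0 _ (sg a)) ?xa // src_sigma //.
  by case/andP: ab => /eqP.
have [sc|sc] := eqVneq (src c) (tgt a); last first.
  rewrite (xc sc); case: ifP => // /andP[_ /eqP cb]; case/negP: sc.
  by rewrite cb; case/andP: ab.
case: (zstep_out ab sc) => ->.
  by rewrite eqxx andbT; case: n {xc} => [|n] //=.
by rewrite xa [sg a == b]eq_sym (negbTE (zstep_neq ab)) andbF.
Qed.

Lemma left_exact_last a x : (forall b, ~~ zstep a b) -> x * idem (tgt a) = x ->
  x * ar a = 0 -> x = 0.
Proof.
move=> ab xe /mul_arrow_eq0 xa; apply: galg_extP => c n.
have [/(no_zstep_out ab) -> //|/negbTE sc] := eqVneq (src c) (tgt a).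
by rewrite -xe mul_idemE sc.
Qed.

(** Dual argument on last arrows: b x = 0 kills the trivial path and the paths that b continues
    without a relation, and by injectivity of [sigma] the remaining ones end with a. *)
Lemma right_exact_arrow a b x : zstep a b -> idem (tgt a) * x = x ->
  ar b * x = 0 -> exists y, x = ar a * y.
Proof.
move=> ab ex bx.
have xb c n : iter n sg c = b -> x (ptraj c n) = 0.
  move=> e; have := congr1 (fun f : G => f (ptraj c n.+1)) bx.
  by rewrite arrow_mulE /= e eqxx.
have xc c n : src (iter n sg c) != tgt a -> x (ptraj c n) = 0.
  by move=> /negbTE h; rewrite -ex idem_mulE h.
(* The coefficient of y on p is that of x on p continued by one arrow. A trivial path has no first
   arrow to continue from, and the only continuation that counts there is a. *)
exists (GentleAlg (fun p => if (val p).2 is d :: _ then x (ptraj d (plen p).+1)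
  else x (ptraj a 1))).
apply: galg_extP => c n; rewrite arrow_mulE; case: n => [|n] /=.
  have [sc|sc] := eqVneq (src c) (tgt a); last exact: xc.
  rewrite (@ptraj0 _ b); first exact: xb.
  by case/andP: ab => /eqP ->.
rewrite plen_ptraj; case: ifP => [/eqP e|e].
  by case: n e => [|n] //= <-.
have [sc|/xc//] := eqVneq (src (iter n.+1 sg c)) (tgt a).
have [/xb//|e'] := zstep_out ab sc.
by case/eqP: e; exact: sigma_inj hQ _ _ e'.
Qed.

Section DiffTwist.
Variables (b : int -> E) (s : int -> bool).
Hypothesis bz : forall n, zstep (b (n + 1)) (b n).

Definition arrow_twist : twist G.
Proof.
exists (fun n => idem (tgt (b n))) (fun n => if s n then - ar (b n) else ar (b n)) => n.
- exact: idem_idem.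
- by case: (s n); rewrite ?mulrN idem_arrow.
- have /andP[/eqP e _] := bz n.
  by case: (s n); rewrite ?mulNr -e arrow_idem.
- by case: (s n); case: (s (n + 1)); rewrite ?mulNr ?mulrN arrow_zmul ?oppr0.
Defined.

Lemma arrow_twist_left : left_exact arrow_twist.
Proof.
move=> n x /= xe xu.
have xb : x * ar (b (n + 1)) = 0.
  by move: xu; case: (s _) => //; rewrite mulrN => /eqP; rewrite oppr_eq0 => /eqP.
have [y ->] := left_exact_arrow (bz n) xe xb.
by case: (s n); [exists (- y); rewrite mulrNN|exists y].
Qed.

Lemma arrow_twist_right : right_exact arrow_twist.
Proof.
move=> n x /= ex ux.
have bx : ar (b n) * x = 0.
  by move: ux; case: (s _) => //; rewrite mulNr => /eqP; rewrite oppr_eq0 => /eqP.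
have [y ->] := right_exact_arrow (bz n) ex bx.
by case: (s _); [exists (- y); rewrite mulrNN|exists y].
Qed.

Lemma arrow_twist_e0 : te arrow_twist 0 * ar (b 0) = ar (b 0).
Proof. exact: idem_arrow. Qed.

Lemma arrow_twist_u0 n : n + 1 = 0 -> tu arrow_twist n * ar (b 0) = 0.
Proof.
move=> n0; rewrite /= -n0.
by case: (s n); rewrite ?mulNr arrow_zmul ?oppr0.
Qed.

Lemma arrow_twist_ann y : y * te arrow_twist 0 = y -> y * ar (b 0) = 0 ->
  y * tu arrow_twist 0 = 0.
Proof. by move=> _ yb /=; case: (s 0); rewrite ?mulrN yb ?oppr0. Qed.

End DiffTwist.

Section DiffCycle.

(** The differential cycle is unrolled periodically and backwards: from n0, increasing indices
    follow [prev] and decreasing ones [next]. *)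
Lemma diff_seq a (n0 : int) : on_diff_cycle a ->
  exists b : int -> E, [/\ b n0 = a, forall n, zstep (b (n + 1)) (b n)
    & forall n, on_diff_cycle (b n)].
Proof.
move=> [w wd aw]; have /and3P[w0 wu wc] := wd.
pose f (i : int) := match i with Posz i => iter i (prev w) a
  | Negz i => iter i.+1 (next w) a end.
have fw i : f i \in w.
  case: i => i /=; last rewrite mem_next; elim: i => //= i IH.
    by rewrite mem_prev.
  by rewrite mem_next.
have fz i : zstep (f (i + 1)) (f i).
  have fE : f i = next w (f (i + 1)).
    case: i => [i|[|i]].
    - rewrite -PoszD addn1 /= next_prev //.
    - by [].
    - have -> : Negz i.+1 + 1 = Negz i by lia.
      by [].
  by rewrite fE; apply: next_cycle.
exists (fun n => f (n - n0)); split=> [|n|n]; first by rewrite subrr.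
  by have := fz (n - n0); rewrite addrAC.
by exists w.
Qed.

Lemma diff_cycle_next a : on_diff_cycle a -> exists2 b, zstep a b & on_diff_cycle b.
Proof.
move=> /(diff_seq 0)[b [<- bz bd]].
by exists (b (-1)) => //; have := bz (-1).
Qed.

(** Follow the zero relations forward from a. Predecessors for [zstep] are unique too ([back]), so a
    walk that never stopped would, by the pigeonhole principle, return to a itself, and its orbit
    would be a differential cycle. *)
Lemma not_diff_cycle a : ~ on_diff_cycle a ->
  exists l (c : nat -> E), [/\ c 0%N = a,
    forall i, (i < l)%N -> zstep (c i) (c i.+1) & forall b, ~~ zstep (c l) b].
Proof.
move=> na; pose f (c : E) := odflt c [pick b | zstep c b].
have fP c b : zstep c b -> zstep c (f c).
  by rewrite /f; case: pickP => [d|/(_ b) ->].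
have [[l lP]|nl] := EM (exists l, forall b, ~~ zstep (iter l f a) b).
  have ex : exists l, [forall b, ~~ zstep (iter l f a) b].
    by exists l; apply/forallP.
  case: (ex_minnP ex) => m /forallP mP mmin.
  exists m, (fun i => iter i f a); split=> // i im.
  have : ~~ [forall b, ~~ zstep (iter i f a) b].
    by apply/negP => /mmin; lia.
  by rewrite negb_forall => /existsP[b]; rewrite negbK => /fP.
case: na; have fz i : zstep (iter i f a) (iter i.+1 f a).
  have [b /fP //] : exists b, zstep (iter i f a) b.
  apply/existsP; apply: contraT; rewrite negb_exists => /forallP h.
  by case: nl; exists i.
have back c c' b : zstep c b -> zstep c' b -> c = c'.
  move=> /andP[/eqP s z] /andP[/eqP s' z'].
  case: (hQ (src b)) => [[_ _ _ /(_ b)]|[d [d' [di _ nz]]]].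
    rewrite inE eqxx => /(_ isT) /eqP/cards1P[d dE].
    have h (x : E) : tgt x = src b -> zrel b x -> x = d.
      by move=> e zx; apply/set1P; rewrite -dE !inE e eqxx.
    by rewrite (h c) // (h c').
  have h (x : E) : tgt x = src b -> x = d.
    by move=> e; apply/set1P; rewrite -di inE e.
  by rewrite (h c) // (h c').
(* Two equal terms of the walk are moved back together, by [back], until the earlier one is a. *)
have /(orbitPcycle 3 0) fc : exists n, iter n.+1 f a = a.
  have : ~~ injectiveb (fun i : 'I_#|E|.+1 => iter i f a).
    apply/negP => /injectiveP inj; have := leq_card _ inj.
    by rewrite card_ord ltnn.
  case/injectivePn => i [j ij].
  wlog lt_ij : i j ij / (i < j)%N.
    have : i != j :> nat by [].
    rewrite neq_ltn => /orP[] h H; [exact: H|].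
    by move=> e; apply: (H j i); rewrite // eq_sym.
  move=> e; exists (j - i).-1; rewrite prednK ?subn_gt0 //.
  have : (i <= j)%N := ltnW lt_ij.
  elim: (i : nat) (j : nat) e {lt_ij ij} => [|m IH] [|n] //.
  move=> e mn; rewrite subSS; apply: IH => //.
  apply: back (fz m) _; have := fz n; rewrite -/(iter n.+1 f a) -e //.
exists (orbit f a); last by rewrite -fconnect_orbit connect0.
apply/and3P; split; last 1 first.
- move: fc; apply: sub_in_cycle (allss _) => c d; rewrite -!fconnect_orbit => /iter_findex <- _ /eqP <-.
  exact: fz.
- by rewrite /orbit -orderSpred.
- exact: orbit_uniq.
Qed.

End DiffCycle.

End GentlePaths.

(** * Morphisms between the modules A a *)

Section HomDim.
Variables (Q : bound_quiver) (hQ : gentle Q) (k : fieldType).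
Notation E := (arr Q).
Local Notation G := (gentle_alg Q k).
Local Notation sg := (@sigma Q).
Local Notation ar := (arrow_elt k).
Local Notation pt := (ptraj hQ).
Implicit Types (a b c : E) (x y : G).

Definition no_sign (n : int) : bool := false.

(* A class in Hom(L_a, L_b) is represented by some y in A b; modulo the
   coboundaries, which form a (A b), it is a multiple of a. *)
Lemma arrow_quotient a b c y (hac : zstep a c) : ar c * y = 0 ->
  idem k (tgt a) * y = y -> (exists z, y = z * ar b) ->
  exists l h, [/\ y = galg_scalar Q l * ar a + ar a * (h * ar b) & a != b -> l = 0].
Proof.
move=> cy ey [z yz].
have [w yw] := right_exact_arrow hQ hac ey cy.
have yb d n : y (pt d n) != 0 -> d = b.
  by rewrite yz mul_arrowE; case: ifP; rewrite ?eqxx // => /andP[_ /eqP].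
have ya d n : y (pt d n) != 0 -> (n != 0%N) /\ iter n.-1 sg d = a.
  by rewrite yw arrow_mulE; case: ifP; rewrite ?eqxx // => /andP[? /eqP].
exists (y (pt b 1)), (GentleAlg (fun p => y (pt b (plen p).+2))); split; last first.
  move=> ab; apply: contraNeq ab => /ya[_ /= ->] //.
apply: galg_extP => d n; rewrite galg_addE [X in _ = X + _]galg_scalarE.
rewrite arrowE arrow_mulE mul_arrowE /= plen_ptraj.
have [y0|yn] := eqVneq (y (pt d n)) 0; last first.
  have db := yb _ _ yn; have [n0 na] := ya _ _ yn; subst d.
  rewrite n0 na eqxx /= eqxx andbT; case: n n0 na yn => [|[|n]] //= _ na yn.
    by rewrite na eqxx mulr1 addr0.
  by rewrite mulr0 add0r.
have [n0|n0] := eqVneq n 0%N; first by rewrite y0 n0 mulr0 addr0.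
rewrite y0; case: n n0 y0 => [//|[|n]] _ y0 /=.
  case: (eqVneq d a) => [da|]; last by rewrite mulr0 ?add0r ?if_same.
  rewrite /= ?addr0 mulr1; apply/esym.
  by apply: contra_eq y0 => h; have [_ /= ba] := ya _ _ h; rewrite da -ba.
rewrite mulr0 add0r; case: ifP => // _; case: eqP => // db; subst d.
by rewrite -[in LHS]y0.
Qed.

Variables (a : E) (bs : int -> E).
Hypothesis ba : bs 0 = a.
Hypothesis bz : forall n, zstep (bs (n + 1)) (bs n).
Local Notation t := (arrow_twist hQ k no_sign bz).

Local Notation Dk := (sing_cat (galg_k Q k)).

Fact La_e : te t 0 * ar a = ar a.
Proof. by rewrite -ba; exact: arrow_twist_e0. Qed.
Fact La_u n : n + 1 = 0 -> tu t n * ar a = 0.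
Proof. by rewrite -ba; exact: arrow_twist_u0. Qed.
Fact La_ann y : y * te t 0 = y -> y * ar a = 0 -> y * tu t 0 = 0.
Proof. by rewrite -ba; exact: arrow_twist_ann. Qed.

Local Notation lv x := (lideal_val x : G).

Lemma tc_L b (y : tcocycle t (L k b)) : exists l (h : G),
  lv (y 0 : left_ideal (ar b)) = galg_scalar Q l * ar a + ar a * (h * ar b) /\
  (a != b -> l = 0).
Proof.
have hac : zstep a (bs (-1)) by rewrite -ba; exact: (bz (-1)).
have [|||l [h [yE l0]]] := arrow_quotient (b := b) (y := lv (y 0 : left_ideal (ar b))) hac.
- exact: (congr1 (fun z : left_ideal (ar b) => lv z) (esym (tc_d y (-1)))).
- rewrite -ba.
  exact: (congr1 (fun z : left_ideal (ar b) => lv z) (tc_e y 0)).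
- exact: left_idealP.
- by exists l, h.
Qed.

Lemma tc_L_bound b (y : tcocycle t (L k b)) (h : G) :
  lv (y 0 : left_ideal (ar b)) = ar a * (h * ar b) -> tbound t y.
Proof.
move=> yh.
have hb : (te t 1 * h * ar b : G^o) \in lideal (ar b).
  by apply/lidealP; exists (te t 1 * h).
exists (@stalk_elt G (left_ideal (ar b)) (LeftIdeal hb)); split.
  move=> [[|n]|n] /=; rewrite ?scaler0 //; apply: val_inj.
  by rewrite /= regular_scaleE !mulrA (te_idem t 1).
move=> n; have [n1|n1] := eqVneq (n + 1) 0; last first.
  apply: etrans (stalk_eq0 (y (n + 1)) n1) _; apply/esym.
  by rewrite (stalk_eq0 (stalk_elt _ (n + 1)) n1) scaler0 addr0.
have -> : n = -1 by lia.
apply: val_inj; rewrite /= add0r regular_scaleE.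
rewrite [LHS]yh !mulrA; congr (_ * _ * _).
by rewrite -{1}ba; exact: esym (tue t 0).
Qed.

(** A bounding chain would give a = a h with h in A a, but a h has no component on the path a of
    length one. *)
Lemma tbound_lcoc : ~ tbound t (lcoc (@La_e) (@La_u)).
Proof.
move=> [h [_ /(_ (-1)) /(congr1 (fun z : left_ideal (ar a) => lv z)) hE]].
have {hE} : ar a = ar a * lv (h 0 : left_ideal (ar a)).
  by rewrite -[in X in _ = X * _]ba; rewrite [LHS]hE /= add0r.
have [z ->] := left_idealP (h 0 : left_ideal (ar a)).
move=> /(congr1 (fun f : G => f (pt a 1))).
rewrite arrowE arrow_mulE mul_arrowE /= !eqxx => /eqP.
by rewrite oner_eq0.
Qed.

Local Notation eta := (eta (galg_k Q k) (@arrow_twist_left Q hQ k bs no_sign bz) La_e La_u La_ann).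

Lemma hom_L (b : E) (f : hom (L k a : Dk) (L k b : Dk)) :
  exists y : tcocycle t (L k b), f =h eta y.
Proof.
by eexists; exact: (hom_Lst (@arrow_twist_right Q hQ k bs no_sign bz)
  (@arrow_twist_left Q hQ k bs no_sign bz) La_e La_u La_ann f).
Qed.

Lemma hom_dim_L_neq b : a != b -> hom_dim (L k a : Dk) (L k b : Dk) 0.
Proof.
move=> ab; have f0 (f : hom (L k a : Dk) (L k b : Dk)) : f =h hzero _ _.
  have [y ->] := hom_L f; have [l [h [yE /(_ ab) l0]]] := tc_L y.
  have [g [g1 g2]] : tbound t y.
    by apply: (@tc_L_bound _ _ h); rewrite yE l0 raddf0 mul0r add0r.
  have yz : tceq y (tcscale (galg_k Q k) 0 y).
    exists g; split=> // n; rewrite -g2 /= raddf0 scale0r subr0 //.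
  by apply: heq_trans (eta_cong (galg_k Q k) (@arrow_twist_left Q hQ k bs no_sign bz) La_e La_u La_ann yz) _; apply: heq_trans (etaZ _ _ _ _ _ _ _) (hscale0f _).
exists (fun i => hzero _ _); split=> [f|c _ []//].
by exists (fun=> 0); rewrite (f0 f) /lin_comb big_ord0.
Qed.

Lemma hom_dim_L_eq : hom_dim (L k a : Dk) (L k a : Dk) 1.
Proof.
apply/hom_dim1P; exists (idm _) => [z|f].
  apply: tbound_lcoc; apply: (Lst_zero (iota := galg_k Q k)) z.
  exact: arrow_twist_right.
have [y yE] := hom_L f; have [l [h [y0 _]]] := tc_L y.
exists l; rewrite yE; apply: heq_trans _ (hscale_cong l (eta_gen (galg_k Q k) (@arrow_twist_left Q hQ k bs no_sign bz) La_e La_u La_ann)).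
apply: heq_trans _ (etaZ _ _ _ _ _ _ _); apply: eta_cong.
pose y' : tcocycle t (L k a) := tcadd y (tcscale (galg_k Q k) (-1)
  (tcscale (galg_k Q k) l (lcoc La_e La_u))).
have [|g [g1 g2]] := @tc_L_bound a y' h.
  rewrite /= y0 rmorphN rmorph1 !regular_scaleE mulN1r addrAC subrr add0r //.
exists g; split=> // n; rewrite -g2 /= rmorphN rmorph1 scaleN1r //.
Qed.

End HomDim.

(** * Noetherian rings and minimal covers *)

Section Submodules.
Variable A : pzRingType.

Record submodule (M : lmodType A) := Submodule {
  smem :> M -> Prop;
  smem0 : smem 0;
  smemP : forall a x y, smem x -> smem y -> smem (a *: x + y)
}.

Section Sub.
Variables (M : lmodType A) (S : submodule M).

Lemma smemZ a x : S x -> S (a *: x).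
Proof. by move=> Sx; rewrite -[_ *: _]addr0; apply: smemP => //; exact: smem0. Qed.
Lemma smemD x y : S x -> S y -> S (x + y).
Proof. by move=> Sx Sy; rewrite -[x]scale1r; exact: smemP. Qed.
Lemma smemB x y : S x -> S y -> S (x - y).
Proof. by move=> Sx Sy; rewrite addrC -scaleN1r; exact: smemP. Qed.

Definition spred : {pred M} := fun x => `[< S x >].
Fact spred_closed : submod_closed spred.
Proof.
split; first by apply/asboolP; exact: smem0.
by move=> a x y /asboolP Sx /asboolP Sy; apply/asboolP; exact: smemP.
Qed.
HB.instance Definition _ := GRing.isSubmodClosed.Build A M spred spred_closed.

Record sub_of := SubOf { sub_val :> M; _ : sub_val \in spred }.
HB.instance Definition _ := [isSub for sub_val].
HB.instance Definition _ := [Choice of sub_of by <:].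
HB.instance Definition _ := [SubChoice_isSubLmodule of sub_of by <:].

Lemma sub_ofP (x : sub_of) : S (sub_val x).
Proof. by case: x => x /= /asboolP. Qed.

Definition sub_mk x (Sx : S x) : sub_of := SubOf (asboolT Sx).

Fact sub_incl_linear : linear (fun x : sub_of => sub_val x).
Proof. by []. Qed.
Definition sub_incl : {linear sub_of -> M} := mklin sub_incl_linear.

End Sub.

Section Span.
Variable M : lmodType A.
Implicit Types (s : seq M) (S : submodule M).

Fixpoint spans s (x : M) : Prop :=
  if s is g :: s' then exists a, spans s' (x - a *: g) else x = 0.

Lemma spansP s a x y : spans s x -> spans s y -> spans s (a *: x + y).
Proof.
elim: s x y => [|g s IH] x y /=; first by move=> -> ->; rewrite scaler0 addr0.
move=> [b hb] [c hc]; exists (a * b + c).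
suff -> : a *: x + y - (a * b + c) *: g = a *: (x - b *: g) + (y - c *: g) by exact: IH.
by rewrite scalerBr scalerDl scalerA opprD addrACA.
Qed.

Lemma spans0 s : spans s 0.
Proof. by elim: s => //= g s IH; exists 0; rewrite scale0r subr0. Qed.

Lemma spans_cons s g x : spans s x -> spans (g :: s) x.
Proof. by move=> h; exists 0; rewrite scale0r subr0. Qed.

Lemma spans_head s g : spans (g :: s) g.
Proof. by exists 1; rewrite scale1r subrr; exact: spans0. Qed.

Lemma spans_cat s1 s2 x y : spans s1 x -> spans s2 y -> spans (s1 ++ s2) (x + y).
Proof.
elim: s1 x => [|g s IH] x /=; first by move=> ->; rewrite add0r.
by move=> [a ha] hy; exists a; rewrite addrAC; exact: IH.
Qed.

Lemma spans_sum (I : Type) (r : seq I) (g : I -> M) (a : I -> A) :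
  spans (map g r) (\sum_(i <- r) a i *: g i).
Proof.
elim: r => [|i r IH]; rewrite ?big_nil //= big_cons; exists (a i).
by rewrite addrKl.
Qed.

Lemma spansE s x : spans s x <-> exists a : nat -> A, x = \sum_(i < size s) a i *: s`_i.
Proof.
elim: s x => [|g s IH] x /=.
  split=> [->|[a ->]]; last by rewrite big_ord0.
  by exists (fun=> 0); rewrite big_ord0.
split=> [[b /IH[a xE]]|[a ->]].
  exists (fun i => if i is j.+1 then a j else b).
  by rewrite big_ord_recl /= -xE subrKC.
exists (a 0%N); apply/IH; exists (fun i => a i.+1).
by rewrite big_ord_recl /= addrKl.
Qed.

Lemma fin_gen_spans : fin_gen M <-> exists s, forall x, spans s x.
Proof.
split=> [[n [g hg]]|[s hs]].
  exists (map g (index_enum 'I_n)) => x; have [a ->] := hg x; exact: spans_sum.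
exists (size s), (fun i => s`_i) => x.
by have /spansE[a ->] := hs x; exists (fun i => a i).
Qed.

Definition fg_sub S : Prop := exists s, forall x, S x <-> spans s x.

Lemma fg_sub_fin_gen S : fg_sub S -> fin_gen (sub_of S).
Proof.
move=> [s hs]; have Ss i : (i < size s)%N -> S s`_i.
  move=> h; apply/hs/spansE; exists (fun j => (j == i)%:R).
  rewrite (bigD1 (Ordinal h)) //= eqxx scale1r big1 ?addr0 // => j.
  by rewrite -val_eqE /= => /negbTE ->; rewrite scale0r.
exists (size s), (fun i : 'I_(size s) => sub_mk (Ss i (ltn_ord i))) => x.
have /hs/spansE[a xE] := sub_ofP x; exists (fun i => a i); apply: val_inj.
by rewrite [LHS]xE -[RHS]/(sub_incl S _) raddf_sum; apply: eq_bigr => i _.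
Qed.

End Span.

Definition noetherian : Prop := forall S : submodule A^o, fg_sub S.

Hypothesis An : noetherian.

(** The coefficients at g of elements of S form a left ideal. Elements of S realising its finitely
    many generators, together with generators of the part of S spanned by the remaining list,
    generate S. *)
Lemma noetherian_spans (M : lmodType A) (s : seq M) (S : submodule M) :
  (forall x, S x -> spans s x) -> fg_sub S.
Proof.
elim: s S => [|g s IH] S hS.
  by exists [::] => x; split=> [/hS//|->]; exact: smem0.
have I0 : exists2 x, S x & spans s (x - (0 : A) *: g).
  by exists 0; rewrite ?scale0r ?subrr; [exact: smem0|exact: spans0].
have IP (a : A) (b c : A^o) : (exists2 x, S x & spans s (x - (b : A) *: g)) ->
    (exists2 x, S x & spans s (x - (c : A) *: g)) ->
    exists2 x, S x & spans s (x - ((a *: b + c : A^o) : A) *: g).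
  move=> [x Sx hx] [y Sy hy]; exists (a *: x + y); first exact: smemP.
  suff -> : a *: x + y - ((a *: b + c : A^o) : A) *: g =
      a *: (x - (b : A) *: g) + (y - (c : A) *: g).
    exact: spansP.
  by rewrite scalerBr scalerDl scalerA opprD addrACA.
have [r hr] := An (Submodule I0 IP).
have S'0 : S 0 /\ spans s 0 by split; [exact: smem0|exact: spans0].
have S'P a x y : S x /\ spans s x -> S y /\ spans s y ->
    S (a *: x + y) /\ spans s (a *: x + y).
  by move=> [Sx hx] [Sy hy]; split; [exact: smemP|exact: spansP].
have [s' hs'] := IH (Submodule S'0 S'P) (fun x => @proj2 _ _).
have hS' x : spans s' x -> S x by move/hs' => [].
have rI i : (i < size r)%N -> exists2 x, S x & spans s (x - (r`_i : A) *: g).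
  move=> h; apply/(hr r`_i)/spansE; exists (fun j => (j == i)%:R).
  rewrite (bigD1 (Ordinal h)) //= eqxx scale1r big1 ?addr0 // => j.
  by rewrite -val_eqE /= => /negbTE ->; rewrite scale0r.
have rI' i : exists x, (i < size r)%N -> S x /\ spans s (x - (r`_i : A) *: g).
  by have [/rI[x]|] := boolP (i < size r)%N; [exists x|exists 0].
have [xs hxs] := choice rI'.
exists (s' ++ map (fun i : 'I_(size r) => xs i) (index_enum _)) => x; split=> [Sx|]; last first.
  have Sxs (i : 'I_(size r)) : S (xs i) by have [] := hxs i (ltn_ord i).
  elim: (index_enum _) s' x hS' {hs'} => [|i l IHl] s' x hS' /=.
    by rewrite cats0; exact: hS'.
  have E : s' ++ xs i :: map (fun i : 'I_(size r) => xs i) l =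
    (rcons s' (xs i)) ++ map (fun i : 'I_(size r) => xs i) l by rewrite cat_rcons.
  rewrite E; apply: IHl => y; elim: s' y hS' {E} => [|z s' IHs] y hS' /=.
    by move=> [c yc]; rewrite -[y](subrK (c *: xs i)) yc add0r; exact: smemZ.
  move=> [c yc]; rewrite -[y](subrK (c *: z)); apply: smemD.
    by apply: IHs yc => w hw; apply: hS'; exact: spans_cons.
  by apply: smemZ; apply: hS'; exact: spans_head.
have [b hb] := hS x Sx.
have /(hr b)/spansE[a bE] : exists2 x, S x & spans s (x - b *: g) by exists x.
pose y := \sum_(i < size r) a i *: xs i.
have Sy : S y.
  rewrite /y; elim/big_rec: _ => [|i z _ Sz]; first exact: smem0.
  by apply: smemP => //; have [] := hxs i (ltn_ord i).
have hy : spans s (y - b *: g).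
  have -> : y - b *: g = \sum_(i < size r) a i *: (xs i - (r`_i : A) *: g).
    rewrite bE scaler_suml -sumrB; apply: eq_bigr => i _.
    by rewrite scalerBr scalerA.
  elim/big_rec: _ => [|i z _ hz]; first exact: spans0.
  by apply: spansP => //; have [] := hxs i (ltn_ord i).
rewrite -[x](subrK y); apply: spans_cat; last exact: spans_sum.
apply/hs'; split; first exact: smemB.
have -> : x - y = (-1) *: (y - b *: g) + (x - b *: g).
  by rewrite scaleN1r opprB [RHS]addrC subrKA.
exact: spansP.
Qed.

Lemma noetherian_sub (M : lmodType A) (S : submodule M) : fin_gen M -> fin_gen (sub_of S).
Proof.
move=> /fin_gen_spans[s hs]; apply: fg_sub_fin_gen.
by apply: (@noetherian_spans _ s).
Qed.

End Submodules.

(** * Syzygies in the singularity category *)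

Section SubComplex.
Variables (A : pzRingType) (X : cplx A) (S : forall n, submodule (X n)).
Hypothesis Sd : forall n x, S n x -> S (n + 1) (cdif X n x).

Definition sub_dif n (x : sub_of (S n)) : sub_of (S (n + 1)) :=
  sub_mk (Sd (sub_ofP x)).
Fact sub_dif_linear n : linear (@sub_dif n).
Proof. by move=> a x y; apply: val_inj; rewrite /= linearP. Qed.

Definition sub_cplx : cplx A.
Proof.
exists (fun n => sub_of (S n)) (fun n => mklin (@sub_dif_linear n)) => n x.
by apply: val_inj; rewrite /= cdif2.
Defined.

Definition sub_cplx_incl : chmap sub_cplx X.
Proof. by exists (fun n => sub_incl (S n)) => n x. Defined.

End SubComplex.

Definition sub_bcplx (A : pzRingType) (An : noetherian A) (X : bcplx A)
  (S : forall n, submodule (X n)) (Sd : forall n x, S n x -> S (n + 1) (cdif X n x)) :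
  bcplx A.
Proof.
exists (sub_cplx Sd).
  have [m hm] := bc_bounded X; exists m => n /hm h x.
  by apply: val_inj; exact: h.
by move=> n; apply: noetherian_sub => //; exact: bc_fg.
Defined.

(** The cone of X -> cone f is quasi-isomorphic to the shift of P, by p |-> (-f p, (p, 0)). *)
Lemma cone_in_iso (k : fieldType) (A : pzRingType) (iota : central_morph k A)
    (P X : bcplx A) (f : chmap P X) : degreewise (@fg_projective A) P ->
  is_iso (sing_map iota (cone_in f : chmap X (bcone f))).
Proof.
move=> PP; apply: sing_map_iso; exists (bshift P).
split; first by move=> n; exact: PP.
pose i n (p : shift P n) : cone (cone_in f) n := (- f (n + 1) p, (p, 0)).
have il n : linear (@i n).
  move=> a x y; apply/pair_equal_spec; split=> /=.
    by rewrite linearP opprD scalerN.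
  by apply/pair_equal_spec; split; rewrite /= ?scaler0 ?addr0.
have ic n (x : shift P n) : i (n + 1) (cdif (shift P) n x) =
    cdif (cone (cone_in f)) n (i n x).
  apply/pair_equal_spec; split=> /=; first by rewrite !raddfN /= cmapP opprK.
  by apply/pair_equal_spec; split; rewrite /= ?add0r ?raddf0 ?addr0 ?addNr.
pose I : chmap (bshift P) (bcone (cone_in f : chmap X (bcone f))) :=
  @ChMap A (shift P) (cone (cone_in f)) (fun n => mklin (@il n)) ic.
apply: isomorphic_sym; exists (derived_map iota I); apply: derived_map_iso.
split=> n.
  move=> x dx [[y [p z]] /pair_equal_spec[_ /pair_equal_spec[/= -> _]]].
  by exists p; rewrite /= add0r.
move=> [x [p z]] /pair_equal_spec[/= dx /pair_equal_spec[/= dp e]].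
exists p, (z, (0, 0)); split.
  by rewrite -[RHS]dp add0r.
apply/pair_equal_spec; split=> /=; last first.
  by apply/pair_equal_spec; split; rewrite /= ?raddf0 ?oppr0 ?addr0 ?add0r ?raddf0 ?addr0.
apply/eqP; rewrite -subr_eq0 opprD !opprK addrA; apply/eqP.
by rewrite -addrA [X in X = _]e.
Qed.

Section Covers.
Variables (A : pzRingType) (V : Type) (e : V -> A).
Hypothesis ee : forall v, e v * e v = e v.

Section Cover.
Variables (r : nat) (v : 'I_r -> V).

(** The direct sum of the projectives A e(v j), kept inside a free module because later arguments
    cut its elements coordinatewise by arrows. *)
Definition pv_mem (f : 'rV[A]_r) : Prop := forall j, f 0 j * e (v j) = f 0 j.
Fact pv_mem0 : pv_mem 0. Proof. by move=> j; rewrite mxE mul0r. Qed.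
Fact pv_memP a f g : pv_mem f -> pv_mem g -> pv_mem (a *: f + g).
Proof. by move=> hf hg j; rewrite !mxE mulrDl -mulrA hf hg. Qed.
Definition pv_sub := Submodule pv_mem0 pv_memP.
Definition pv : lmodType A := sub_of pv_sub.

Fact pv_gen_subproof j : pv_mem (\row_i if i == j then e (v j) else 0).
Proof. by move=> i; rewrite mxE; case: eqP => [->|_]; rewrite ?ee ?mul0r. Qed.
Definition pv_gen j : pv := sub_mk (pv_gen_subproof j : pv_sub _).

Lemma pv_genE (f : pv) : f = \sum_j (sub_val f) 0 j *: pv_gen j.
Proof.
apply: val_inj; rewrite -[RHS]/(sub_incl pv_sub _) raddf_sum /=.
apply/rowP => i; rewrite summxE (bigD1 i) //= !mxE eqxx big1 ?addr0.
  by rewrite (sub_ofP f).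
by move=> j /negbTE ji; rewrite !mxE eq_sym ji mulr0.
Qed.

Lemma pv_fgproj : fg_projective pv.
Proof.
split.
  exists r, pv_gen => f; exists (fun j => sub_val f 0 j); exact: pv_genE.
move=> M N p f psurj.
have [m hm] := choice (fun j => psurj (f (pv_gen j))).
pose g (x : pv) : M := \sum_j sub_val x 0 j *: m j.
have gl : linear g.
  move=> a x y; rewrite /g scaler_sumr -big_split; apply: eq_bigr => j _.
  by rewrite /= !mxE scalerDl scalerA.
exists (mklin gl) => x; rewrite /= /g linear_sum [RHS](congr1 f (pv_genE x)) linear_sum.
by apply: eq_bigr => j _; rewrite linearZ /= hm -linearZ.
Qed.

Variables (M : lmodType A) (x : 'I_r -> M).

Definition hcover : Prop :=
  (forall j, e (v j) *: x j = x j) /\ forall m, exists a : 'I_r -> A, m = \sum_j a j *: x j.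

Fact pv_act_linear : linear (fun f : pv => \sum_j sub_val f 0 j *: x j).
Proof.
move=> a f g; rewrite scaler_sumr -big_split; apply: eq_bigr => j _.
by rewrite /= !mxE scalerDl scalerA.
Qed.
Definition pv_act : {linear pv -> M} := mklin pv_act_linear.

Lemma pv_act_surj : hcover -> forall m, exists f, pv_act f = m.
Proof.
move=> [xe xg] m; have [a ->] := xg m.
have h : pv_sub (\row_j (a j * e (v j))).
  by move=> j; rewrite mxE -mulrA ee.
by exists (sub_mk h); apply: eq_bigr => j _; rewrite /= mxE -scalerA xe.
Qed.

End Cover.

Definition mincover (M : lmodType A) r v (x : 'I_r -> M) : Prop :=
  hcover v x /\ forall r' v' (x' : 'I_r' -> M), hcover v' x' -> (r <= r')%N.

Lemma mincover_exists (M : lmodType A) (vs : seq V) :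
  \sum_(v <- vs) e v = 1 -> fin_gen M -> exists r v (x : 'I_r -> M), mincover v x.
Proof.
move=> e1 [n [g hg]].
pose P r := `[< exists v (x : 'I_r -> M), hcover v x >].
have exP : exists r, P r.
  pose T : finType := ('I_n * 'I_(size vs))%type.
  exists #|T|; apply/asboolP.
  exists (fun i => tnth (in_tuple vs) (enum_val i).2),
    (fun i => e (tnth (in_tuple vs) (enum_val i).2) *: g (enum_val i).1).
  split=> [i|m]; first by rewrite scalerA ee.
  have [a ->] := hg m; exists (fun i => a (enum_val i).1).
  transitivity (\sum_(p : T) a p.1 *: (e (tnth (in_tuple vs) p.2) *: g p.1)); last first.
    by rewrite (reindex _ (onW_bij _ (@enum_val_bij T))).
  rewrite -(pair_big predT predT (fun i j => a i *: (e (tnth (in_tuple vs) j) *: g i))) /=.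
  apply: eq_bigr => i _; rewrite -scaler_sumr -scaler_suml -(big_tnth _ _ _ xpredT e) e1.
  by rewrite scale1r.
case: (ex_minnP exP) => r /asboolP[v [x hx]] rmin; exists r, v, x; split=> //.
by move=> r' v' x' h'; apply: rmin; apply/asboolP; exists v', x'.
Qed.

End Covers.

Section Step.
Variables (k : fieldType) (A : pzRingType) (iota : central_morph k A).
Variables (V : Type) (e : V -> A) (vs : seq V).
Hypothesis ee : forall v, e v * e v = e v.
Hypothesis e1 : \sum_(v <- vs) e v = 1.
Hypothesis An : noetherian A.

(* The cone of a minimal cover of the top term X^(n+1) by a perfect complex is
   isomorphic to X in the singularity category and exact in degree n + 1. *)
Lemma step (n : int) (X : bcplx A) : (forall i (x : X i), n + 1 < i -> x = 0) ->
  exists X' : bcplx A,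
    [/\ isomorphic (X : sing_cat iota) (X' : sing_cat iota),
        forall i (x : X' i), n < i -> x = 0,
        forall i, i < n -> (forall x : X i, x = 0) -> forall x : X' i, x = 0
      & (forall x : X n, x = 0) -> exists r v (x : 'I_r -> X (n + 1)),
          mincover e v x /\ exists i : {linear X' n -> 'rV[A]_r},
            injective i /\ forall f, (exists y, i y = f) <->
              pv_mem e v f /\ \sum_j f 0 j *: x j = 0].
Proof.
move=> Xn.
(* The cover lives in degree n + 1 only; taking a family over all degrees, without generators
   elsewhere, avoids casts between X^i and X^(n+1). *)
have C i : exists c : {r & (('I_r -> V) * ('I_r -> X i))%type},
    (i = n + 1 -> mincover e (projT2 c).1 (projT2 c).2) /\
    (i != n + 1 -> projT1 c = 0%N).
  have [_|ni] := eqVneq i (n + 1); last first.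
    exists (existT _ 0%N ((fun j : 'I_0 => match j with Ordinal _ p => match notF p with end end), fun=> 0)); split=> // ii; by rewrite ii eqxx in ni.
  have [r [v [x hx]]] := mincover_exists ee e1 (bc_fg X i).
  exists (existT (fun r => ('I_r -> V) * ('I_r -> X i))%type r (v, x)).
  by split=> //; rewrite eqxx.
pose c i := projT1 (cid (C i)); have cP i : (_ : Prop) := projT2 (cid (C i)).
pose r i := projT1 (c i); pose v i : 'I_(r i) -> V := (projT2 (c i)).1.
pose x i : 'I_(r i) -> X i := (projT2 (c i)).2.
have rn : mincover e (v (n + 1)) (@x (n + 1)) by case: (cP (n + 1)) => /(_ erefl).
have r0 i : i != n + 1 -> r i = 0%N by case: (cP i).
have G0 i : i != n + 1 -> forall f : pv e (v i), f = 0.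
  move=> h f; apply: val_inj; apply/rowP => j.
  by exfalso; have := ltn_ord j; have := r0 i h; lia.
pose Gc : cplx A := @Cplx A (fun i => pv e (v i)) (fun i => \0) (fun i f => erefl).
have Gbd : bounded Gc by exists (absz (n + 1)) => i h; apply: G0; lia.
have Gfg : degreewise (@fin_gen A) Gc by move=> i; case: (pv_fgproj ee (v i)).
pose G : bcplx A := BCplx Gbd Gfg.
have pc i (f : G i) : pv_act e (v (i + 1)) (@x (i + 1)) (cdif G i f) =
    cdif X i (pv_act e (v i) (@x i) f).
  rewrite raddf0; have [h|/G0 h] := eqVneq i (n + 1); last by rewrite (h f) !raddf0.
  by apply/esym/Xn; lia.
pose p : chmap G X := ChMap pc.
have Xp : isomorphic (X : sing_cat iota) (bcone p : sing_cat iota).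
  exists (sing_map iota (cone_in p : chmap X (bcone p))); apply: cone_in_iso => i.
  exact: pv_fgproj.
(* Truncation of the cone by cycles in degree n. It keeps the cohomology, because the cover makes
   the differential onto the top term X^(n+1) surjective. *)
pose Sm i (z : cone p i) := [\/ i < n, i = n /\ cdif (cone p) i z = 0 | z = 0].
have Sm0 i : @Sm i 0 by constructor 3.
have SmP i a y z : @Sm i y -> @Sm i z -> @Sm i (a *: y + z).
  move=> [h|[h dy]|->] [h'|[h' dz]|->]; try by [constructor 1].
  - by constructor 2; split; rewrite // linearP dy dz scaler0 addr0.
  - by constructor 2; split; rewrite // linearP dy cdif0 scaler0 addr0.
  - by constructor 2; split; rewrite // scaler0 add0r.
  - by constructor 3; rewrite scaler0 addr0.
pose S i := Submodule (Sm0 i) (@SmP i).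
have Sd i z : S i z -> S (i + 1) (cdif (cone p) i z).
  move=> [h|[h dz]|->]; last by constructor 3; rewrite cdif0.
    have [h'|h'] := eqVneq (i + 1) n; last by constructor 1; lia.
    by constructor 2; split=> //; rewrite cdif2.
  by constructor 3.
pose X' := sub_bcplx An (X := bcone p) Sd.
have Cq : quasi_iso (sub_cplx_incl Sd).
  split=> i.
    move=> s ds [c' sE]; have [h|h] := ltP i n.
      have Sc : S i c' by constructor 1.
      by exists (sub_mk Sc); apply: val_inj; exact: sE.
    exists 0; rewrite cdif0; apply: val_inj.
    by case: (sub_ofP s) => [|[]|//]; lia.
  move=> z dz; have [h|h] := leP (i + 1) n.
    have Sz : S (i + 1) z.
      by have [h'|h'] := eqVneq (i + 1) n; [constructor 2|constructor 1; lia].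
    exists (sub_mk Sz), 0; split; first exact: val_inj.
    by rewrite cdif0 addr0.
  have [h'|h'] := eqVneq i n; last first.
    exists 0, 0; split; first by rewrite cdif0.
    rewrite cdif0 addr0 raddf0; case: z dz => f y _.
    by rewrite (G0 _ _ f) ?(Xn _ y) //; lia.
  subst i; case: z dz => f y _; have [g gy] := pv_act_surj ee (proj1 rn) y.
  exists 0, (g, 0); split; first by rewrite cdif0.
  rewrite raddf0 add0r; apply/pair_equal_spec; split; last first.
    by rewrite /= -gy raddf0 addr0.
  by rewrite (G0 _ _ f) ?oppr0 //; lia.
exists X'; split.
- apply: isomorphic_trans Xp _; apply: isomorphic_sym.
  by exists (sing_map iota (sub_cplx_incl Sd : chmap X' (bcone p))); exact: sing_map_qiso.
- move=> i y h; apply: val_inj.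
  by case: (sub_ofP y) => [|[]|//]; lia.
- move=> i h X0 y; apply: val_inj; case: y => -[f y] /= _.
  by rewrite (G0 _ _ f) ?(X0 y) //; lia.
move=> X0; exists (r (n + 1)), (v (n + 1)), (@x (n + 1)); split=> //.
pose q (z : X' n) : 'rV[A]_(r (n + 1)) := sub_val (sub_val z).1.
have ql : linear q by move=> a y z.
exists (mklin ql); split.
  move=> y z /= yz; apply: val_inj.
  rewrite [val y]surjective_pairing [val z]surjective_pairing; congr pair.
    exact: val_inj.
  by rewrite (X0 (val y).2) (X0 (val z).2).
move=> f; split=> [[y <-]|[fm f0]].
  split; first exact: (sub_ofP (sub_val y).1).
  case: (sub_ofP y) => [|[_ /pair_equal_spec[_ /=]]|z0]; first by rewrite ltxx.
    by rewrite (X0 (sub_val y).2) raddf0 addr0.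
  by rewrite /= /q z0; apply: big1 => j _; rewrite mxE scale0r.
have Sf : S n (sub_mk (fm : pv_sub e (v (n + 1)) f), 0).
  constructor 2; split=> //; apply/pair_equal_spec; split; rewrite /= ?oppr0 //.
  by rewrite raddf0 addr0.
by exists (sub_mk Sf).
Qed.

Lemma concentrate (X : bcplx A) : exists (n : int) (X' : bcplx A),
  isomorphic (X : sing_cat iota) (X' : sing_cat iota) /\
  forall i (x : X' i), i != n -> x = 0.
Proof.
have [m hm] := bc_bounded X; exists (- m%:Z).
have [j] : exists j : nat, forall i (x : X i), - m%:Z + j%:Z < i -> x = 0.
  by exists (2 * m)%N => i x h; apply: hm; lia.
have : forall i (x : X i), i < - m%:Z -> x = 0 by move=> i x h; apply: hm; lia.
elim: j X {hm} => [|j IH] X lo hi.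
  exists X; split; first exact: isomorphic_refl.
  by move=> i x h; have [/lo//|h'] := ltP i (- m%:Z); apply: hi; lia.
have [|X' [XX' hi' lo' _]] := step (n := - m%:Z + j%:Z) (X := X).
  by move=> i x h; apply: hi; lia.
have [||X'' [h1 h2]] := IH X'.
- by move=> i x h; apply: lo'; [lia|move=> y; exact: lo].
- by move=> i x h; apply: hi'.
by exists X''; split=> //; exact: isomorphic_trans h1.
Qed.

End Step.

(** * The radical of a gentle algebra *)

Section RadicalInverse.
Variables (Q : bound_quiver) (k : fieldType).
Local Notation G := (gentle_alg Q k).

Definition in_rad (x : G) : Prop := forall p, plen p = 0%N -> x p = 0.

Lemma in_rad_exp (r : G) n p : in_rad r -> (plen p < n)%N -> (r ^+ n) p = 0.
Proof.
move=> hr; elim: n p => // n IH p; rewrite ltnS => pn.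
rewrite exprS galg_mulE big1 // => i _; have ip : (i <= plen p)%N by rewrite -ltnS.
case: (ltnP i (plen p)) => h.
  by rewrite IH ?mulr0 // plen_pre //; apply: leq_trans pn.
by rewrite hr ?mul0r // plen_suf; apply/eqP; rewrite subn_eq0.
Qed.

(* 1 - r is inverted by the geometric series. *)
Lemma rad_inverse (r : G) : in_rad r -> exists v, v * (1 - r) = 1.
Proof.
move=> hr; pose v : G := GentleAlg (fun p => \sum_(i < (plen p).+1) (r ^+ i) p).
have vE n p : (plen p <= n)%N -> v p = \sum_(i < n.+1) (r ^+ i) p.
  move=> pn; rewrite /v /= (big_ord_widen n.+1 (fun i => (r ^+ i) p)) // big_mkcond /=.
  by apply: eq_bigr => i _; case: ltnP => // h; rewrite in_rad_exp.
exists v; rewrite mulrBr mulr1; apply: galg_ext => p.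
rewrite galg_addE galg_oppE galg_mulE.
under [X in _ - X]eq_bigr => j _.
  rewrite (@vE (plen p)) ?plen_suf ?leq_subr // mulr_suml; over.
rewrite exchange_big /=.
have E (i : nat) : \sum_(j < (plen p).+1) (r ^+ i) (nsuf j p) * r (npre j p) =
    (r ^+ i.+1) p by rewrite exprSr.
under [X in _ - X]eq_bigr => i _ do rewrite E.
rewrite big_ord_recl [X in _ - X]big_ord_recr /= in_rad_exp // addr0.
by rewrite addrK.
Qed.

(** The element l^-1 x differs from 1 by an element of the radical. *)
Lemma unit_inverse (x : G) (l : k) : l != 0 -> (forall p, plen p = 0%N -> x p = l) ->
  exists v, v * x = 1.
Proof.
move=> l0 xl; pose r := 1 - galg_scalar Q l^-1 * x.
have [|v vr] := @rad_inverse r.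
  move=> p p0; rewrite galg_addE galg_oppE [X in _ - X]galg_scalarE xl // mulVf //.
  by rewrite /= p0 eqxx subrr.
by exists (v * galg_scalar Q l^-1); rewrite -mulrA -[RHS]vr /r subKr.
Qed.

End RadicalInverse.

Section Uniserial.
Variables (Q : bound_quiver) (hQ : gentle Q) (k : fieldType).
Notation V := (vert Q).
Notation E := (arr Q).
Local Notation G := (gentle_alg Q k).
Local Notation sg := (@sigma Q).
Local Notation ar := (arrow_elt k).
Local Notation pt := (ptraj hQ).
Implicit Types (a b c : E) (x y z : G).

Lemma in_radP x : (forall a, x (pt a 0) = 0) <-> in_rad x.
Proof.
split=> [h p p0|h a]; last by apply: h; rewrite plen_ptraj.
by have [a ->] := nzpath_ptraj hQ p; rewrite p0.
Qed.

Lemma galg_funE (F : E -> nat -> k) :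
  (forall a b, src a = src b -> F a 0%N = F b 0%N) ->
  exists x : G, forall a n, x (pt a n) = F a n.
Proof.
move=> h; have g v : exists a, src a = v := exists_out hQ v.
exists (GentleAlg (fun p => if (val p).2 is a :: _ then F a (plen p)
  else F (projT1 (cid (g (val p).1))) 0%N)) => a [|n] /=.
  by apply: h; case: cid => b /= ->.
by rewrite plen_ptraj.
Qed.

(** This projection is left linear on the radical and [last_part] is right linear there; a trivial
    path has neither a first nor a last arrow, hence the restriction to the radical. *)
Definition first_part a x : G :=
  GentleAlg (fun p => if (val p).2 is b :: _ then (b == a)%:R * x p else 0).
Definition last_part c x : G :=
  GentleAlg (fun p => if (val p).2 is b :: w then (last b w == c)%:R * x p else 0).

Lemma first_partE a x b n :
  first_part a x (pt b n) = if (n != 0%N) && (b == a) then x (pt b n) else 0.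
Proof. by case: n => [//|n] /=; case: eqP; rewrite ?mul1r ?mul0r. Qed.

Lemma last_partE c x b n :
  last_part c x (pt b n) = if (n != 0%N) && (iter n.-1 sg b == c) then x (pt b n) else 0.
Proof.
by case: n => [//|n] /=; rewrite last_traject; case: eqP; rewrite ?mul1r ?mul0r.
Qed.

Lemma first_partM a x y : in_rad y -> first_part a (x * y) = x * first_part a y.
Proof.
move=> /in_radP hy; apply: (@galg_extP Q hQ k) => b n; rewrite first_partE !galg_mul_ptraj.
case: n => [|n]; first by rewrite !big_ord1 first_partE mulr0.
case: (b =P a) => [->|/eqP/negbTE ba]; last rewrite andbF.
  rewrite [(_ != _) && true]/=; apply: eq_bigr => i _; rewrite first_partE eqxx andbT.
  by case: eqP => // -> ; rewrite hy.
by rewrite big1 // => i _; rewrite first_partE ba andbF mulr0.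
Qed.

Lemma last_partM c x y : in_rad x -> last_part c (x * y) = last_part c x * y.
Proof.
move=> /in_radP hx; apply: (@galg_extP Q hQ k) => b n; rewrite last_partE !galg_mul_ptraj.
case: n => [|n]; first by rewrite !big_ord1 last_partE mul0r.
have E (i : 'I_n.+2) : last_part c x (pt (iter i sg b) (n.+1 - i)) =
    if iter n sg b == c then x (pt (iter i sg b) (n.+1 - i)) else 0.
  rewrite last_partE; case: eqP => /= [->|h]; first by rewrite hx if_same.
  by rewrite -iterD; have -> : ((n.+1 - i).-1 + i = n)%N by lia.
rewrite [(_ != _) && _]/=; case: ifP => h.
  by apply: eq_bigr => i _; rewrite E h.
by rewrite big1 // => i _; rewrite E h mul0r.
Qed.

Lemma last_part_arrow c x : exists y, last_part c x = ar c * y.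
Proof.
have [y yE] := @galg_funE (fun a n => if n is 0%N then x (pt c 1) else x (pt a n.+1))
  (fun a b _ => erefl).
exists y; apply: (@galg_extP Q hQ k) => a n; rewrite last_partE arrow_mulE.
by case: n => [//|[|n]] /=; rewrite yE //; case: eqP => // ->.
Qed.

Lemma idem_last_part c x : idem k (tgt c) * last_part c x = last_part c x.
Proof. by have [y ->] := last_part_arrow c x; rewrite mulrA idem_arrow. Qed.

(** Both x and z are left multiples of the path of length n beginning with a, and for z the
    multiplier is left invertible. *)
Lemma uniserial a n (x z : G) : first_part a x = x -> first_part a z = z ->
  z (pt a n) != 0 -> (forall i, (i < n)%N -> z (pt a i) = 0) ->
  (forall i, (i < n)%N -> x (pt a i) = 0) -> exists w : G, x = w * z.
Proof.
move=> xa za zn zlt xlt.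
have n0 : n != 0%N by apply: contraNneq zn => ->; rewrite -za first_partE.
have part (y : G) : first_part a y = y -> (forall i, (i < n)%N -> y (pt a i) = 0) ->
    exists2 u : G, y = u * path_elt k (val (pt a n)) & forall p, plen p = 0%N -> u p = y (pt a n).
  move=> ya ylt.
  (* The multiplier gets the same coefficient on all trivial paths, also at vertices that do not
     matter for the product, so that [unit_inverse] applies to it. *)
  have [u uE] := @galg_funE (fun b m => if (m == 0%N) || (b == iter n sg a) then y (pt a (n + m)) else 0)
    (fun b c _ => erefl).
  exists u; last first.
    by move=> p p0; have [b ->] := nzpath_ptraj hQ p; rewrite p0 uE addn0.
  have pE (i : nat) b : path_elt k (val (pt a n)) (pt b i) = ((i == n) && (b == a))%:R.
    rewrite /path_elt /=; congr (nat_of_bool _)%:R; apply/eqP/andP => [[_ e]|[/eqP -> /eqP ->] //].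
    have := congr1 size e; rewrite !size_traject => ni; rewrite ni eqxx; split=> //.
    by move: n0 e; rewrite ni; case: (n) => // n' _ [-> _].
  apply: (@galg_extP Q hQ k) => b m; rewrite galg_mul_ptraj.
  have [nm|mn] := leqP n m; last first.
    have y0 : y (pt b m) = 0.
      by have := first_partE a y b m; rewrite ya => ->; case: ifP => // /andP[_ /eqP ->]; exact: ylt.
    rewrite y0 big1 // => i _; have im : (i < n)%N.
      exact: leq_ltn_trans (leq_ord i) mn.
    by rewrite pE (ltn_eqF im) mulr0.
  have hn : (n < m.+1)%N by lia.
  rewrite (bigD1 (Ordinal hn)) // pE eqxx big1 => [|i]; last first.
    by rewrite -val_eqE pE /= => /negbTE ->; rewrite mulr0.
  rewrite /= uE addr0; case: (b =P a) => [->|/eqP/negbTE ba].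
    by rewrite eqxx orbT mulr1; have -> : (n + (m - n) = m)%N by lia.
  by rewrite mulr0 -ya first_partE ba andbF.
have [u zE ul] := part z za zlt; have [w xE _] := part x xa xlt.
have [v vu] := unit_inverse zn ul.
by exists (w * v); rewrite xE zE mulrA -[w * v * u]mulrA vu mulr1.
Qed.

Lemma uniserial_gen a (S : submodule G^o) : (forall x, S x -> first_part a x = x) ->
  (forall x, S x -> x = 0) \/ exists z n, [/\ S z, z (pt a n) != 0 &
    forall x i, S x -> (i < n)%N -> x (pt a i) = 0].
Proof.
move=> hS.
have [[z [i [Sz zi]]]|h] := EM (exists z i, S z /\ (z : G) (pt a i) != 0); [right|left].
  have ex : exists i, `[< exists z, S z /\ (z : G) (pt a i) != 0 >].
    by exists i; apply/asboolP; exists z.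
  case: (ex_minnP ex) => n /asboolP[w [Sw wn]] nmin; exists w, n; split=> // x j Sx jn.
  apply/eqP; apply: contraTT jn => xj; rewrite -leqNgt; apply: nmin.
  by apply/asboolP; exists x.
move=> x Sx; apply: (@galg_extP Q hQ k) => b n; rewrite -[in LHS](hS x Sx) first_partE.
case: ifP => // /andP[_ /eqP ->]; apply/eqP/negPn/negP => xn.
by apply: h; exists x, n.
Qed.

Lemma first_partD a x y : first_part a (x + y) = first_part a x + first_part a y.
Proof.
apply: (@galg_extP Q hQ k) => b n; rewrite galg_addE !first_partE galg_addE.
by case: ifP => // _; rewrite addr0.
Qed.

Lemma last_partD a x y : last_part a (x + y) = last_part a x + last_part a y.
Proof.
apply: (@galg_extP Q hQ k) => b n; rewrite galg_addE !last_partE galg_addE.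
by case: ifP => // _; rewrite addr0.
Qed.

Lemma first_part0 a : first_part a 0 = 0.
Proof. by apply: (addrI (first_part a 0)); rewrite -first_partD !addr0. Qed.

Lemma last_part0 a : last_part a 0 = 0.
Proof. by apply: (addrI (last_part a 0)); rewrite -last_partD !addr0. Qed.

Lemma first_last_part a c x :
  first_part a (last_part c x) = last_part c (first_part a x).
Proof.
apply: (@galg_extP Q hQ k) => b n.
by rewrite first_partE !last_partE first_partE; do 2 case: ifP.
Qed.

Lemma first_part_idem a x : first_part a (first_part a x) = first_part a x.
Proof.
by apply: (@galg_extP Q hQ k) => b n; rewrite !first_partE; case: (_ && _).
Qed.

Lemma first_parts_eq0 x : in_rad x -> (forall a, first_part a x = 0) -> x = 0.
Proof.
move=> /in_radP hx h; apply: (@galg_extP Q hQ k) => b [|n]; first exact: hx.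
have := congr1 (fun f : G => f (pt b n.+1)) (h b); by rewrite first_partE eqxx andbT.
Qed.

Lemma fg_sub_ext (M : lmodType G) (S S' : submodule M) (z : M) :
  (forall m, S' m -> S m) -> S z -> (forall m, S m -> exists w, S' (m - w *: z)) ->
  fg_sub S' -> fg_sub S.
Proof.
move=> S'S Sz h [s hs]; exists (z :: s) => x; split=> [/h[w /hs hw]|[w /hs/S'S hw]].
  by exists w.
by rewrite -[x](subrK (w *: z)); apply: smemD => //; exact: smemZ.
Qed.

(** Induction on the arrows that occur as first arrows. The a-parts of P lie in a uniserial module,
    so one of them generates the others, and subtracting multiples of a lift of it leaves elements
    of P without a-part. *)
Lemma fg_sub_rad (P : submodule G^o) : (forall x, P x -> in_rad x) -> fg_sub P.
Proof.
have : exists s : seq E, forall x a, P x -> a \notin s -> first_part a x = 0.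
  by exists (enum E) => x a _; rewrite mem_enum.
move=> [s]; elim: s P => [|a s IH] P hs Prad.
  exists [::] => x; split=> [Px|->]; last exact: smem0.
  by apply: first_parts_eq0; [exact: Prad|move=> b; exact: hs].
have S0 : exists2 x : G, P x & first_part a x = 0.
  by exists 0; [exact: smem0|exact: first_part0].
have SP (w : G) (x y : G^o) : (exists2 x' : G, P x' & first_part a x' = x) ->
    (exists2 y' : G, P y' & first_part a y' = y) ->
    exists2 z : G, P z & first_part a z = (w *: x + y : G^o).
  move=> [x' Px' xx] [y' Py' yy]; exists ((w *: (x' : G^o) + y' : G^o) : G).
    exact: smemP.
  rewrite first_partD yy; congr (_ + _).
  by rewrite [LHS](@first_partM a w x' (Prad _ Px')) xx.
have T0 : P 0 /\ first_part a 0 = 0 by split; [exact: smem0|exact: first_part0].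
have TP (w : G) (x y : G^o) : P x /\ first_part a x = 0 -> P y /\ first_part a y = 0 ->
    P (w *: x + y) /\ first_part a (w *: x + y : G^o) = 0.
  move=> [Px x0] [Py y0]; split; first exact: smemP.
  rewrite first_partD y0 addr0 [LHS](@first_partM a w x (Prad _ Px)) x0.
  exact: mulr0.
have fgT : fg_sub (Submodule T0 TP).
  apply: IH => [x b [Px x0] bs|x [Px _]]; last exact: Prad.
  have [->//|ba] := eqVneq b a.
  by apply: hs => //; rewrite inE negb_or ba.
have [|h0|[z [n [[z' Pz' z'E] zn nmin]]]] := @uniserial_gen a (Submodule S0 SP).
- by move=> x [x' _ <-]; exact: first_part_idem.
- have [s' hs'] := fgT; exists s' => x; split=> [Px|/hs'[]//].
  by apply/hs'; split=> //; apply: (h0 (first_part a x)); exists x.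
apply: (@fg_sub_ext G^o P (Submodule T0 TP) z' _ _ _ fgT) => [x []|//|x Px] //.
have [|||w xw] := @uniserial a n (first_part a x) z (first_part_idem a x) _ zn.
- by rewrite -z'E first_part_idem.
- by move=> i h; apply: nmin h; exists z'.
- by move=> i h; apply: nmin h; exists x.
exists w; split; first by apply: smemB => //; exact: smemZ.
have e : first_part a (w * z') = first_part a x.
  by rewrite first_partM ?z'E //; exact: Prad.
apply: (addIr (first_part a (w * z'))); rewrite -first_partD add0r e.
by congr first_part; exact: subrK.
Qed.

Definition triv (v : V) : nzpath Q := exist (fun u => is_nzpath u) (v, [::]) isT.

(** Induction on the vertices whose trivial path occurs: one element with a nonzero coefficient
    there clears that coefficient from the others by scalars, until a submodule of the radical is
    left. *)
Lemma galg_noetherian : noetherian G.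
Proof.
move=> S; have : exists s : seq V, forall x v, S x -> v \notin s -> (x : G) (triv v) = 0.
  by exists (enum V) => x v _; rewrite mem_enum.
move=> [s]; elim: s S => [|v s IH] S hs.
  apply: fg_sub_rad => x Sx p p0.
  have -> : p = triv (val p).1 by apply: val_inj => /=; case: p p0 => [[? []]].
  exact: hs.
have [[z Sz zv]|h] := EM (exists2 z : G, S z & z (triv v) != 0); last first.
  apply: IH => x w Sx ws; have [->|wv] := eqVneq w v.
    by apply/eqP/negPn/negP => xv; apply: h; exists x.
  by apply: hs => //; rewrite inE negb_or wv.
have T0 : S 0 /\ (0 : G) (triv v) = 0 by split => //; exact: smem0.
have trivM (x y : G) w : (x * y) (triv w) = x (triv w) * y (triv w).
  rewrite galg_mulE big_ord1; congr (x _ * y _); exact: val_inj.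
have TP (w : G) (x y : G^o) : S x /\ (x : G) (triv v) = 0 -> S y /\ (y : G) (triv v) = 0 ->
    S (w *: x + y) /\ (w *: x + y : G) (triv v) = 0.
  move=> [Sx x0] [Sy y0]; split; first exact: smemP.
  by rewrite galg_addE y0 addr0 [LHS]trivM x0 mulr0.
apply: (@fg_sub_ext G^o S (Submodule T0 TP) z) => [x []//|//|x Sx|].
  exists (galg_scalar Q ((x : G) (triv v) / z (triv v))); split.
    by apply: smemB => //; exact: smemZ.
  by rewrite galg_addE galg_oppE [X in _ - X]galg_scalarE divfK // subrr.
apply: IH => x w [Sx x0] ws; have [->//|wv] := eqVneq w v.
by apply: hs => //; rewrite inE negb_or wv.
Qed.

(** A relation with a coefficient outside the radical could be solved for one generator,
    contradicting minimality. *)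
Lemma mincover_rad (M : lmodType G) r (v : 'I_r -> V) (m : 'I_r -> M) (f : 'rV[G]_r) :
  mincover (@idem Q k) v m -> pv_mem (@idem Q k) v f -> \sum_j f 0 j *: m j = 0 ->
  forall j, in_rad (f 0 j).
Proof.
move=> [[me mg] mmin] fv f0 j; apply/in_radP => a.
have [//|fa] := eqVneq ((f 0 j) (pt a 0)) 0; exfalso.
case: r v m f me mg mmin fv f0 j fa => [v m f _ _ _ _ _ []//|r] v m f me mg mmin fv f0 j fa.
pose w := v j; have sa : src a = w.
  by apply/eqP; apply: contraNT fa => /negbTE sa; rewrite -fv mul_idemE sa.
pose u : G := idem k w * f 0 j; pose l := (f 0 j) (pt a 0).
(* The element u has the coefficient l on the trivial path at w and 0 on the others; adding l at the
   other vertices makes it left invertible. *)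
have [p p0|y yu] := @unit_inverse Q k (u + galg_scalar Q l * (1 - idem k w)) l fa.
  have [b ->] := nzpath_ptraj hQ p; rewrite p0 galg_addE [X in _ + X]galg_scalarE.
  rewrite /u idem_mulE galg_addE galg_oppE idemE /=.
  case: eqP => [sb|_]; last by rewrite add0r subr0 mulr1.
  by rewrite subrr mulr0 addr0 /l (@ptraj0 _ hQ b a) // sb.
have ue : u * idem k w = u by rewrite /u -mulrA fv.
have uE : (u + galg_scalar Q l * (1 - idem k w)) * idem k w = u.
  by rewrite mulrDl ue -mulrA mulrBl mul1r (idem_idem hQ) (subrr (idem k w)) mulr0 addr0.
have yuw : y * u = idem k w by rewrite -[X in y * X]uE mulrA yu mul1r.
have mj : m j = \sum_(i < r) (- (y * (idem k w * f 0 (lift j i)))) *: m (lift j i).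
  rewrite -[LHS]me -/w -[in LHS]yuw.
  have := congr1 (fun z : M => (y * idem k w) *: z) f0.
  rewrite scaler0 (bigD1_ord j) //= scalerDr scalerA -mulrA => /eqP.
  rewrite addr_eq0 => /eqP ->; rewrite scaler_sumr -sumrN; apply: eq_bigr => i _.
  by rewrite scalerA scaleNr !mulrA.
have := mmin r (fun i => v (lift j i)) (fun i => m (lift j i)); rewrite ltnn.
move=> h; suff : false by []; apply: h; split=> // z.
have [b ->] := mg z.
exists (fun i => b (lift j i) + b j * (- (y * (idem k w * f 0 (lift j i))))).
rewrite (bigD1_ord j) //= [m j]mj scaler_sumr -big_split /=; apply: eq_bigr => i _.
by rewrite scalerDl scalerA addrC.
Qed.

End Uniserial.

(** * Classification of the indecomposable objects *)

Section ProductComplex.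
Variables (k : fieldType) (A : pzRingType) (iota : central_morph k A).
Variables X Y : bcplx A.

Definition prod_dif n (z : X n * Y n) : X (n + 1) * Y (n + 1) :=
  (cdif X n z.1, cdif Y n z.2).
Fact prod_dif_linear n : linear (@prod_dif n).
Proof. by move=> a x y; apply/pair_equal_spec; split; rewrite /= linearP. Qed.

Definition prod_cplx : cplx A.
Proof.
exists (fun n => (X n * Y n)%type : lmodType A) (fun n => mklin (@prod_dif_linear n)) => n x.
by apply/pair_equal_spec; split; rewrite /= cdif2.
Defined.

Definition prod_bcplx : bcplx A.
Proof.
exists prod_cplx; last by move=> n; apply: fin_gen_prod; exact: bc_fg.
have [a ha] := bc_bounded X; have [b hb] := bc_bounded Y.
exists (a + b)%N => n h [x y]; rewrite (ha n _ x); last by lia.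
by rewrite (hb n _ y) //; lia.
Defined.

Fact prod_inl_linear n : linear (fun x : X n => (x, 0) : prod_cplx n).
Proof. by move=> a x y; apply/pair_equal_spec; split; rewrite /= ?scaler0 ?addr0. Qed.
Definition prod_inl : chmap X prod_bcplx.
Proof.
exists (fun n => mklin (@prod_inl_linear n)) => n x.
by apply/pair_equal_spec; split; rewrite /= ?cdif0.
Defined.

Fact prod_inr_linear n : linear (fun x : Y n => (0, x) : prod_cplx n).
Proof. by move=> a x y; apply/pair_equal_spec; split; rewrite /= ?scaler0 ?addr0. Qed.
Definition prod_inr : chmap Y prod_bcplx.
Proof.
exists (fun n => mklin (@prod_inr_linear n)) => n x.
by apply/pair_equal_spec; split; rewrite /= ?cdif0.
Defined.

Fact prod_fst_linear n : linear (fun z : prod_cplx n => z.1 : X n).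
Proof. by []. Qed.
Definition prod_fst : chmap prod_bcplx X.
Proof. by exists (fun n => mklin (@prod_fst_linear n)) => n x. Defined.

Fact prod_snd_linear n : linear (fun z : prod_cplx n => z.2 : Y n).
Proof. by []. Qed.
Definition prod_snd : chmap prod_bcplx Y.
Proof. by exists (fun n => mklin (@prod_snd_linear n)) => n x. Defined.

Lemma prod_biproduct : is_biproduct (X : sing_cat iota) (Y : sing_cat iota)
  (prod_bcplx : sing_cat iota).
Proof.
have H : is_biproduct (X : homotopy_cat iota) (Y : homotopy_cat iota)
    (prod_bcplx : homotopy_cat iota).
  exists prod_inl, prod_inr, prod_fst, prod_snd.
  split; apply: homotopic_ext => n x //=.
  case: x => a b; rewrite /= -[RHS]/(a, b).
  by apply/pair_equal_spec; split; rewrite /= ?addr0 ?add0r.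
exact: (fmap_biproduct (sing_fun iota) (fmap_biproduct (loc_fun _) H)).
Qed.

Variables (Z : bcplx A) (f : chmap X Z) (g : chmap Y Z).

Fact prod_sum_linear n : linear (fun z : prod_cplx n => f n z.1 + g n z.2 : Z n).
Proof. by move=> a x y; rewrite /= !linearP /= scalerDr addrACA. Qed.
Definition prod_sum : chmap prod_bcplx Z.
Proof.
exists (fun n => mklin (@prod_sum_linear n)) => n x.
by rewrite /= !cmapP raddfD.
Defined.

Lemma biproduct_split :
  (forall n z, exists x y, z = f n x + g n y) ->
  (forall n x y, f n x + g n y = 0 -> x = 0 /\ y = 0) ->
  is_biproduct (X : sing_cat iota) (Y : sing_cat iota) (Z : sing_cat iota).
Proof.
move=> surj inj; apply: biproduct_iso prod_biproduct.
exists (sing_map iota prod_sum); apply: sing_map_qiso.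
have inj' n (z : prod_cplx n) : prod_sum n z = 0 -> z = 0.
  by case: z => x y /inj[/= -> ->].
split=> n.
  move=> x dx [z xz]; have [a [b zE]] := surj n z; exists (a, b).
  apply/eqP; rewrite -subr_eq0; apply/eqP; apply: inj'.
  transitivity (prod_sum (n + 1) x - prod_sum (n + 1) (cdif prod_cplx n (a, b))).
    exact: raddfB.
  by rewrite cmapP xz zE subrr.
move=> z dz; have [a [b zE]] := surj (n + 1) z; exists (a, b), 0.
rewrite raddf0 addr0; split=> //; apply: inj'.
by rewrite cmapP /= -zE.
Qed.

End ProductComplex.

Lemma fam_update (T : int -> Type) (d : forall n, T n) n (x : T n) :
  exists f : forall i, T i, f n = x /\ forall i, i != n -> f i = d i.
Proof.
exists (fun i => if n =P i is ReflectT e then ecast j (T j) e x else d i); split.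
  by case: eqP => // e; rewrite (eq_irrelevance e erefl).
by move=> i ni; case: eqP => // e; rewrite e eqxx in ni.
Qed.

Section Classification.
Variables (Q : bound_quiver) (hQ : gentle Q) (k : fieldType).
Notation E := (arr Q).
Local Notation G := (gentle_alg Q k).
Local Notation ar := (arrow_elt k).
Local Notation Dk := (sing_cat (galg_k Q k)).
Local Notation idem := (@idem Q k).
Implicit Types (c : E).

Section OneArrow.
Variables (Y : bcplx G) (n : int) (z : forall i, Y i) (c : E).
Hypothesis Y0 : forall i (y : Y i), i != n -> y = 0.
Hypothesis Yz : forall i (y : Y i), exists w, y = w *: z i.
Hypothesis ez : idem (tgt c) *: z n = z n.
Hypothesis zann : forall w, w *: z n = 0 <-> w * ar c = 0.

(** Here Y is A c in degree n. A single complex serves both objects: its truncation to [-|n|, |n|]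
    is isomorphic in the singularity category to A b_0 in degree 0 and to A b_n in degree n. *)
Lemma one_arrow_cycle (b : int -> E) (bz : forall i, zstep (b (i + 1)) (b i)) :
  b n = c -> isomorphic (L k (b 0) : Dk) (Y : Dk).
Proof.
move=> bn.
pose t := arrow_twist hQ k no_sign bz.
have tL : left_exact t := @arrow_twist_left _ _ _ _ _ _.
have xe i : te t i *: z i = z i.
  have [->|/Y0 h] := eqVneq i n; first by rewrite /= bn ez.
  by rewrite (h (z i)) scaler0.
have xd i : cdif Y i (z i) = tu t i *: z (i + 1).
  have [h|/Y0 h] := eqVneq (i + 1) n; last by rewrite [LHS]h (h (z _)) scaler0.
  rewrite (Y0 (z i)) ?cdif0; last by lia.
  apply/esym; rewrite h; apply/zann; rewrite -bn -h /=.
  exact: (arrow_zmul hQ k (bz i)).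
pose x : tcocycle t Y := TCocycle xe xd.
have hN : bounds Y `|n|%N by move=> i h y; apply: Y0; lia.
apply: (@isomorphic_trans _ Dk _ (res_cplx t `|n|%N : Dk)).
  apply: isomorphic_sym; exists (sing_map _ (phi (@Lst_bounds _ _ _) (lcoc (arrow_twist_e0 hQ k no_sign bz) (arrow_twist_u0 hQ k no_sign bz)))).
  by apply: Lst_iso => //; exact: arrow_twist_ann.
exists (sing_map (galg_k Q k) (phi hN x)); apply: (@trunc_act_iso _ _ _ _ _ _ _ _ _ n).
- by lia.
- exact: Y0.
- by move=> i y _; exact: Yz.
- move=> y i h ye yx.
  have yu : y * tu t (i + 1) = 0 by rewrite /= h bn; apply/zann; rewrite -h.
  by split=> //; exact: tL ye yu.
- by move=> y i _; exact: tL.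
Qed.

(** The zero relations following c stop after l steps, at an arrow whose right multiplication is
    injective on the projective at its target; so Y has a finite projective resolution. *)
Lemma one_arrow_not_cycle : ~ on_diff_cycle c -> is_zero (Y : Dk).
Proof.
move=> /(not_diff_cycle hQ)[l [d [d0 dz dl]]].
pose lo (i : int) := (n - l%:Z <= i) && (i <= n).
pose b (i : int) := d (absz (n - i)).
have bz (i : int) : lo i -> lo (i + 1) -> zstep (b (i + 1)) (b i).
  rewrite /lo /b => h h'; have -> : absz (n - i)%R = (absz (n - (i + 1))%R).+1 by lia.
  by apply: dz; lia.
(* The twist is zero outside the degrees from n - l to n, so the truncation at n - l has zero end
   term. *)
pose te' (i : int) : G := if lo i then idem (tgt (b i)) else 0.
pose tu' (i : int) : G := if lo i && lo (i + 1) then ar (b i) else 0.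
have h1 i : te' i * te' i = te' i by rewrite /te'; case: ifP; rewrite ?mulr0 // idem_idem.
have h2 i : te' i * tu' i = tu' i.
  rewrite /te' /tu'; case: (lo i) => /=; last by rewrite mul0r.
  by case: ifP => _; [exact: idem_arrow|exact: mulr0].
have h3 i : tu' i * te' (i + 1) = tu' i.
  rewrite /te' /tu'; case: ifP => [/andP[l1 l2]|_]; last by rewrite mul0r.
  by rewrite l2; have /andP[/eqP <- _] := bz i l1 l2; exact: arrow_idem.
have h4 i : tu' i * tu' (i + 1) = 0.
  rewrite /tu'; case: ifP => [/andP[l1 l2]|_]; last by rewrite mul0r.
  by case: ifP => _; rewrite ?mulr0 // (arrow_zmul hQ k (bz i l1 l2)).
pose t := Twist h1 h2 h3 h4.
have bn : b n = c by rewrite /b subrr.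
have lon : lo n by rewrite /lo; lia.
have xe i : te t i *: z i = z i.
  have [->|/Y0 h] := eqVneq i n; first by rewrite /= /te' lon bn ez.
  by rewrite (h (z i)) scaler0.
have xd i : cdif Y i (z i) = tu t i *: z (i + 1).
  have [h|/Y0 h] := eqVneq (i + 1) n; last by rewrite [LHS]h (h (z _)) scaler0.
  rewrite (Y0 (z i)) ?cdif0; last by lia.
  apply/esym; rewrite h /= /tu'; case: ifP => [/andP[l1 l2]|_]; last by rewrite scale0r.
  by apply/zann; have := bz i l1 l2; rewrite h bn => /(arrow_zmul hQ k).
pose x : tcocycle t Y := TCocycle xe xd.
have ex i y : lo (i + 1) -> y * te t (i + 1) = y -> y * ar (b (i + 1)) = 0 ->
    exists w, y = w * tu t i.
  move=> l2; rewrite /= /te' /tu' l2 andbT => ye yb.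
  have [l1|l1] := boolP (lo i); first exact: left_exact_arrow (bz i l1 l2) ye yb.
  have bl : b (i + 1) = d l by rewrite /b; congr d; move: l1 l2; rewrite /lo; lia.
  move: ye yb; rewrite bl => ye yb.
  by exists 0; rewrite mul0r; exact: (left_exact_last hQ dl ye yb).
have an : n - l%:Z <= n by lia.
apply: perfect_is_zero; apply: (@trunc_perfect _ _ _ t (n - l%:Z) n an Y x n) => //.
- move=> y i h ye yx; have yc : y * ar (b (i + 1)) = 0 by rewrite h bn; apply/zann; rewrite -h.
  split; last by apply: ex => //; rewrite h.
  rewrite /= /tu' h; case: ifP => [/andP[_]|_]; last exact: mulr0.
  by rewrite /lo; lia.
- move=> y i h ye yu; have [l2|l2] := boolP (lo (i + 1)); last first.
    by exists 0; rewrite mul0r -ye /= /te' (negbTE l2) mulr0.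
  apply: ex => //; move: yu; rewrite /= /tu' l2 /= ifT //.
  by move: l2; rewrite /lo; lia.
- move=> i h; rewrite /= /tu' ifN // negb_and; apply/orP; left.
  by rewrite /lo; lia.
Qed.

End OneArrow.

End Classification.

Section ClassifyAll.
Variables (Q : bound_quiver) (hQ : gentle Q) (k : fieldType).
Notation E := (arr Q).
Local Notation G := (gentle_alg Q k).
Local Notation sg := (@sigma Q).
Local Notation ar := (arrow_elt k).
Local Notation pt := (ptraj hQ).
Local Notation Dk := (sing_cat (galg_k Q k)).
Implicit Types (c : E).

(** All paths occurring in x end with c, hence are continued by [sigma c]. By induction on m, the
    coefficient of w x on the path of length n + m from a is the leading coefficient of x times that
    of w on the path of length m beginning with [sigma c]. *)
Lemma lead_ann a n (x w : G) c : first_part a x = x -> last_part c x = x ->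
  x (pt a n) != 0 -> (forall i, (i < n)%N -> x (pt a i) = 0) ->
  w * x = 0 -> w * ar c = 0.
Proof.
move=> xa xc xn xlt wx.
have cE i : x (pt a i) != 0 -> i != 0%N /\ sg c = iter i sg a.
  rewrite -xc last_partE; case: ifP; last by rewrite eqxx.
  by move=> /andP[i0 /eqP <-] _; case: i i0.
have [n0 nE] := cE n xn.
have wc m : w (pt (sg c) m) = 0.
  have [m' ] := ubnP m; elim: m' m => // m' IH m; rewrite ltnS => mm'.
  have := congr1 (fun f : G => f (pt a (n + m)%N)) wx.
  rewrite galg_mul_ptraj; have hn : (n < (n + m).+1)%N by lia.
  rewrite (bigD1 (Ordinal hn)) //= big1 => [|i ni].
    rewrite addr0 -nE addKn => /eqP; rewrite mulf_eq0 (negbTE xn) orbF.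
    by move/eqP.
  have [->|xi] := eqVneq (x (pt a i)) 0; first exact: mulr0.
  have [_ <-] := cE _ xi.
  have hi : (n < i)%N.
    rewrite ltn_neqAle eq_sym; move: ni; rewrite -val_eqE /= => -> /=.
    by rewrite leqNgt; apply: contraNN xi => /xlt ->.
  by rewrite IH ?mul0r //; have := ltn_ord i; lia.
apply: (@galg_extP Q hQ k) => b m; rewrite mul_arrowE.
by case: ifP => // /andP[_ /eqP ->]; rewrite wc.
Qed.

(* The maps kap j embed Y in a sum of uniserial modules A (al j), and Y is stable
   under the projections [last_part c]: a lowest-order element of the last
   component then generates a direct summand isomorphic to some A c. *)
Lemma classify_ind (m : nat) (Y : bcplx G) (n : int) (al : nat -> E)
    (kap : nat -> forall i, {linear Y i -> G^o}) :
  (forall i (y : Y i), i != n -> y = 0) ->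
  (forall j i y, (j < m)%N -> first_part (al j) (kap j i y) = kap j i y) ->
  (forall i y, (forall j, (j < m)%N -> kap j i y = 0) -> y = 0) ->
  (forall i y c, exists y', forall j, (j < m)%N ->
    kap j i y' = last_part c (kap j i y)) ->
  indecomposable (Y : Dk) ->
  exists2 a : E, on_diff_cycle a & isomorphic (L k a : Dk) (Y : Dk).
Proof.
elim: m Y al kap => [|m IH] Y al kap Y0 H1 H2 H3 indY.
  by case: indY => Yn0 _; case: Yn0; apply: sing_map_zero => i y; exact: H2.
have [km|km] := EM (forall i y, kap m i y = 0).
  apply: (IH Y al kap) => //.
  - by move=> j i y jm; apply: H1; exact: ltnW.
  - move=> i y h; apply: H2 => j; rewrite ltnS leq_eqVlt => /orP[/eqP ->|/h //].
    exact: km.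
  - move=> i y c; have [y' hy'] := H3 i y c; exists y' => j jm.
    by apply: hy'; exact: ltnW.
have ex : exists i, `[< exists y : Y n, (kap m n y : G) (pt (al m) i) != 0 >].
  apply: contrapT => h; apply: km => i y; have [e|ni] := eqVneq i n; last first.
    by rewrite (Y0 i y ni) raddf0.
  subst i.
  rewrite -[LHS](H1 m n y (ltnSn m)); apply: (@galg_extP Q hQ k) => b j.
  rewrite first_partE; case: ifP => // /andP[_ /eqP ->].
  by apply/eqP/negPn/negP => hj; apply: h; exists j; apply/asboolP; exists y.
case: (ex_minnP ex) => i0 /asboolP[y yi0] i0min.
have ylt (x : Y n) i : (i < i0)%N -> (kap m n x : G) (pt (al m) i) = 0.
  move=> ii; apply/eqP; apply: contraTT ii => xi; rewrite -leqNgt; apply: i0min.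
  by apply/asboolP; exists x.
have i00 : i0 != 0%N.
  by apply: contraNneq yi0 => ->; rewrite -(H1 m n y) // first_partE.
(* The last arrow of the leading path of y. Passing to the c-part z of y keeps the leading term and
   puts all coordinates into c A, so z has the same annihilator as c. *)
pose c := iter i0.-1 sg (al m).
have [z zE] := H3 n y c.
have zi0 : (kap m n z : G) (pt (al m) i0) != 0.
  by rewrite zE // last_partE i00 eqxx.
have lpart2 (x : G) : last_part c (last_part c x) = last_part c x.
  by apply: (@galg_extP Q hQ k) => b j; rewrite !last_partE; case: (_ && _).
have ann1 (w : G) : kap m n (w *: z) = 0 -> w * ar c = 0.
  rewrite linearZ /= => wz; apply: (@lead_ann (al m) i0 (kap m n z) w c) wz => //.
  - exact: H1.
  - by rewrite zE.
  - by move=> i; exact: ylt.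
have ann2 (w : G) : w * ar c = 0 -> w *: z = 0.
  move=> wc; apply: H2 => j jm; rewrite linearZ /= zE //.
  have [x ->] := last_part_arrow hQ c (kap j n y).
  by rewrite regular_scaleE mulrA wc mul0r.
have ez : idem k (tgt c) *: z = z.
  apply/eqP; rewrite -subr_eq0; apply/eqP; apply: H2 => j jm.
  rewrite raddfB /= linearZ /= zE // regular_scaleE idem_last_part // subrr //.
have [zz [zzn zz0]] := @fam_update (fun i => Y i) (fun i => 0) n z.
have d0 i (x : Y i) : cdif Y i x = 0.
  have [e|ni] := eqVneq i n; last by rewrite (Y0 i x ni) cdif0.
  by apply: Y0; lia.
have S10 i : kap m i 0 = 0 by exact: raddf0.
have S1P i (w : G) x x' : kap m i x = 0 -> kap m i x' = 0 -> kap m i (w *: x + x') = 0.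
  by move=> h h'; rewrite linearP h h' addr0 scaler0.
pose S1 i := Submodule (S10 i) (S1P i).
have S1d i x : S1 i x -> S1 (i + 1) (cdif Y i x) by move=> _; rewrite d0; exact: S10.
have Sz0 i : exists w : G, 0 = w *: zz i by exists 0; rewrite scale0r.
have SzP i (w : G) x x' : (exists w : G, x = w *: zz i) -> (exists w : G, x' = w *: zz i) ->
    exists w' : G, w *: x + x' = w' *: zz i.
  by move=> [u ->] [u' ->]; exists (w * u + u'); rewrite scalerDl scalerA.
pose Sz i := Submodule (Sz0 i) (SzP i).
have Szd i x : Sz i x -> Sz (i + 1) (cdif Y i x) by move=> _; rewrite d0; exact: Sz0.
pose Y1 := sub_bcplx (@galg_noetherian Q hQ k : noetherian G) S1d.
pose Yz := sub_bcplx (@galg_noetherian Q hQ k : noetherian G) Szd.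
(* Y is the direct sum of A z and the kernel of [kap m]: this coordinate has values in a uniserial
   module, where the image of z has the lowest order, and it is injective on A z. *)
have bip : is_biproduct (Yz : Dk) (Y1 : Dk) (Y : Dk).
  have surj i (x : Y i) : exists (x1 : Yz i) (x2 : Y1 i),
      x = (sub_cplx_incl Szd : chmap Yz Y) i x1 + (sub_cplx_incl S1d : chmap Y1 Y) i x2.
    have [w hw] : exists w : G, kap m i (x - w *: zz i) = 0.
      move: x; have [->|ni] := eqVneq i n => x; last first.
        by exists 0; rewrite (Y0 i (x - _) ni) raddf0.
      have [|||||w xw] := @uniserial Q hQ k (al m) i0 (kap m n x) (kap m n z).
      - exact: H1.
      - exact: H1.
      - exact: zi0.
      - by move=> i' /ylt.
      - by move=> i' /ylt.
      exists w; rewrite raddfB /= zzn linearZ /= regular_scaleE.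
      by rewrite [X in X - _]xw; exact: subrr.
    have hz : Sz i (w *: zz i) by exists w.
    by exists (sub_mk hz), (sub_mk (hw : S1 i _)); rewrite /= subrKC.
  apply: (biproduct_split (galg_k Q k) surj) => i x x1 e.
  have x1E : sub_val x1 = - sub_val x.
    by apply: (addrI (sub_val x)); rewrite e subrr.
  have [w xw] := sub_ofP x; have := sub_ofP x1; rewrite /= x1E raddfN xw => /eqP.
  rewrite oppr_eq0 => /eqP kz.
  suff x0 : sub_val x = 0.
    by split; apply: val_inj => //; rewrite [LHS]x1E x0 oppr0.
  rewrite xw; move: kz; have [->|ni _] := eqVneq i n; last by rewrite zz0 ?scaler0.
  by rewrite zzn => /ann1/ann2.
have [Yn0 /(_ _ _ bip)[zz1|z1]] := indY.
  have iso1 := biproduct_zero bip zz1.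
  have [|||||a ad aY1] := IH Y1 al (fun j i => kap j i \o sub_incl (S1 i)); last first.
  - by exists a => //; exact: isomorphic_trans aY1 iso1.
  - exact: indecomposable_iso (isomorphic_sym iso1) indY.
  - move=> i x c'; have [y' hy'] := H3 i (sub_val x) c'.
    have y'S : S1 i y' by rewrite /S1 /= hy' // (sub_ofP x); exact: last_part0.
    by exists (sub_mk y'S) => j jm /=; apply: hy'; exact: ltnW.
  - move=> i x h; apply: val_inj; apply: H2 => j; rewrite ltnS leq_eqVlt.
    by case/orP => [/eqP ->|/h //]; exact: (sub_ofP (x : sub_of (S1 i))).
  - by move=> j i x jm; apply: H1; exact: ltnW.
  - by move=> i x ni; apply: val_inj; exact: Y0.
have isoz := biproduct_zero (biproductC bip) z1.
have zzS i : Sz i (zz i) by exists 1; rewrite scale1r.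
have [c_dc|c_dc] := EM (on_diff_cycle c); last first.
  case: Yn0; apply: is_zero_iso isoz _.
  apply: (@one_arrow_not_cycle _ hQ k Yz n (fun i => sub_mk (zzS i)) c) => //.
  - by move=> i x ni; apply: val_inj; exact: Y0.
  - by move=> i x; have [w xw] := sub_ofP x; exists w; apply: val_inj.
  - by apply: val_inj; rewrite /= zzn.
  - move=> w; split=> [/(congr1 val) /= |wc]; last by apply: val_inj; rewrite /= zzn ann2.
    by rewrite zzn => wz; apply: ann1; rewrite wz raddf0.
have [b [bn bz bd]] := diff_seq n c_dc.
exists (b 0) => //; apply: isomorphic_trans isoz.
apply: (@one_arrow_cycle _ hQ k Yz n (fun i => sub_mk (zzS i)) c _ _ _ _ b bz bn).
- by move=> i x ni; apply: val_inj; exact: Y0.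
- by move=> i x; have [w xw] := sub_ofP x; exists w; apply: val_inj.
- by apply: val_inj; rewrite /= zzn.
- move=> w; split=> [/(congr1 val) /= |wc]; last by apply: val_inj; rewrite /= zzn ann2.
  by rewrite zzn => wz; apply: ann1; rewrite wz raddf0.
Qed.

End ClassifyAll.

Section Objects.
Variables (Q : bound_quiver) (hQ : gentle Q) (k : fieldType).
Notation E := (arr Q).
Local Notation G := (gentle_alg Q k).
Local Notation Dk := (sing_cat (galg_k Q k)).

Lemma classify (X : Dk) : indecomposable X ->
  exists2 a : E, on_diff_cycle a & isomorphic (L k a : Dk) X.
Proof.
move=> indX; have An : noetherian G := @galg_noetherian Q hQ k.
have ee := @idem_idem Q hQ k; have e1 := @sum_idem Q hQ k.
have [m [X1 [XX1 X1c]]] := concentrate (galg_k Q k) ee e1 An X.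
pose n := m - 2.
have [|X2 [X12 X2hi X2lo X2m]] := step (galg_k Q k) ee e1 An (n := n + 1) (X := X1).
  by move=> i x h; apply: X1c; lia.
have [|r1 [v1 [x1 [_ [i1 [i1inj _]]]]]] := X2m; first by move=> x; apply: X1c; lia.
have [|X3 [X23 X3hi X3lo X3m]] := step (galg_k Q k) ee e1 An (n := n) (X := X2).
  by move=> i x; exact: X2hi.
have [|r [v [x [xcov [i2 [i2inj i2im]]]]]] := X3m.
  by move=> y; apply: X2lo => [|z]; [lia|apply: X1c; lia].
have X30 i (y : X3 i) : i != n -> y = 0.
  move=> ni; have [h|h] := ltP n i; first exact: X3hi.
  apply: X3lo => [|z]; first by lia.
  by apply: X2lo => [|w]; [lia|apply: X1c; lia].
have XX3 : isomorphic X (X3 : Dk).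
  exact: isomorphic_trans XX1 (isomorphic_trans X12 X23).
have indX3 := indecomposable_iso XX3 indX.
have i2P y : pv_mem (@idem Q k) v (i2 y) /\ \sum_j (i2 y) 0 j *: x j = 0.
  by apply/i2im; exists y.
have i2rad y j : in_rad ((i2 y) 0 j : G).
  by have [h1 h2] := i2P y; exact: (mincover_rad hQ xcov h1 h2).
have i20 y : (forall j a, first_part a ((i2 y) 0 j) = 0) -> y = 0.
  move=> h; apply: i2inj; rewrite raddf0; apply/rowP => j; rewrite mxE.
  by apply: (first_parts_eq0 hQ).
(* Here the second syzygy matters: the x_j lie in a first syzygy, so by i1 a relation between them
   is an equation of rows over A, to which the right linearity of [last_part] on radical
   coefficients applies. *)
have i2last y c : exists y', i2 y' = \row_j last_part c ((i2 y) 0 j).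
  apply/i2im; have [h1 h2] := i2P y; split=> [j|].
    by rewrite mxE -(last_partM hQ) // h1.
  apply: i1inj; rewrite raddf0; apply/rowP => l; rewrite [RHS]mxE.
  transitivity (last_part c ((i1 (\sum_j (i2 y) 0 j *: x j)) 0 l)); last first.
    by rewrite h2 raddf0 mxE (last_part0 hQ).
  rewrite !linear_sum !summxE (big_morph (last_part c) (@last_partD _ hQ _ c) (last_part0 hQ k c)).
  apply: eq_bigr => j _; rewrite !linearZ !mxE.
  by rewrite [RHS](last_partM hQ).
have [[p0 _]|np] := EM (exists p : 'I_r * E, True); last first.
  case: indX3 => nz _; case: nz; apply: sing_map_zero => i y.
  have [e|/(X30 i y)//] := eqVneq i n; subst i; apply: i20 => j a.
  by case: np; exists (j, a).
pose p j := nth p0 (enum {: 'I_r * E}) j.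
have pl j : linear (fun y : X3 n => first_part (p j).2 ((i2 y) 0 (p j).1) : G^o).
  move=> w y z; rewrite linearP !mxE (first_partD hQ); congr (_ + _).
  by rewrite [LHS](first_partM hQ).
have [kap [kapn _]] := @fam_update (fun i => nat -> {linear X3 i -> G^o})
  (fun i j => \0) n (fun j => mklin (pl j)).
have [|j i y jm|i y h|i y c||a ad aX3] := @classify_ind Q hQ k
  (size (enum {: 'I_r * E})) X3 n (fun j => (p j).2) (fun j i => kap i j).
- exact: X30.
- have [e|ni] := eqVneq i n; last by rewrite (X30 i y ni) raddf0 (first_part0 hQ).
  by subst i; rewrite kapn; exact: first_part_idem.
- have [e|/(X30 i y)//] := eqVneq i n; subst i; apply: i20 => j a.
  have := h (index (j, a) (enum {: 'I_r * E})).
  rewrite index_mem mem_enum => /(_ isT); rewrite kapn /=.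
  by rewrite /p nth_index ?mem_enum.
- have [e|ni] := eqVneq i n; last first.
    by exists 0 => j _; rewrite (X30 i y ni) !raddf0 (last_part0 hQ).
  subst i; have [y' y'E] := i2last y c; exists y' => j _.
  by rewrite !kapn /= y'E mxE; exact: first_last_part.
- exact: indX3.
by exists a => //; exact: isomorphic_trans aX3 (isomorphic_sym XX3).
Qed.

Lemma hom_dim_L (a b : E) : on_diff_cycle a ->
  hom_dim (L k a : Dk) (L k b : Dk) (a == b).
Proof.
move=> /(diff_seq 0)[bs [ba bz _]]; have [<-|ab] := eqVneq a b.
  exact: (@hom_dim_L_eq Q hQ k a bs ba bz).
exact: (@hom_dim_L_neq Q hQ k a bs ba bz b ab).
Qed.

Lemma L_indecomposable (a : E) : on_diff_cycle a -> indecomposable (L k a : Dk).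
Proof. by move=> /(@hom_dim_L a a); rewrite eqxx; exact: indecomposable_hom_dim. Qed.

Lemma L_inj (a b : E) : on_diff_cycle a ->
  isomorphic (L k a : Dk) (L k b : Dk) -> a = b.
Proof.
move=> ad ab; have := @hom_dim_L a b ad; case: eqVneq => // _ h; exfalso.
have [nz _] := L_indecomposable ad; apply: nz; have [f [g [gf _]]] := ab.
by rewrite /is_zero -gf (hom_dim0 h f (hzero _ _)) hcompf0.
Qed.

(** The desuspension of A a lives in degree 1. With a at position 1 of the doubly infinite sequence,
    position 0 carries the arrow following a. *)
Lemma unshift_L (a r : E) : on_diff_cycle a -> zstep a r ->
  isomorphic (bunshift (L k a) : Dk) (L k r : Dk).
Proof.
move=> /(diff_seq 1)[b [ba bz _]] ar.
have -> : r = b 0 by apply: (zstep_uniq hQ ar); rewrite -ba; exact: bz.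
pose z := @stalk_elt G _ (lgen (arrow_elt k a)).
have gen i (y : stalk (left_ideal (arrow_elt k a)) i) : exists w : G, y = w *: z i.
  case: i y => [[|i]|i] y /=; last 2 first.
  - by exists 0; rewrite scale0r; exact: rV0_eq0.
  - by exists 0; rewrite scale0r; exact: rV0_eq0.
  by have [w yw] := left_idealP y; exists w; apply: val_inj.
apply: isomorphic_sym; apply: (@one_arrow_cycle Q hQ k (bunshift (L k a)) 1 ((fun i => z (i - 1)) : forall i, bunshift (L k a) i) a _ _ _ _ b bz ba).
- by move=> i y i1; apply: stalk_eq0; lia.
- by move=> i y; exact: gen.
- by apply: val_inj; exact: (idem_arrow hQ).
- move=> w; split=> [/(congr1 (fun y : left_ideal _ => lideal_val y : G))//|wa].
  by apply: val_inj.
Qed.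

End Objects.

(** * Derived tensor products with the dualising bimodule *)

Section TwistComplex.
Variables (A : pzRingType) (t : twist A).
Local Notation e := (te t).
Local Notation u := (tu t).
Local Notation lv x := (lideal_val x : A).

Fact tw_gw n : (e n * u n : A^o) \in lideal (e (n + 1)).
Proof. by apply/lidealP; exists (u n); rewrite teu tue. Qed.
Fact tw_gww n : e n * u n * u (n + 1) = 0.
Proof. by rewrite teu tuu. Qed.

Definition tw_cplx : cplx A := icplx tw_gw tw_gww.

Lemma tw_mem n (y : tw_cplx n) : lv y * e n = lv y.
Proof. by apply: left_ideal_idem; exact: te_idem. Qed.

Lemma tw_in n c : (c * e n : A^o) \in lideal (e n).
Proof. by apply/lidealP; exists c. Qed.

Lemma tw_fgproj : degreewise (@fg_projective A) tw_cplx.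
Proof. by move=> n; apply: left_ideal_fgproj; exact: te_idem. Qed.

Section Act.
Variables (X : cplx A) (x : tcocycle t X).

Fact tw_gx n : e n *: cdif X n (x n) = (e n * u n) *: x (n + 1).
Proof. by rewrite tc_d scalerA. Qed.
Definition tw_act : chmap tw_cplx X := iact tw_gw tw_gww tw_gx.

End Act.

Lemma tw_act_homotopic X (x y : tcocycle t X) : tceq x y -> homotopic (tw_act x) (tw_act y).
Proof.
move=> [h [h1 h2]].
pose s n (z : tw_cplx (n + 1)) : X n := (lv z : A) *: h n.
have sl n : linear (@s n) by move=> b y1 y2; rewrite /s /= scalerDl scalerA.
exists (fun n => mklin (@sl n)) => n z; rewrite /= /s /=.
by rewrite -scalerBr h2 scalerDr -linearZ /= scalerA.
Qed.

End TwistComplex.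

Section TwistQuasiIso.
Variables (k : fieldType) (A : pzRingType) (iota : central_morph k A).
Variable t : twist A.
Hypothesis t0 : forall n, 0 < n -> te t n = 0.
Local Notation e := (te t).
Local Notation u := (tu t).
Local Notation lv x := (lideal_val x : A).

Lemma tc_hi X (x : tcocycle t X) n : 0 < n -> x n = 0.
Proof. by move=> /t0 en; rewrite -tc_e en scale0r. Qed.

Lemma tw_bounded_above : bounded_above (tw_cplx t).
Proof. by exists 0 => n /t0 en x; exact: left_ideal0. Qed.

(** The twist vanishes in positive degrees, so the downward recursion on the acyclic cone can start
    at 0 although the complexes themselves may be unbounded. *)
Lemma tw_lift X Y (f : chmap X Y) (y : tcocycle t Y) : quasi_iso f ->
  exists x : tcocycle t X, tceq (tc_push f x) y.
Proof.
move=> /cone_acyclic acy; apply: tc_cone_surj => z.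
have [|h [h1 h2 _]] := @tc_acyclic A t _ z 0 acy; first exact: tc_hi.
by exists h.
Qed.

Lemma tw_lift_qiso X Y (f : chmap X Y) (x : tcocycle t X) (y : tcocycle t Y) :
  quasi_iso f -> tceq (tc_push f x) y -> quasi_iso (tw_act y) -> quasi_iso (tw_act x).
Proof.
move=> qf xy qy; apply: (quasi_iso_cancel qf).
apply: quasi_iso_homotopic qy; apply: homotopic_trans.
  by apply: homotopic_sym; exact: tw_act_homotopic xy.
by apply: homotopic_ext => n z /=; rewrite linearZ.
Qed.

Lemma tw_push_qiso X Y (f : chmap X Y) (x : tcocycle t X) :
  quasi_iso f -> quasi_iso (tw_act x) -> quasi_iso (tw_act (tc_push f x)).
Proof.
move=> qf qx; apply: quasi_iso_homotopic (quasi_iso_comp qf qx).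
by apply: homotopic_ext => n z /=; rewrite linearZ.
Qed.

Hypothesis tL : forall n x, n + 1 < 0 -> x * e (n + 1) = x -> x * u (n + 1) = 0 ->
  exists y, x = y * u n.

Lemma tw_qiso (Y : cplx A) (x : tcocycle t Y) :
  (forall n (y : Y n), n != 0 -> y = 0) ->
  (forall n (y : Y n), n = 0 -> exists b, y = b *: x n) ->
  (forall y n, n + 1 = 0 -> y * e (n + 1) = y -> y *: x (n + 1) = 0 ->
    exists z, y = z * u n) ->
  quasi_iso (tw_act x).
Proof.
move=> Y0 Yx xtop; split=> n y dy.
  move=> [z yz]; have [h|h] := ltP 0 (n + 1).
    by exists 0; rewrite cdif0; apply: left_ideal0; exact: t0.
  have ye := tw_mem y.
  have [w yw] : exists w, (lv y : A) = w * u n.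
    have [n0|n0] := eqVneq (n + 1) 0.
      apply: (xtop _ _ n0 ye); rewrite -[LHS]/(tw_act x (n + 1) y) yz.
      by rewrite (Y0 _ z) ?cdif0 //; lia.
    by apply: tL => //; [lia|exact: (congr1 val dy)].
  exists (LeftIdeal (tw_in t n w)); apply: val_inj.
  by rewrite /= yw -mulrA teu.
have [n0|n0] := eqVneq (n + 1) 0; last first.
  by exists 0, 0; rewrite !cdif0 raddf0 addr0; split=> //; exact: Y0.
have [b yb] := Yx _ y n0; exists (LeftIdeal (tw_in t (n + 1) b)), 0; split.
  by apply: left_ideal0; apply: t0; lia.
by rewrite cdif0 addr0 /= -scalerA tc_e.
Qed.

(** The resolution may be infinite to the left. Replacing it below -N by the image A u_(-N-1) keeps
    it a resolution, since X has no cohomology there. *)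
Lemma tw_phi_qiso (X : bcplx A) N (hN : bounds X N) (x : tcocycle t X) :
  quasi_iso (tw_act x) -> quasi_iso (phi hN x).
Proof.
move=> [qi qs]; have u0 n : 0 <= n -> u n = 0.
  by move=> n0; rewrite -tue t0 ?mulr0 //; lia.
split=> n y dy.
  move=> [z yz]; have [h|h] := boolP (- N%:Z <= n + 1 <= N%:Z); last first.
    exists 0; rewrite ?imul0 ?cdif0; have [h'|h'] := eqVneq (n + 1 + 1) (- N%:Z); last first.
      by apply: trunc_out; lia.
    apply: val_inj; have := congr1 (fun w : res_cplx t N _ => lv w) dy.
    by rewrite /= trunc_w_edge // mulr1.
  have ye : lv y * e (n + 1) = lv y := trunc_mem y h.
  have hy : (lv y : A^o) \in lideal (e (n + 1)) by apply/lidealP; exists (lv y).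
  have yu : lv y * u (n + 1) = 0.
    have [h'|h'] := ltP (n + 1) N%:Z; last by rewrite u0 ?mulr0 //; lia.
    have := congr1 (fun w : res_cplx t N _ => lv w) dy.
    by rewrite /= trunc_w_in //; lia.
  have [||w /(congr1 val) /= yw] := qi n (LeftIdeal hy).
  - exact: val_inj.
  - by exists z.
  have [h'|h'] := eqVneq (n + 1) (- N%:Z).
    exists (LeftIdeal (trunc_in_edge t N (lv w) h')); apply: val_inj.
    by rewrite /= trunc_w_edge // mulr1.
  have h2 : - N%:Z <= n <= N%:Z by lia.
  exists (LeftIdeal (trunc_in t (NN N) (lv w) h2)); apply: val_inj => /=.
  by rewrite trunc_w_in ?tw_mem //; lia.
have [h|h] := boolP (- N%:Z <= n + 1 <= N%:Z); last first.
  have -> : y = 0 by apply: (hN (n + 1)); lia.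
  by exists 0, 0; split; rewrite ?imul0 ?cdif0 ?raddf0 ?addr0.
have [w [z [dw ->]]] := qs n y dy.
exists (LeftIdeal (trunc_in t (NN N) (lv w) h)), z; split; last by rewrite /= tw_mem.
apply: val_inj; rewrite /= tw_mem /trunc_w ifN; last by lia.
by case: ifP => _; rewrite ?mulr0 //; exact: (congr1 val dw).
Qed.

Lemma tw_isomorphic (X Y : bcplx A) (x : tcocycle t X) (y : tcocycle t Y) :
  quasi_iso (tw_act x) -> quasi_iso (tw_act y) ->
  isomorphic (X : sing_cat iota) (Y : sing_cat iota).
Proof.
move=> qx qy; have [N hX] := bc_bounded X; have [M hY] := bc_bounded Y.
have hX' : bounds X (N + M)%N by move=> n nN; apply: hX; lia.
have hY' : bounds Y (N + M)%N by move=> n nN; apply: hY; lia.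
apply: (@isomorphic_trans _ _ _ (res_cplx t (N + M) : sing_cat iota)).
  apply: isomorphic_sym; exists (sing_map iota (phi hX' x)).
  by apply: sing_map_qiso; exact: tw_phi_qiso.
by exists (sing_map iota (phi hY' y)); apply: sing_map_qiso; exact: tw_phi_qiso.
Qed.

End TwistQuasiIso.

Section Contraction.
Variables (A : pzRingType) (C : cplx A).

Lemma contraction : bounded_above C -> degreewise (@projective A) C -> acyclic C ->
  exists c : forall n, {linear C (n + 1) -> C n},
    forall n y, cdif C n (c n y) + c (n + 1) (cdif C (n + 1) y) = y.
Proof.
move=> [m hm] PC acy; pose R n (c : {linear C (n + 1) -> C n})
  (c' : {linear C (n + 1 + 1) -> C (n + 1)}) :=
  forall y, cdif C n (c y) + c' (cdif C (n + 1) y) = y.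
have [||c [cR _]] := @int_choice_down (fun n => {linear C (n + 1) -> C n}) R
  (fun n => \0) m; last by exists c.
- by move=> n mn y; rewrite cdif0 addr0 [RHS]hm //; lia.
move=> n x y Rxy.
have K0 : cdif C (n + 1) 0 = 0 by exact: cdif0.
have KP a z w : cdif C (n + 1) z = 0 -> cdif C (n + 1) w = 0 ->
    cdif C (n + 1) (a *: z + w) = 0.
  by move=> dz dw; rewrite linearP dz dw scaler0 addr0.
pose K := Submodule K0 KP.
have qK z : K (z - x (cdif C (n + 1) z)).
  have := Rxy (cdif C (n + 1) z); rewrite cdif2 raddf0 addr0 => e.
  by rewrite /K /= raddfB /= e subrr.
have ql : linear (fun z => sub_mk (qK z)).
  move=> a z w; apply: val_inj; rewrite /= linearP /= linearP scalerBr opprD.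
  exact: addrACA.
have pK z : K (cdif C n z) by exact: cdif2.
have pl : linear (fun z => sub_mk (pK z)).
  by move=> a z w; apply: val_inj; rewrite /= linearP.
have [|w hw] := PC (n + 1) _ _ (mklin pl) (mklin ql).
  move=> z; have [z' zE] := acy n (sub_val z) (sub_ofP z).
  by exists z'; apply: val_inj; rewrite /= -zE.
exists w => z; have /(congr1 val) /= -> := hw z.
by rewrite subrK.
Qed.

End Contraction.

Definition mkadd (U V : zmodType) (f : U -> V) (fa : zmod_morphism f) :
  {additive U -> V} := HB.pack f (GRing.isZmodMorphism.Build U V f fa).

Section Tensor.
Variables (R : comPzRingType) (A : pzRingType) (phi : central_morph R A).
Local Notation dualising := (dualising phi).
Implicit Types (g : dualising).

Lemma tensor_ext (M T : lmodType A) (t : dualising -> M -> T) (U : zmodType)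
    (v w : {additive T -> U}) : is_tensor t ->
  (forall g x, v (t g x) = w (t g x)) -> v =1 w.
Proof.
move=> [[tD1 tD2 tZ] _ uni] vw z.
have [|v' [_ v'u]] := uni U (fun g x => w (t g x)).
  by split=> *; rewrite ?tD1 ?tD2 ?raddfD ?tZ.
by rewrite (v'u v vw) (v'u w (fun _ _ => erefl)).
Qed.

Lemma tensor_r0 (M T : lmodType A) (t : dualising -> M -> T) g :
  is_tensor t -> t g 0 = 0.
Proof.
by move=> [[_ tD _] _ _]; apply: (addrI (t g 0)); rewrite -tD !addr0.
Qed.

Lemma tensor_prod (M T M' T' : lmodType A) (t : dualising -> M -> T)
    (t' : dualising -> M' -> T') : is_tensor t -> is_tensor t' ->
  is_tensor (fun g (z : (M * M')%type) => (t g z.1, t' g z.2) : (T * T')%type).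
Proof.
move=> ht ht'; have [[tD1 tD2 tZ] tl uni] := ht; have [[tD1' tD2' tZ'] tl' uni'] := ht'.
split.
- split=> [g h x|g x y|g a x]; first by rewrite tD1 tD1'.
    by rewrite /= tD2 tD2'.
  by rewrite tZ tZ'.
- by move=> a g x; rewrite tl tl'.
move=> U u [uD1 uD2 uZ].
have [|v1 [v1E _]] := uni U (fun g x => u g (x, 0)).
  split=> [g h x|g x y|g a x]; first exact: uD1.
    by rewrite -uD2; congr (u g); apply/pair_equal_spec; rewrite /= addr0.
  by rewrite uZ; congr (u g); apply/pair_equal_spec; rewrite /= scaler0.
have [|v2 [v2E _]] := uni' U (fun g x => u g (0, x)).
  split=> [g h x|g x y|g a x]; first exact: uD1.
    by rewrite -uD2; congr (u g); apply/pair_equal_spec; rewrite /= addr0.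
  by rewrite uZ; congr (u g); apply/pair_equal_spec; rewrite /= scaler0.
pose v (z : (T * T')%type) := v1 z.1 + v2 z.2.
have va : zmod_morphism v.
  by move=> y z; rewrite /v /= !raddfB opprD addrACA.
exists (mkadd va); split=> [g [x y]|v' v'u] /=.
  rewrite /v /= v1E v2E -uD2; congr (u g); apply/pair_equal_spec.
  by rewrite /= addr0 add0r.
have va1 : zmod_morphism (fun a : T => v' (a, 0)).
  by move=> a b; rewrite -raddfB; congr (v' _); apply/pair_equal_spec; rewrite /= subr0.
have va2 : zmod_morphism (fun a : T' => v' (0, a)).
  by move=> a b; rewrite -raddfB; congr (v' _); apply/pair_equal_spec; rewrite /= subr0.
move=> [a b]; rewrite /v /=.
have -> : v' (a, b) = v' (a, 0) + v' (0, b).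
  by rewrite -raddfD; congr (v' _); apply/pair_equal_spec; rewrite /= addr0 add0r.
congr (_ + _).
  apply: (tensor_ext (v := mkadd va1) (w := v1) ht).
  by move=> g x /=; rewrite v1E -v'u /= (tensor_r0 _ ht').
apply: (tensor_ext (v := mkadd va2) (w := v2) ht').
by move=> g x /=; rewrite v2E -v'u /= (tensor_r0 _ ht).
Qed.

(** The contraction induces additive maps by the universal property, and the contraction identity
    need only be checked on pure tensors. *)
Lemma tensor_acyclic (C D : cplx A) (c : forall n, {linear C (n + 1) -> C n}) :
  (forall n y, cdif C n (c n y) + c (n + 1) (cdif C (n + 1) y) = y) ->
  is_tensor_cplx phi C D -> acyclic D.
Proof.
move=> cd [t [ht td]].
have Kex (n : int) : exists K : {additive D (n + 1)%R -> D n}, forall g x, K (t (n + 1) g x) = t n g (c n x).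
  have [_ _ uni] := ht (n + 1); have [[tD1 tD2 tZ] _ _] := ht n.
  have [|K [KE _]] := uni (D n) (fun g x => t n g (c n x)); last by exists K.
  by split=> [g h x|g x y|g a x]; rewrite ?tD1 ?raddfD ?tD2 ?tZ ?linearZ.
pose K n := projT1 (cid (Kex n)); have KE n g x : K n (t (n + 1) g x) = t n g (c n x) := projT2 (cid (Kex n)) g x.
move=> n z dz; exists (K n z).
have : ((cdif D n \o K n) \+ (K (n + 1) \o cdif D (n + 1))) z = z.
  apply: (tensor_ext (w := idfun) (ht (n + 1))) => g x.
  have [[_ tD2 _] _ _] := ht (n + 1).
  by rewrite /= td !KE td -tD2 cd.
by rewrite /= dz raddf0 addr0.
Qed.

(** The module omega (x)_A A e is omega e, which z |-> z f identifies with A e; so the tensor of g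
    and y is the z with g y = z f. *)
Lemma tensor_idem (e : A) (f : dualising) : e * e = e ->
  e *: f = f -> dual_rmul f e = f ->
  (forall g, dual_rmul g e = g -> exists2 a, a * e = a & g = a *: f) ->
  (forall a, a * e = a -> a *: f = 0 -> a = 0) ->
  exists t : dualising -> left_ideal e -> left_ideal e, is_tensor t /\
    forall g y, dual_rmul g (lideal_val y : A) = (lideal_val (t g y) : A) *: f.
Proof.
move=> ee ef fe ex inj.
have rA g a b : dual_rmul (dual_rmul g a) b = dual_rmul g (a * b).
  by apply: dual_ext => x /=; rewrite mulrA.
have rl a g b : dual_rmul (a *: g) b = a *: dual_rmul g b.
  by apply: dual_ext => x /=; rewrite mulrA.
have rDl g h b : dual_rmul (g + h) b = dual_rmul g b + dual_rmul h b.
  by apply: dual_ext.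
have rDr g a b : dual_rmul g (a + b) = dual_rmul g a + dual_rmul g b.
  by apply: dual_ext => x; rewrite /= mulrDl dualD.
have inj2 a b : a * e = a -> b * e = b -> a *: f = b *: f -> a = b.
  move=> ae be ab; apply/eqP; rewrite -subr_eq0; apply/eqP; apply: inj.
    by rewrite mulrBl ae be.
  by rewrite scalerBl ab subrr.
have ex' g (y : left_ideal e) : exists z : left_ideal e,
    dual_rmul g (lideal_val y : A) = (lideal_val z : A) *: f.
  have [|a ae aE] := ex (dual_rmul g (lideal_val y : A)).
    by rewrite rA left_ideal_idem.
  have ha : (a : A^o) \in lideal e by apply/lidealP; exists a.
  by exists (LeftIdeal ha).
pose t g y := projT1 (cid (ex' g y)).
have tE g y : dual_rmul g (lideal_val y : A) = (lideal_val (t g y) : A) *: f.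
  exact: projT2 (cid (ex' g y)).
have tu g y z : dual_rmul g (lideal_val y : A) = (lideal_val z : A) *: f -> t g y = z.
  move=> h; apply: val_inj; apply: inj2; rewrite ?left_ideal_idem //.
  by rewrite -tE.
exists t; split=> //; split.
- split=> [g h x|g x y|g a x]; apply: tu => /=.
  + by rewrite rDl !tE scalerDl.
  + by rewrite rDr !tE scalerDl.
  + by rewrite rA -tE.
- by move=> a g x; apply: tu; rewrite rl tE scalerA.
move=> U u [uD1 uD2 uZ].
have he : (e : A^o) \in lideal e by apply/lidealP; exists 1; rewrite mul1r.
pose v (a : left_ideal e) := u ((lideal_val a : A) *: f) (LeftIdeal he).
have u0 x : u 0 x = 0 by apply: (addrI (u 0 x)); rewrite -uD1 !addr0.
have va : zmod_morphism v.
  move=> a b; apply: (addIr (v b)); rewrite subrK /v -uD1 -scalerDl /=.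
  by rewrite subrK.
exists (mkadd va); split=> [g x|v' v'u a] /=; rewrite /v.
  rewrite -tE uZ; congr (u g); apply: val_inj.
  by rewrite /= [LHS](left_ideal_idem x).
rewrite -v'u; congr (v' _); apply/esym; apply: tu.
by rewrite /= rl fe.
Qed.

End Tensor.

Section Signs.
Variables (A : pzRingType) (t : twist A).

Definition sign_twist (s : int -> bool) : twist A.
Proof.
exists (te t) (fun n => if s n then - tu t n else tu t n) => n.
- exact: te_idem.
- by case: (s n); rewrite ?mulrN teu.
- by case: (s n); rewrite ?mulNr tue.
- by case: (s n); case: (s (n + 1)); rewrite ?mulNr ?mulrN tuu ?oppr0.
Defined.

Definition half_twist : twist A.
Proof.
exists (fun n => if n <= 0 then te t n else 0) (fun n => if n < 0 then tu t n else 0) => n.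
- by case: ifP; rewrite ?te_idem ?mulr0.
- by case: ifP => h1; case: ifP => h2; rewrite ?mulr0 ?teu //; lia.
- by case: ifP => h1; case: ifP => h2; rewrite ?mul0r ?tue //; lia.
- by case: ifP => h1; case: ifP => h2; rewrite ?mul0r ?mulr0 ?tuu //.
Defined.

End Signs.

Section DerivedTensor.
Variables (k : fieldType) (R : comPzRingType) (A : pzRingType).
Variables (iota : central_morph k A) (phi : central_morph R A).
Variables (t : twist A) (s : int -> bool) (f : int -> dualising phi).
Local Notation t' := (sign_twist t s).
Hypothesis t0 : forall n, 0 < n -> te t n = 0.
Hypothesis ef : forall n, te t n *: f n = f n.
Hypothesis fe : forall n, dual_rmul (f n) (te t n) = f n.
Hypothesis fu : forall n, dual_rmul (f n) (tu t n) = tu t' n *: f (n + 1).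
Hypothesis fex : forall n g, dual_rmul g (te t n) = g ->
  exists2 a, a * te t n = a & g = a *: f n.
Hypothesis finj : forall n a, a * te t n = a -> a *: f n = 0 -> a = 0.

Lemma twist_tensor : exists T : forall n, dualising phi -> tw_cplx t n -> tw_cplx t' n,
  [/\ forall n, is_tensor (T n),
      forall n g x, cdif (tw_cplx t') n (T n g x) = T (n + 1) g (cdif (tw_cplx t) n x)
    & forall n g y, dual_rmul g (lideal_val y : A) = (lideal_val (T n g y) : A) *: f n].
Proof.
have Tex n := tensor_idem (te_idem t n) (ef n) (fe n) (@fex n) (@finj n).
pose T n := projT1 (cid (Tex n)).
have TT n : is_tensor (T n) by case: (projT2 (cid (Tex n))).
have TE n g y : dual_rmul g (lideal_val y : A) = (lideal_val (T n g y) : A) *: f n.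
  by case: (projT2 (cid (Tex n))) => _; exact.
exists T; split=> // n g x; apply: val_inj; apply/eqP; rewrite -subr_eq0; apply/eqP.
apply: (finj (n := n + 1)).
  by rewrite mulrBl [X in X - _](tw_mem (t := t') (cdif (tw_cplx t') n _)) [X in _ - X]tw_mem.
rewrite scalerBl -TE; apply/eqP; rewrite subr_eq0; apply/eqP.
rewrite /= -scalerA -[X in _ *: X]fu.
have rl a h b : dual_rmul (a *: h) b = a *: dual_rmul h b.
  by apply: dual_ext => z /=; rewrite mulrA.
rewrite -rl -TE; apply: dual_ext => z /=.
by rewrite mulrA.
Qed.

Lemma twist_tensor_cplx : is_tensor_cplx phi (tw_cplx t) (tw_cplx t').
Proof. by have [T [h1 h2 _]] := twist_tensor; exists T. Qed.

Lemma dtensor_exists (X T : bcplx A) (x : tcocycle t X) (y : tcocycle t' T) :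
  quasi_iso (tw_act x) -> quasi_iso (tw_act y) -> is_dtensor phi X T.
Proof.
move=> qx qy; exists (tw_cplx t), (tw_act x), (tw_cplx t'), (tw_cplx t'), (ch_id _), (tw_act y).
split=> //; first exact: tw_bounded_above.
- exact: tw_fgproj.
- exact: twist_tensor_cplx.
split=> //; split=> n z dz; first by move=> [w zw]; exists w.
by exists z, 0; rewrite raddf0 addr0.
Qed.

(** Tensoring need not preserve quasi-isomorphisms, but the cone of [tw_act x] is acyclic, bounded
    above and degreewise projective, hence contractible, and tensoring turns it into the cone of
    [tw_act w]. *)
Lemma tensor_twist_qiso (P W : cplx A) (T : forall n, dualising phi -> P n -> W n)
    (x : tcocycle t P) (w : tcocycle t' W) :
  bounded_above P -> degreewise (@projective A) P ->
  (forall n, is_tensor (T n)) ->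
  (forall n g y, cdif W n (T n g y) = T (n + 1) g (cdif P n y)) ->
  (forall n, w n = T n (f n) (x n)) ->
  quasi_iso (tw_act x) -> quasi_iso (tw_act w).
Proof.
move=> [m hm] PP hT Td wE qx; apply: acyclic_cone.
have [S [hS Sd SE]] := twist_tensor.
have [||c cP] := contraction (C := cone (tw_act x)) _ _ (cone_acyclic qx).
- exists (Num.max m 0) => n nm [y z]; rewrite (hm n _ z); last by lia.
  by congr pair; apply: left_ideal0; apply: t0; lia.
- move=> n M N p h psurj.
  have il1 : linear (fun y : tw_cplx t (n + 1) => h (y, 0)).
    move=> a y z; rewrite -linearP; congr (h _).
    by apply/pair_equal_spec; rewrite /= scaler0 addr0.
  have il2 : linear (fun y : P n => h (0, y)).
    move=> a y z; rewrite -linearP; congr (h _).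
    by apply/pair_equal_spec; rewrite /= scaler0 addr0.
  have [g1 g1E] := proj2 (tw_fgproj t (n + 1)) M N p (mklin il1) psurj.
  have [g2 g2E] := PP n M N p (mklin il2) psurj.
  have gl : linear (fun z : cone (tw_act x) n => g1 z.1 + g2 z.2).
    by move=> a y z; rewrite /= !linearP /= scalerDr addrACA.
  exists (mklin gl) => -[y z]; rewrite [LHS](raddfD p) [X in X + _]g1E [X in _ + X]g2E.
  rewrite /= -raddfD; congr (h _); apply/pair_equal_spec.
  by rewrite /= addr0 add0r.
apply: (tensor_acyclic (phi := phi) cP).
exists (fun n g z => (S (n + 1) g z.1, T n g z.2)); split=> [n|n g [y z]].
  exact: tensor_prod.
apply/pair_equal_spec; split; rewrite /=.
  have [[_ tD _] _ _] := hS (n + 1 + 1).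
  apply: (addrI (S (n + 1 + 1) g (cdif (tw_cplx t) (n + 1) y))).
  by rewrite -tD subrr (tensor_r0 _ (hS _)) -Sd subrr.
have [[_ tD tZ] tl _] := hT (n + 1).
by rewrite tD Td; congr (_ + _); rewrite wE -tl -SE tZ.
Qed.

(** The cocycle x is lifted to P, tensored with the f n to a cocycle of W, lifted to Z and pushed to
    T. Then T and X have the same signed complex as resolution. *)
Lemma dtensor_unique (X T : bcplx A) (x : tcocycle t X) (y : tcocycle t' X) :
  quasi_iso (tw_act x) -> quasi_iso (tw_act y) -> is_dtensor phi X T ->
  isomorphic (T : sing_cat iota) (X : sing_cat iota).
Proof.
move=> qx qy [P [e [W [Z [u [v [bP PP qe [S [hS Sd]] [qu qv]]]]]]]].
have [p px] := tw_lift t0 x qe; have qp := tw_lift_qiso qe px qx.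
have we n : te t' n *: S n (f n) (p n) = S n (f n) (p n).
  by have [_ tl _] := hS n; rewrite -tl ef.
have wd n : cdif W n (S n (f n) (p n)) = tu t' n *: S (n + 1) (f (n + 1)) (p (n + 1)).
  by have [[_ _ tZ] tl _] := hS (n + 1); rewrite Sd tc_d -tZ fu tl.
pose w : tcocycle t' W := TCocycle we wd.
have qw : quasi_iso (tw_act w).
  by apply: (tensor_twist_qiso (x := p) bP _ hS Sd) => // n; case: (PP n).
have [z zw] := tw_lift (t := t') t0 w qu; have qz := tw_lift_qiso qu zw qw.
exact: (tw_isomorphic iota (t := t') t0 (tw_push_qiso qv qz) qy).
Qed.

End DerivedTensor.

(** * The dualising bimodule of a gentle algebra *)

Lemma sum_one (I : finType) (U : nmodType) (P : pred I) (F : I -> U) a : P a ->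
  (forall b, P b -> b != a -> F b = 0) -> \sum_(b | P b) F b = F a.
Proof.
move=> Pa h; rewrite (bigD1 a) //= big1 ?addr0 // => b /andP[]; exact: h.
Qed.

Section Dualising.
Variables (Q : bound_quiver) (hQ : gentle Q) (k : fieldType).
Notation V := (vert Q).
Notation E := (arr Q).
Local Notation G := (gentle_alg Q k).
Local Notation sg := (@sigma Q).
Local Notation ar := (arrow_elt k).
Local Notation pt := (ptraj hQ).
Local Notation ell := (fingraph.order (@sigma Q)).
Local Notation cc := (c_elt Q k).
Local Notation pe a n := (path_elt k (val (pt a n))).
Local Notation dual := (dualising (galg_R hQ k)).
Implicit Types (b c : E) (x y : G) (g h : dual) (v : V).

Lemma ell_gt0 b : (0 < ell b)%N. Proof. exact: order_gt0. Qed.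

Lemma iter_ell i b : iter (i * ell b) sg b = b.
Proof.
elim: i => // i IH; rewrite mulSn iterD IH.
exact: (iter_order (sigma_inj hQ)).
Qed.

Lemma c_ptraj b n : cc (pt b n) = (n == ell b)%:R.
Proof.
rewrite (c_eltE hQ); case: n => [|n] /=; first by rewrite eq_sym (gtn_eqF (ell_gt0 b)).
by rewrite size_traject -[in RHS]orderSpred eqSS.
Qed.

Lemma c_exp_mul d x b n : (cc ^+ d * x) (pt b n) =
  if (d * ell b <= n)%N then x (pt b (n - d * ell b)) else 0.
Proof.
elim: d n => [|d IH] n; first by rewrite expr0 mul1r mul0n subn0.
rewrite exprS -mulrA galg_mul_ptraj.
under eq_bigr => i _ do rewrite c_ptraj (order_iter_sigma hQ) IH.
have [h|h] := leqP (ell b) n; last first.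
  rewrite big1 => [|i _]; last by rewrite (_ : (_ == _) = false) ?mul0r //; lia.
  by rewrite ifN // -ltnNge mulSn; lia.
have hn : (n - ell b < n.+1)%N by lia.
rewrite (bigD1 (Ordinal hn)) //= big1 => [|i]; last first.
  by rewrite -val_eqE /= => ni; rewrite (_ : (_ == _) = false) ?mul0r //; have := ltn_ord i; lia.
rewrite subKn // eqxx mul1r addr0 mulSn leq_subRL //.
by rewrite subnDA.
Qed.

Lemma fps_mulE r x p : (galg_of_fps Q r * x) p =
  \sum_(i < (plen p).+1) r i * (cc ^+ i * x) p.
Proof.
have suf_le i : (plen (nsuf i p) <= plen p)%N by rewrite plen_suf leq_subr.
rewrite galg_mulE.
under eq_bigr => i _ do rewrite (galg_of_fpsE r (suf_le i)) mulr_suml.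
rewrite exchange_big; apply: eq_bigr => i _.
by rewrite galg_mulE mulr_sumr; apply: eq_bigr => j _; rewrite mulrA.
Qed.

(** The coefficients along the powers of the admissible cycle beginning with b, the trivial path
    included. *)
Definition cyc_coef b x : fps k := Fps (fun i => x (pt b (i * ell b))).

Lemma cyc_coefZ b (r : fps k) x :
  cyc_coef b (galg_of_fps Q r * x) = r * cyc_coef b x.
Proof.
apply: fps_ext => i; apply: etrans (fps_mulE r x (pt b (i * ell b))) _.
rewrite plen_ptraj [RHS]/=.
have hi : (i.+1 <= (i * ell b).+1)%N by rewrite ltnS leq_pmulr // ell_gt0.
rewrite (big_ord_widen _ (fun j => r j * x (pt b ((i - j) * ell b)%N)) hi).
rewrite [RHS]big_mkcond; apply: eq_bigr => j _; rewrite c_exp_mul ltnS leq_pmul2r ?ell_gt0 //.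
by case: ifP => _; rewrite ?mulr0 // mulnBl.
Qed.

Variable sb : E -> bool.
Local Notation sgn b := ((-1) ^+ sb b : k).

Definition balanced_at v : Prop := exists b1 b2, sb b1 != sb b2 /\
  forall b, (src b == v) = (b == b1) || (b == b2).

Lemma sum_at v (F : E -> k) b1 b2 : sb b1 != sb b2 ->
  (forall b, (src b == v) = (b == b1) || (b == b2)) ->
  \sum_(b | src b == v) F b = F b1 + F b2.
Proof.
move=> b12 hv; have ne : b2 != b1 by apply: contraNneq b12 => ->.
rewrite (bigD1 b1) ?hv ?eqxx //= (bigD1 b2) /=; last by rewrite hv eqxx orbT.
rewrite big1 ?addr0 // => b; rewrite hv => /andP[/andP[/orP[]/eqP -> ]]; rewrite ?eqxx //.
Qed.

Lemma sum_sgn v : balanced_at v -> \sum_(b | src b == v) sgn b = 0.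
Proof.
move=> [b1 [b2 [b12 hv]]]; rewrite (sum_at _ b12 hv).
by case: (sb b1) (sb b2) b12 => [] [] //= _; rewrite expr0 expr1 ?addNr ?subrr.
Qed.

Section AtVertex.
Variable v : V.
Hypothesis hv : balanced_at v.

(* The coefficients of the c^i are shifted by one: the map is k[[c]]-linear since
   the signs cancel the contribution of the trivial path at v. *)
Definition dual_at : dual.
Proof.
exists (fun x => Fps (fun i => \sum_(b | src b == v) sgn b * cyc_coef b x i.+1)).
  move=> x y; apply: fps_ext => i /=; rewrite -big_split /=.
  by apply: eq_bigr => b _; rewrite mulrDr.
move=> r x; apply: fps_ext => i /=.
transitivity (\sum_(b | src b == v) (sgn b * (\sum_(j < i.+1) r j * cyc_coef b x (i.+1 - j)%N) +
    sgn b * (r i.+1 * x (pt b 0)))).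
  apply: eq_bigr => b _; rewrite -mulrDr; congr (_ * _).
  apply: etrans (congr1 (fun f : fps k => f i.+1) (cyc_coefZ b r x)) _.
  by rewrite [LHS]big_ord_recr /= subnn mul0n.
rewrite big_split /= [X in _ + X](_ : _ = 0) ?addr0; last first.
  have [b1 [b2 [_ hb]]] := hv.
  transitivity (\sum_(b | src b == v) sgn b * (r i.+1 * x (pt b1 0))).
    apply: eq_bigr => b sb1; congr (_ * (_ * x _)); apply: ptraj0.
    by rewrite (eqP sb1); apply/esym/eqP; rewrite hb eqxx.
  by rewrite -mulr_suml sum_sgn // mul0r.
under eq_bigr => b _ do rewrite mulr_sumr.
rewrite exchange_big /=; apply: eq_bigr => j _; rewrite mulr_sumr.
by apply: eq_bigr => b _; rewrite mulrCA subSn // -ltnS.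
Defined.

Lemma dual_atE x i : dual_at x i =
  \sum_(b | src b == v) sgn b * x (pt b (i.+1 * ell b)).
Proof. by []. Qed.

Lemma dual_at_lidem : idem k v *: dual_at = dual_at.
Proof.
apply: dual_ext => x; apply: fps_ext => i; rewrite [LHS]dual_atE dual_atE.
by apply: eq_bigr => b sbv; rewrite mul_idemE sbv.
Qed.

Lemma dual_at_ridem : dual_rmul dual_at (idem k v) = dual_at.
Proof.
apply: dual_ext => x; apply: fps_ext => i; rewrite [LHS]dual_atE dual_atE.
by apply: eq_bigr => b sbv; rewrite idem_mulE iter_ell sbv.
Qed.

End AtVertex.

(** Cyclic rotation: moving b from the end to the beginning turns a power of the cycle beginning
    with [sigma b] into one of the cycle beginning with b. The signs of these two cycles give the
    factor. *)
Lemma dual_at_arrow b (ht : balanced_at (tgt b)) (hs : balanced_at (src b)) :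
  dual_rmul (dual_at ht) (ar b) =
  (if sb (sg b) (+) sb b then - ar b else ar b) *: dual_at hs.
Proof.
apply: dual_ext => x; apply: fps_ext => i; rewrite [LHS]dual_atE [RHS]dual_atE.
have NS c : (i.+1 * ell c = (i.+1 * ell c).-1.+1)%N.
  by rewrite prednK // muln_gt0 ell_gt0.
rewrite (sum_one (a := sg b)) ?(src_sigma hQ) // => [|c _ cb]; last first.
  rewrite arrow_mulE; case: ifP => [/andP[_ /eqP e]|_]; last by rewrite mulr0.
  by case/eqP: cb; rewrite -[LHS](iter_ell i.+1) NS iterS e.
rewrite (sum_one (a := b)) // => [|c _ /negbTE cb]; last first.
  have cE : (x * ar b) (pt c (i.+1 * ell c)) = 0 by rewrite mul_arrowE cb andbF.
  by case: ifP => _; rewrite ?mulrN ?galg_oppE ?mulrN cE mulr0 ?oppr0.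
have eb : ell (sg b) = ell b := order_iter_sigma hQ b 1.
rewrite arrow_mulE eb.
have -> : iter (i.+1 * ell b).-1 sg (sg b) == b.
  by rewrite -iterSr -NS iter_ell.
have E : (x * ar b) (pt b (i.+1 * ell b)) = x (pt (sg b) (i.+1 * ell b).-1).
  by rewrite mul_arrowE eqxx andbT ifT // muln_eq0 negb_or /= -lt0n ell_gt0.
rewrite andbT ifT; last by rewrite muln_eq0 negb_or /= -lt0n ell_gt0.
have -> : (x * (if sb (sg b) (+) sb b then - ar b else ar b)) (pt b (i.+1 * ell b)) =
    if sb (sg b) (+) sb b then - x (pt (sg b) (i.+1 * ell b).-1)
    else x (pt (sg b) (i.+1 * ell b).-1).
  by case: ifP => _; rewrite ?mulrN ?galg_oppE E.
by case: (sb (sg b)); case: (sb b); rewrite /= ?expr1 ?expr0 ?mulN1r ?mul1r ?opprK.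
Qed.

Lemma peE c b n m : m != 0%N -> pe c m (pt b n) = ((n == m) && (b == c))%:R.
Proof.
move=> m0; rewrite /path_elt /=; congr (nat_of_bool _)%:R; apply/eqP/andP => [[_ e]|[/eqP -> /eqP ->] //].
have := congr1 size e; rewrite !size_traject => nm; rewrite nm eqxx; split=> //.
by move: m0 e; rewrite nm; case: (m) => // m' _ [-> _].
Qed.

Lemma pe_mul c b n m a : m != 0%N -> (pe c m * a) (pt b n) =
  if (m <= n)%N && (iter (n - m) sg b == c) then a (pt b (n - m)) else 0.
Proof.
move=> m0; rewrite galg_mul_ptraj; have [h|h] := leqP m n; last first.
  rewrite big1 // => i _; rewrite peE //.
  by rewrite (_ : (_ == _) = false) ?mul0r //; have := ltn_ord i; lia.
have hn : (n - m < n.+1)%N by lia.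
rewrite (sum_one (a := Ordinal hn)) // => [|i _]; last first.
  rewrite -val_eqE /= => ni; rewrite [X in X * _]peE //.
  by rewrite (_ : (_ == m) = false) ?mul0r //; have := ltn_ord i; lia.
rewrite peE // subKn // eqxx [true && _]/=.
by case: (_ == c); rewrite ?mul1r ?mul0r.
Qed.

Lemma c_exp_pe c m d : m != 0%N -> cc ^+ d * pe c m = pe c (m + d * ell c).
Proof.
move=> m0; apply: (@galg_extP Q hQ k) => b n; rewrite c_exp_mul !peE //; last by lia.
case: (b =P c) => [->|]; last by rewrite !andbF if_same.
rewrite !andbT; case: ifP => h; last by rewrite (_ : (_ == _) = false) //; lia.
by congr (nat_of_bool _)%:R; lia.
Qed.

Lemma dual_c_exp g x d i :
  g (cc ^+ d * x) i = if (d <= i)%N then g x (i - d)%N else 0.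
Proof.
pose r : fps k := Fps (fun j => (j == d)%:R).
have -> : cc ^+ d = galg_of_fps Q r.
  apply: galg_ext => p; have [h|h] := leqP d (plen p); last first.
    rewrite c_elt_exp //= big1 // => j _.
    by rewrite (_ : (_ == _) = false) ?mul0r //; have := ltn_ord j; lia.
  have hd : (d < (plen p).+1)%N by lia.
  rewrite [RHS](sum_one (a := Ordinal hd)) //= ?eqxx ?mul1r // => j _.
  by rewrite -val_eqE /= => /negbTE ->; rewrite mul0r.
rewrite [X in fcoef X](dualZ g r) /=; case: ifP => h; last first.
  rewrite big1 // => j _; rewrite (_ : (_ == _) = false) ?mul0r //.
  by have := ltn_ord j; lia.
have hd : (d < i.+1)%N by lia.
rewrite (sum_one (a := Ordinal hd)) //= ?eqxx ?mul1r // => j _.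
by rewrite -val_eqE /= => /negbTE ->; rewrite mul0r.
Qed.

Lemma dual_scalar g (l : k) x i : g (galg_scalar Q l * x) i = l * g x i.
Proof.
pose r : fps k := Fps (fun j => if j == 0%N then l else 0).
have -> : galg_scalar Q l = galg_of_fps Q r.
  apply: galg_ext => p /=; rewrite big_ord_recl /= big1 => [|j _]; last by rewrite mul0r.
  by rewrite addr0; case: eqP => // p0; rewrite ?mulr1 ?mulr0.
rewrite [X in fcoef X](dualZ g r) /= big_ord_recl /= big1 ?addr0 ?subn0 // => j _.
by rewrite mul0r.
Qed.

Lemma dual0 g i : g 0 i = 0.
Proof. by have := dual_scalar g 0 0 i; rewrite mulr0 mul0r. Qed.

Lemma galg_sumE (I : finType) (F : I -> G) p : (\sum_i F i) p = \sum_i F i p.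
Proof. exact: (big_morph (fun g : G => g p) (fun _ _ => erefl) erefl). Qed.

Lemma dual_sum g (I : finType) (F : I -> G) i : g (\sum_j F j) i = \sum_j g (F j) i.
Proof.
apply: (big_morph (fun x => g x i)) => [x y|]; last exact: dual0.
by rewrite dualD.
Qed.

(** Modulo c^(i+1), an element of the radical is a finite combination of nontrivial paths, and
    multiples of c^(i+1) do not affect the i-th coefficient. The general case follows on multiplying
    by c, which leads into the radical. *)
Lemma dual_path_eq0 g : (forall c m i, g (pe c m.+1) i = 0) -> g = 0.
Proof.
move=> g0.
have gr y i : (forall c, y (pt c 0) = 0) -> g y i = 0.
  move=> y0.
  have [z zE] := @galg_funE Q hQ k (fun b n => if n == 0%N then 0 else y (pt b (n + i.+1 * ell b)))
    (fun b c _ => erefl).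
  have -> : y = cc ^+ i.+1 * z + \sum_c \sum_(n < i.+1 * ell c)
      galg_scalar Q (y (pt c n.+1)) * pe c n.+1.
    apply: (@galg_extP Q hQ k) => b q; rewrite galg_addE c_exp_mul zE galg_sumE.
    rewrite (sum_one (a := b)) // => [|c _ cb]; last first.
      rewrite galg_sumE big1 // => n _.
      by rewrite [LHS]galg_scalarE peE // [b == c]eq_sym (negbTE cb) andbF mulr0.
    rewrite galg_sumE.
    have -> : \sum_(n < i.+1 * ell b) (galg_scalar Q (y (pt b n.+1)) * pe b n.+1) (pt b q) =
        \sum_(n < i.+1 * ell b) y (pt b n.+1) * (q == n.+1)%:R.
      by apply: eq_bigr => n _; rewrite [LHS]galg_scalarE peE // eqxx andbT.
    have [q0|q0] := eqVneq q 0%N.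
      rewrite q0 sub0n eqxx if_same add0r y0 big1 // => n _.
      by rewrite (_ : (_ == _) = false) ?mulr0.
    have [h|h] := ltnP (i.+1 * ell b) q.
      rewrite (ltnW h) ifN; last by lia.
      rewrite subnK ?(ltnW h) // big1 ?addr0 // => n _.
      by rewrite (_ : (_ == _) = false) ?mulr0 //; have := ltn_ord n; lia.
    have -> : (if (i.+1 * ell b <= q)%N then if (q - i.+1 * ell b)%N == 0%N then 0
        else y (pt b (q - i.+1 * ell b + i.+1 * ell b)) else 0) = 0.
      by case: ifP => // _; rewrite ifT //; lia.
    have hq : (q.-1 < i.+1 * ell b)%N by lia.
    rewrite add0r (sum_one (a := Ordinal hq)) //= => [|n _]; last first.
      rewrite -val_eqE /= => nq; rewrite (_ : (_ == _) = false) ?mulr0 //.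
      by lia.
    by rewrite prednK ?lt0n // eqxx mulr1.
  rewrite dualD [LHS](_ : _ = g (cc ^+ i.+1 * z) i + g (\sum_c \sum_(n < i.+1 * ell c)
      galg_scalar Q (y (pt c n.+1)) * pe c n.+1) i) //.
  rewrite dual_c_exp ltnn add0r dual_sum big1 // => c _; rewrite dual_sum big1 // => n _.
  by rewrite dual_scalar g0 mulr0.
apply: dual_ext => x; apply: fps_ext => i.
have := dual_c_exp g x 1 i.+1; rewrite expr1 subSS subn0 /= => <-.
by apply: gr => c; have := c_exp_mul 1 x c 0; rewrite expr1 mul1n leqNgt ell_gt0.
Qed.

Lemma dual_at_pe v (hv : balanced_at v) c m a i : m != 0%N ->
  dual_at hv (pe c m * a) i =
  if (src (iter m sg c) == v) && (m <= i.+1 * ell c)%N then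
    sgn (iter m sg c) * a (pt (iter m sg c) (i.+1 * ell c - m)) else 0.
Proof.
move=> m0; rewrite dual_atE.
have eqc b : (m <= i.+1 * ell b)%N -> iter (i.+1 * ell b - m) sg b = c ->
    ell b = ell c /\ b = iter m sg c.
  move=> h <-; rewrite (order_iter_sigma hQ); split=> //.
  by rewrite -iterD subnKC // iter_ell.
have ec : ell (iter m sg c) = ell c := order_iter_sigma hQ c m.
case: ifP => [/andP[sv h]|h].
  rewrite (sum_one (a := iter m sg c)) // => [|b _ bc].
    rewrite pe_mul // ec h /= -iterD subnK // iter_ell eqxx //.
  rewrite pe_mul //; case: ifP => [/andP[h' /eqP e]|_]; last by rewrite mulr0.
  by have [_ be] := eqc _ h' e; rewrite be eqxx in bc.
apply: big1 => b sv; rewrite pe_mul //.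
case: ifP => [/andP[h' /eqP e]|_]; last by rewrite mulr0.
by have [eb be] := eqc _ h' e; move: h; rewrite -be sv -eb h'.
Qed.

Lemma dual_at_inj v (hv : balanced_at v) a : a * idem k v = a ->
  a *: dual_at hv = 0 -> a = 0.
Proof.
move=> av a0; apply: (@galg_extP Q hQ k) => b n.
have [sb1|sb1] := eqVneq (src b) v; last by rewrite -av mul_idemE (negbTE sb1).
have hn : (n < n.+1 * ell b)%N by rewrite leq_pmulr // ell_gt0.
(* The length of the path that completes the path of length n from b to the (n+1)-st power of its
   admissible cycle; evaluating there detects the coefficient of a up to sign. *)
pose m := (n.+1 * ell b - n)%N; have m0 : m != 0%N by rewrite /m; lia.
have ec : ell (iter n sg b) = ell b := order_iter_sigma hQ b n.
have := congr1 (fun g : dual => g (pe (iter n sg b) m) n) a0.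
rewrite [X in X = _ -> _](dual_at_pe hv (iter n sg b) a n m0) ec -iterD.
have -> : (m + n = n.+1 * ell b)%N by rewrite /m; lia.
rewrite iter_ell sb1 eqxx (_ : (m <= _)%N); last by rewrite /m; lia.
have -> : (n.+1 * ell b - m = n)%N by rewrite /m; lia.
by move/eqP; rewrite /= mulf_eq0 signr_eq0 => /eqP.
Qed.

Lemma dual_pe_shift g c m d i : m != 0%N ->
  g (pe c (m + d * ell c)) i = if (d <= i)%N then g (pe c m) (i - d)%N else 0.
Proof. by move=> m0; rewrite -c_exp_pe // dual_c_exp. Qed.

Lemma dual_at_surj v (hv : balanced_at v) g : dual_rmul g (idem k v) = g ->
  exists2 a, a * idem k v = a & g = a *: dual_at hv.
Proof.
move=> gv; have gvE x : g x = g (idem k v * x) by rewrite -[in LHS]gv.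
(* The coefficients of a are forced by the evaluation on completing paths in [dual_at_inj]. *)
pose F b n : k := if src b == v then
  sgn b * g (pe (iter n sg b) (n.+1 * ell b - n)) n else 0.
(* At n = 0 the value must depend on the vertex only. As c e_v is the sum of the two admissible
   cycles at v and g (c e_v) has zero constant term, g has opposite constant terms on these cycles,
   matching the opposite signs. *)
have F0 b c : src b = src c -> F b 0%N = F c 0%N.
  move=> sbc; rewrite /F -[src c == v](congr1 (fun w => w == v) sbc) /=; case: eqP => // sbv.
  rewrite !mul1n !subn0.
  have [b1 [b2 [b12 hb]]] := hv.
  have cv : cc * idem k v = pe b1 (ell b1) + pe b2 (ell b2).
    have ne : b1 != b2 by apply: contraNneq b12 => ->.
    have ell0 e : ell e != 0%N by rewrite -lt0n ell_gt0.
    apply: (@galg_extP Q hQ k) => e n; rewrite mul_idemE c_ptraj galg_addE !peE // hb.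
    have [->|e1] := eqVneq e b1; first by rewrite (negbTE ne) andbT andbF addr0.
    have [->|e2] := eqVneq e b2; first by rewrite andbT andbF add0r.
    by rewrite !andbF addr0.
  have := dual_c_exp g (idem k v) 1 0; rewrite expr1 cv dualD /= => /eqP.
  rewrite addr_eq0 => /eqP gE.
  have bE e : src e = v -> sgn e * g (pe e (ell e)) 0%N = sgn b1 * g (pe b1 (ell b1)) 0%N.
    move=> /eqP; rewrite hb => /orP[/eqP -> //|/eqP ->]; rewrite gE.
    by case: (sb b1) (sb b2) b12 => [] [] //= _; rewrite ?expr0 ?expr1 ?mulN1r ?mul1r ?opprK.
  by rewrite bE // [RHS]bE // -sbc.
have [a aE] := @galg_funE Q hQ k F F0.
have av : a * idem k v = a.
  apply: (@galg_extP Q hQ k) => b n; rewrite mul_idemE aE /F.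
  by case: (src b == v).
exists a => //; apply/eqP; rewrite -subr_eq0; apply/eqP; apply: dual_path_eq0 => c m1 i.
set m := m1.+1; have m0 : m != 0%N by [].
suff e : dual_at hv (pe c m * a) i = g (pe c m) i.
  have -> : (g - a *: dual_at hv) (pe c m) i = g (pe c m) i - dual_at hv (pe c m * a) i by [].
  by rewrite e subrr.
rewrite dual_at_pe //; set b := iter m sg c.
have ec : ell b = ell c := order_iter_sigma hQ c m.
have [sbv|sbv] := boolP (src b == v); last first.
  rewrite andFb gvE (_ : _ * _ = 0) ?dual0 //.
  apply: (@galg_extP Q hQ k) => e n; rewrite idem_mulE peE //.
  case: ifP => // /eqP sv; case: eqP => // nm; case: eqP => // ce.
  by case/eqP: sbv; rewrite /b -sv nm ce.
rewrite andTb; have [h|h] := leqP m (i.+1 * ell c); last first.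
  have -> : m = (m - i.+1 * ell c + i.+1 * ell c)%N by lia.
  by rewrite dual_pe_shift ?ltnn //; lia.
set n := (i.+1 * ell c - m)%N.
rewrite aE /F sbv mulrA -signr_addb addbb expr0 mul1r.
have -> : iter n sg b = c by rewrite /b -iterD subnK // iter_ell.
(* The given path and the one used in F differ in length by a multiple of the cycle length, that is,
   by a power of c, which shifts the index accordingly. *)
have [ni|ni] := leqP n i.
  have e : m = (n.+1 * ell b - n + (i - n) * ell c)%N.
    rewrite ec; move: (ell_gt0 c) h ni; rewrite /n; set l := ell c; nia.
  rewrite [in RHS]e dual_pe_shift; last first.
    by rewrite ec -lt0n subn_gt0 leq_pmulr // ell_gt0.
  by rewrite leq_subr subKn.
have e : (n.+1 * ell b - n)%N = (m + (n - i) * ell c)%N.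
  rewrite ec; move: (ell_gt0 c) h ni; rewrite /n; set l := ell c; nia.
by rewrite e dual_pe_shift // leq_subr subKn // ltnW.
Qed.

End Dualising.

(** * The resolution of L_a and the signs from dualising *)

Section LeftIdealResolution.
Variables (A : pzRingType) (t : twist A) (a0 : A).
Local Notation e := (te t).
Local Notation u := (tu t).
Hypothesis t0 : forall n, 0 < n -> e n = 0.
Hypothesis tL : forall n x, n + 1 < 0 -> x * e (n + 1) = x -> x * u (n + 1) = 0 ->
  exists y, x = y * u n.
Hypotheses (ea0 : e 0 * a0 = a0) (ua0 : forall n, n + 1 = 0 -> u n * a0 = 0).
Hypothesis aL : forall n x, n + 1 = 0 -> x * e 0 = x -> x * a0 = 0 ->
  exists y, x = y * u n.

Lemma lcoc_tw_qiso : quasi_iso (tw_act (lcoc ea0 ua0)).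
Proof.
apply: (tw_qiso t0 tL).
- by move=> n y; exact: stalk_eq0.
- exact: lcoc_gen.
move=> y n n0 ye yl; apply: aL => //; first by rewrite -n0.
have h m : m = 0 -> y *: lcoc ea0 ua0 m = 0 -> y * a0 = 0.
  by case: m => [[|m]|m] //= _ /(congr1 val).
exact: h n0 yl.
Qed.

End LeftIdealResolution.

Section SignsExact.
Variables (A : pzRingType) (t : twist A) (s : int -> bool).
Local Notation t' := (sign_twist t s).

Lemma sign_mul0 n x : x * tu t' n = 0 -> x * tu t n = 0.
Proof.
by rewrite /=; case: (s n) => //; rewrite mulrN => /eqP; rewrite oppr_eq0 => /eqP.
Qed.

Lemma sign_mul n x : (exists y, x = y * tu t n) -> exists y, x = y * tu t' n.
Proof.
by move=> [y ->] /=; case: (s n); [exists (- y); rewrite mulrNN|exists y].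
Qed.

Lemma sign_mull n x : tu t n * x = 0 -> tu t' n * x = 0.
Proof. by rewrite /=; case: (s n) => // h; rewrite mulNr h oppr0. Qed.

End SignsExact.

Section Serre.
Variables (Q : bound_quiver) (hQ : gentle Q) (k : fieldType).
Notation V := (vert Q).
Notation E := (arr Q).
Local Notation sg := (@sigma Q).
Local Notation ar := (arrow_elt k).
Local Notation Dk := (sing_cat (galg_k Q k)).

(* One of the two arrows starting at a 2-regular vertex gets the sign -1. *)
Definition out_sign (b : E) : bool := [pick a | src a == src b] == Some b.

Lemma balanced_two_regular (v : V) : two_regular v -> balanced_at out_sign v.
Proof.
move=> [_ /eqP/cards2P[b1 [b2 [b12 oE]]] _ _]; exists b1, b2.
have hb b : (src b == v) = (b == b1) || (b == b2).
  by have := in_set2 b b1 b2; rewrite -oE inE.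
have [e1 e2] : src b1 = v /\ src b2 = v.
  by split; apply/eqP; rewrite hb eqxx ?orbT.
split=> //; rewrite /out_sign e1 e2; case: pickP => [x|/(_ b1)]; last by rewrite e1 eqxx.
have S (y z : E) : (Some y == Some z) = (y == z) by [].
rewrite hb !S => /orP[]/eqP ->; first by rewrite eqxx (negbTE b12).
by rewrite eqxx [b2 == b1]eq_sym (negbTE b12).
Qed.

Lemma zstep_two_regular (a b : E) : zstep a b -> two_regular (tgt a).
Proof.
move=> /andP[/eqP sb zb]; case: (hQ (tgt a)) => // -[a' [b' [ai bo]]].
have : a \in arr_in (tgt a) by rewrite inE.
rewrite ai inE => /eqP <-; have : b \in arr_out (tgt a) by rewrite inE sb.
by rewrite bo inE => /eqP <-; rewrite zb.
Qed.

Variables (a : E) (b : int -> E).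
Hypotheses (ba : b 0 = a) (bz : forall n, zstep (b (n + 1)) (b n)).

Fact balanced_tgt n : balanced_at out_sign (tgt (b n)).
Proof.
apply/balanced_two_regular/(@zstep_two_regular _ (b (n - 1))).
by have := bz (n - 1); rewrite subrK.
Qed.

Local Notation t := (half_twist (arrow_twist hQ k no_sign bz)).
Definition rot_sign (n : int) : bool := out_sign (sg (b n)) (+) out_sign (b n).
Definition dual_seq (n : int) : dualising (galg_R hQ k) :=
  if n <= 0 then dual_at hQ k (balanced_tgt n) else 0.
Local Notation t' := (sign_twist t rot_sign).
Local Notation f := dual_seq.

Lemma half_out n : 0 < n -> te t n = 0.
Proof. by move=> n0; rewrite /= leNgt n0. Qed.

Lemma half_e0 : te t 0 * ar a = ar a.
Proof. by rewrite -ba; exact: (idem_arrow hQ). Qed.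

Lemma half_u0 n : n + 1 = 0 -> tu t n * ar a = 0.
Proof.
move=> n0; rewrite /= ifT; last by lia.
by rewrite -ba -n0; exact: (arrow_zmul hQ).
Qed.

Lemma half_left n x : n + 1 < 0 -> x * te t (n + 1) = x -> x * tu t (n + 1) = 0 ->
  exists y, x = y * tu t n.
Proof.
move=> n1; rewrite /= !ifT; [|lia|lia|lia].
move=> xe xa; exact: left_exact_arrow (bz n) xe xa.
Qed.

Lemma half_top n x : n + 1 = 0 -> x * te t 0 = x -> x * ar a = 0 ->
  exists y, x = y * tu t n.
Proof.
move=> n0; rewrite /= ifT; last by lia.
by rewrite -ba -n0 => xe xa; exact: left_exact_arrow (bz n) xe xa.
Qed.

Lemma rmul0 (g : dualising (galg_R hQ k)) : dual_rmul g 0 = 0.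
Proof. by apply: dual_ext => x; apply: fps_ext => i; rewrite /= mul0r dual0. Qed.

Lemma dual_seq_lidem n : te t n *: f n = f n.
Proof.
rewrite /dual_seq /=; case: ifP => h; last exact: scaler0.
exact: dual_at_lidem.
Qed.

Lemma dual_seq_ridem n : dual_rmul (f n) (te t n) = f n.
Proof.
rewrite /dual_seq /=; case: ifP => h; last exact: rmul0.
exact: dual_at_ridem.
Qed.

Lemma dual_seq_arrow n : dual_rmul (f n) (tu t n) = tu t' n *: f (n + 1).
Proof.
rewrite /= /dual_seq; have [n0|n0] := ltP n 0; last first.
  by rewrite rmul0 oppr0 if_same scale0r.
have -> : n <= 0 by lia.
have -> : n + 1 <= 0 by lia.
have /andP[/eqP sb _] := bz n.
move: (balanced_tgt (n + 1)); rewrite -sb => hs.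
exact: dual_at_arrow.
Qed.

Lemma dual_seq_surj n g : dual_rmul g (te t n) = g ->
  exists2 x, x * te t n = x & g = x *: f n.
Proof.
rewrite /dual_seq /=; case: ifP => h; first exact: dual_at_surj.
by move=> <-; exists 0; rewrite ?mul0r // rmul0 scaler0.
Qed.

Lemma dual_seq_inj n x : x * te t n = x -> x *: f n = 0 -> x = 0.
Proof.
rewrite /dual_seq /=; case: ifP => h; first exact: dual_at_inj.
by rewrite mulr0.
Qed.

Fact sign_u0 n : n + 1 = 0 -> tu t' n * ar a = 0.
Proof. by move=> /half_u0; exact: sign_mull. Qed.

Lemma L_qiso : quasi_iso (tw_act (lcoc half_e0 half_u0)).
Proof.
apply: lcoc_tw_qiso; [exact: half_out|exact: half_left|exact: half_top].
Qed.

Lemma L_sign_qiso : quasi_iso (tw_act (lcoc (t := t') half_e0 sign_u0)).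
Proof.
apply: lcoc_tw_qiso; first exact: half_out.
  move=> n x n1 xe /sign_mul0 xu; apply: sign_mul; exact: half_left.
move=> n x n1 xe xa; apply: sign_mul; exact: half_top.
Qed.

Lemma L_dtensor : is_dtensor (galg_R hQ k) (L k a) (L k a).
Proof.
exact: (dtensor_exists half_out dual_seq_lidem dual_seq_ridem dual_seq_arrow
  dual_seq_surj dual_seq_inj L_qiso L_sign_qiso).
Qed.

Lemma L_dtensor_unique T : is_dtensor (galg_R hQ k) (L k a) T ->
  isomorphic (T : Dk) (L k a : Dk).
Proof.
exact: (dtensor_unique (galg_k Q k) half_out dual_seq_lidem dual_seq_ridem dual_seq_arrow
  dual_seq_surj dual_seq_inj L_qiso L_sign_qiso).
Qed.

End Serre.

Theorem theorem10p13 (k : fieldType) (Q : bound_quiver) (hQ : gentle Q) :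
  let D : lincat k := Dsg k Q in
  [/\ [/\ forall a : arr Q, on_diff_cycle a -> indecomposable (L k a : D),
          forall a b : arr Q, on_diff_cycle a -> on_diff_cycle b ->
            isomorphic (L k a : D) (L k b : D) -> a = b
        & forall X : D, indecomposable X ->
            exists2 a : arr Q, on_diff_cycle a & isomorphic (L k a : D) X],
      forall a b : arr Q, on_diff_cycle a -> on_diff_cycle b ->
        hom_dim (L k a : D) (L k b : D) (a == b)
    & forall a : arr Q, on_diff_cycle a ->
        [/\ exists T, is_dtensor (galg_R hQ k) (L k a) T,
            forall T, is_dtensor (galg_R hQ k) (L k a) T ->
              isomorphic (T : D) (L k a : D)
          & exists r : arr Q,
              unique (fun r' => src r' = tgt a /\ zrel r' a) r /\
              isomorphic (bunshift (L k a) : D) (L k r : D)]].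
Proof.
move=> D; split; first split.
- by move=> a; exact: L_indecomposable.
- by move=> a b ad _; exact: L_inj.
- by move=> X; exact: classify.
- by move=> a b ad _; exact: hom_dim_L.
move=> a ad; have [b [ba bz _]] := diff_seq 0 ad; split.
- by exists (L k a); exact: (L_dtensor hQ k ba bz).
- by move=> T; exact: (L_dtensor_unique ba bz).
have [r ar _] := diff_cycle_next ad; exists r; split; last exact: (unshift_L hQ k ad ar).
have /andP[/eqP sr zr] := ar; split=> // r' [sr' zr'].
by apply: (zstep_uniq hQ ar); rewrite /zstep sr' eqxx.
Qed.
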